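(* Let $a$ be a complex number with $\operatorname{Re} a>0$. Then $$\gamma_0(a)=-\psi(a)=\frac{1}{2a}-\ln a+\frac{1}{2\pi i a}\int_0^1\left[\frac{1}{1-\frac{\ln(1-u)}{2\pi i a}}-\frac{1}{1+\frac{\ln(1-u)}{2\pi i a}}\right]\frac{du}{u}.$$
   Context: For $\operatorname{Re} a>0$, the Hurwitz zeta function is $\zeta(s,a)=\sum_{n=0}^\infty (n+a)^{-s}$ for $\operatorname{Re} s>1$ (principal branch of powers), continued analytically in $s$ to $\mathbb{C}\setminus\{1\}$ with a simple pole at $s=1$. The Stieltjes constants $\gamma_n(a)$, $n\ge 0$, are defined by the Laurent expansion about $s=1$, $$\zeta(s,a)=\frac{1}{s-1}+\sum_{n=0}^\infty\frac{(-1)^n}{n!}\gamma_n(a)(s-1)^n.$$ $\psi=\Gamma'/\Gamma$ is the digamma function. $\ln$ denotes the principal branch of the logarithm. *)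

(* Defs.v *)
(* Stdlib world: Stdlib reals, Coquelicot complex numbers, series, derivatives
   and generalized (improper) integrals. *)
From Stdlib Require Import Reals Factorial.
From Coquelicot Require Import Coquelicot.

Open Scope R_scope.

Definition Cexp (z : C) : C :=
  (exp (Re z) * cos (Im z), exp (Re z) * sin (Im z)).

(* Principal argument, in ]-PI, PI] for z <> 0. *)
Definition Carg (z : C) : R :=
  if Rle_dec 0 (Im z) then acos (Re z / Cmod z) else - acos (Re z / Cmod z).

Definition Clog (z : C) : C := (ln (Cmod z), Carg z).

Definition Cpower (z w : C) : C := Cexp (w * Clog z)%C.

(* Euler's integral; meaningful for 0 < Re z, which is an open set, so that
   complex derivatives at its points do not see the other values. *)
Definition Gamma (z : C) : C :=
  RInt_gen (V := C_R_CompleteNormedModule)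
    (fun t : R => (Cpower (RtoC t) (z - 1) * RtoC (exp (- t)))%C)
    (at_right 0) (Rbar_locally p_infty).

Definition digamma (z : C) : C := (C_derive Gamma z / Gamma z)%C.

(* [Z] is the function s |-> zeta(s, a): it is complex differentiable on the
   connected open set C \ {1}, hence is determined there by its values for
   1 < Re s. [Z 1] is unconstrained. *)
Definition is_hurwitz_zeta (a : C) (Z : C -> C) : Prop :=
  (forall s : C, 1 < Re s ->
     is_series (K := C_AbsRing) (V := C_NormedModule)
       (fun n : nat => Cpower (RtoC (INR n) + a)%C (- s)%C) (Z s)) /\
  (forall s : C, s <> RtoC 1 ->
     ex_derive (K := C_AbsRing) (V := C_NormedModule) Z s).

(* [g n] is the n-th Stieltjes constant: the Laurent expansion holds in some
   punctured disc about 1, which determines [g]. *)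
Definition is_stieltjes (a : C) (g : nat -> C) : Prop :=
  exists Z : C -> C, is_hurwitz_zeta a Z /\
  exists r : R, 0 < r /\
    forall s : C, 0 < Cmod (s - 1)%C < r ->
      is_series (K := C_AbsRing) (V := C_NormedModule)
        (fun n : nat =>
           (RtoC ((-1) ^ n / INR (fact n)) * g n * (s - 1) ^ n)%C)
        (Z s - 1 / (s - 1))%C.

(* Main.v *)
(* Both expressions are limits of S_n = sum_(k<n) 1/(a+k) - ln n.

   Digamma: with X = Re a + n, the measure t^(X-1) e^(-t) dt concentrates near t = n, because
   ln(t/n)^2 <= t/n + n/t - 2 and the moments of order +1 and -1 are explicit. Hence
   Gamma(a+n) ~ n^(i Im a) Gamma(X), which is nonzero, and digamma(a+n) - ln n -> 0; the
   functional equation then gives S_n -> - digamma a.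

   Zeta: for 1 < s <= 2 the tail of the series differs from (N+a)^(1-s)/(s-1) by at most 2/(N-1),
   uniformly in s. Letting s -> 1+ and then N -> oo, S_n -> gamma_0(a).

   Integral: u = 1 - e^(-2 pi t) turns it into J(a) = int_0^oo 2t/(t^2+a^2) dt/(e^(2 pi t)-1).
   Partial fractions write 1/(e^(2 pi t)-1) as
   1/(2 pi t) - 1/2 + (1/pi) sum_(k<=m) t/(t^2+k^2) + r_m(t) with 0 <= r_m(t) <= t/(pi m).
   Integrating termwise against 2t/(t^2+a^2) - 2t/(t^2+(a+1)^2), with primitives built from
   Log(a +- it), gives the difference equation of 1/(2a) - Log a + J(a), and J(a+n) -> 0. *)

Require Import Defs.
From Stdlib Require Import Reals Factorial Lra Lia Psatz.
From Coquelicot Require Import Coquelicot.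

Open Scope R_scope.

(** Every curve in the complex plane below is parametrised by a real variable, so complex analysis
    reduces to real derivatives of two components: [C_derive] is itself a limit along a horizontal
    line, and zeta is approached along real [s]. Each exchange of a limit with an integral or a sum
    rests on an explicit bound.

    Three obstacles shape the proof. For complex [a] no convexity argument identifies the growth of
    Gamma, hence the concentration estimate; it must also supply the nonvanishing of Gamma, without
    which [digamma] is an uncontrolled quotient. The constant [-1/2] of the partial fractions cannot
    be integrated against [2t/(t^2+a^2)], which decays like [2/t]; only a difference of two such
    kernels converges, so [J] is characterised by its increments and its decay instead of being
    computed. Finally, the partial fraction remainder must be small for all [t] at once, at the
    price of growth in [t]; realising it as a quotient of two integrals of powers of the cosine
    makes its sign and its size visible. *)

Lemma Cmod_sqr (z : C) : Cmod z * Cmod z = fst z * fst z + snd z * snd z.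
Proof.
unfold Cmod. rewrite sqrt_sqrt; nra.
Qed.

Lemma Cmod_norm_R (z : C) : norm (V := C_R_NormedModule) z = Cmod z.
Proof.
change (sqrt (Rabs (fst z) ^ 2 + Rabs (snd z) ^ 2) = Cmod z).
now rewrite !pow2_abs.
Qed.

Lemma Rabs_fst_le (z : C) : Rabs (fst z) <= Cmod z.
Proof. eapply Rle_trans; [apply Rmax_l|apply Rmax_Cmod]. Qed.

Lemma Rabs_snd_le (z : C) : Rabs (snd z) <= Cmod z.
Proof. eapply Rle_trans; [apply Rmax_r|apply Rmax_Cmod]. Qed.

Lemma Cmod_le_abs (z : C) : Cmod z <= Rabs (fst z) + Rabs (snd z).
Proof.
assert (Hu := Rabs_pos (fst z)). assert (Hv := Rabs_pos (snd z)).
apply Rsqr_incr_0_var; [|lra]. unfold Rsqr. rewrite Cmod_sqr.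
assert (H1 := Rsqr_abs (fst z)). assert (H2 := Rsqr_abs (snd z)). unfold Rsqr in *. nra.
Qed.

Lemma filterlim_C {T} (F : (T -> Prop) -> Prop) {FF : Filter F} (f : T -> C) (l : C) :
  filterlim (fun t => fst (f t)) F (locally (fst l)) ->
  filterlim (fun t => snd (f t)) F (locally (snd l)) ->
  filterlim f F (locally l).
Proof.
intros H1 H2.
apply filterlim_locally. intros eps.
generalize (filter_and _ _ (proj1 (filterlim_locally _ _) H1 eps) (proj1 (filterlim_locally _ _) H2 eps)).
apply filter_imp. intros x Hx; exact Hx.
Qed.

(** * Differentiable curves in the complex plane *)

(** Two real derivatives rather than one derivative in a normed module: the rules for inverse,
    exponential and logarithm then come from [auto_derive] on real expressions, and the real mean
    value theorem stays within reach. *)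
Definition cder (f : R -> C) (t : R) (l : C) : Prop :=
  is_derive (fun s => fst (f s)) t (fst l) /\ is_derive (fun s => snd (f s)) t (snd l).

Definition ccont (f : R -> C) (t : R) : Prop :=
  continuous (fun s => fst (f s)) t /\ continuous (fun s => snd (f s)) t.

Definition ex_cder (f : R -> C) (t : R) : Prop := exists l, cder f t l.

Lemma cder_ccont f t l : cder f t l -> ccont f t.
Proof.
intros [H1 H2]; split; apply (ex_derive_continuous (V := R_NormedModule)); eexists; eassumption.
Qed.

Lemma ccont_continuous f t : ccont f t -> continuous (U := C_R_NormedModule) f t.
Proof. intros [H1 H2]. exact (filterlim_C (locally t) f (f t) H1 H2). Qed.

Lemma cder_eq f t l l' : cder f t l -> l = l' -> cder f t l'.
Proof. now intros H <-. Qed.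

Lemma cder_unique f t l l' : cder f t l -> cder f t l' -> l = l'.
Proof.
intros [H1 H2] [H3 H4]. apply is_derive_unique in H1, H2, H3, H4.
apply injective_projections; [exact (eq_trans (eq_sym H1) H3)|exact (eq_trans (eq_sym H2) H4)].
Qed.

Lemma cder_ext_loc f g t l : locally t (fun s => f s = g s) -> cder f t l -> cder g t l.
Proof.
intros H [H1 H2]; split.
- apply is_derive_ext_loc with (2 := H1). revert H; apply filter_imp. now intros s ->.
- apply is_derive_ext_loc with (2 := H2). revert H; apply filter_imp. now intros s ->.
Qed.

Lemma cder_ext f g t l : (forall s, f s = g s) -> cder f t l -> cder g t l.
Proof. intros H. apply cder_ext_loc. apply filter_forall, H. Qed.

Lemma cder_const (c : C) t : cder (fun _ => c) t 0%C.
Proof. split; apply (is_derive_const (V := R_NormedModule)). Qed.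

Lemma cder_RtoC f t l : is_derive f t l -> cder (fun s => RtoC (f s)) t (RtoC l).
Proof. intros H; split; simpl; [exact H|apply (is_derive_const (V := R_NormedModule))]. Qed.

Lemma cder_id t : cder (fun s => RtoC s) t 1%C.
Proof. apply (cder_RtoC (fun s => s)), (is_derive_id (K := R_AbsRing)). Qed.

Lemma cder_plus f g t lf lg : cder f t lf -> cder g t lg ->
  cder (fun s => f s + g s)%C t (lf + lg)%C.
Proof.
intros [H1 H2] [H3 H4]; split.
- apply (is_derive_plus (V := R_NormedModule)); assumption.
- apply (is_derive_plus (V := R_NormedModule)); assumption.
Qed.

Lemma cder_opp f t lf : cder f t lf -> cder (fun s => - f s)%C t (- lf)%C.
Proof.
intros [H1 H2]; split.
- apply (is_derive_opp (V := R_NormedModule)); assumption.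
- apply (is_derive_opp (V := R_NormedModule)); assumption.
Qed.

Lemma cder_minus f g t lf lg : cder f t lf -> cder g t lg ->
  cder (fun s => f s - g s)%C t (lf - lg)%C.
Proof. intros H1 H2. apply cder_plus; [|apply cder_opp]; assumption. Qed.

Lemma cder_mult f g t lf lg : cder f t lf -> cder g t lg ->
  cder (fun s => f s * g s)%C t (lf * g t + f t * lg)%C.
Proof.
intros [H1 H2] [H3 H4].
assert (E : forall u v : R -> R, forall du dv, is_derive u t du -> is_derive v t dv ->
   is_derive (fun s => u s * v s) t (du * v t + u t * dv)).
{ intros u v du dv Hu Hv. apply (is_derive_mult u v t du dv Hu Hv). apply Rmult_comm. }
split; simpl.
- replace (_ + _) with (fst lf * fst (g t) + fst (f t) * fst lg - (snd lf * snd (g t) + snd (f t) * snd lg)) by ring.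
  apply (is_derive_minus (V := R_NormedModule)); apply E; assumption.
- replace (_ + _) with (fst lf * snd (g t) + fst (f t) * snd lg + (snd lf * fst (g t) + snd (f t) * fst lg)) by ring.
  apply (is_derive_plus (V := R_NormedModule)); apply E; assumption.
Qed.

Lemma cder_scal (c : C) f t l : cder f t l -> cder (fun s => c * f s)%C t (c * l)%C.
Proof.
intros H. eapply cder_eq. apply (cder_mult (fun _ => c) f). apply cder_const. exact H. ring.
Qed.

Lemma cder_inv f t l : cder f t l -> f t <> 0%C -> cder (fun s => / f s)%C t (- l / (f t * f t))%C.
Proof.
intros [H1 H2] H0.
assert (Hn : fst (f t) * (fst (f t) * 1) + snd (f t) * (snd (f t) * 1) <> 0).
{ intros E. apply H0. apply injective_projections; simpl; nra. }
assert (Hn2 : fst (f t) ^ 2 + snd (f t) ^ 2 <> 0) by exact Hn.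
(* The squared modulus of [f t * f t], the denominator that appears once the complex division in the
   claimed derivative is unfolded. *)
assert (Hn3 : (fst (f t) * fst (f t) - snd (f t) * snd (f t)) ^ 2 + (fst (f t) * snd (f t) + snd (f t) * fst (f t)) ^ 2 <> 0).
{ replace (_ + _) with ((fst (f t) ^ 2 + snd (f t) ^ 2) ^ 2) by ring. now apply pow_nonzero. }
destruct l as [l1 l2]; simpl in H1, H2.
assert (Eu : ex_derive (fun s => fst (f s)) t) by (eexists; eassumption).
assert (Ev : ex_derive (fun s => snd (f s)) t) by (eexists; eassumption).
apply is_derive_unique in H1, H2.
set (u := fun s => fst (f s)) in *. set (v := fun s => snd (f s)) in *.
fold (u t) (v t) in Hn, Hn2, Hn3.
split; simpl.
- change (is_derive (fun s => u s / (u s * (u s * 1) + v s * (v s * 1))) t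
    (- l1 * ((u t * u t - v t * v t) / ((u t * u t - v t * v t) * ((u t * u t - v t * v t) * 1) + (u t * v t + v t * u t) * ((u t * v t + v t * u t) * 1)))
    - - l2 * (- (u t * v t + v t * u t) / ((u t * u t - v t * v t) * ((u t * u t - v t * v t) * 1) + (u t * v t + v t * u t) * ((u t * v t + v t * u t) * 1))))).
  auto_derive.
  + repeat split; assumption.
  + change (Derive (fun x => u x) t) with (Derive u t). change (Derive (fun x => v x) t) with (Derive v t).
    rewrite H1, H2. field. split; intros E; [apply Hn3|apply Hn2]; rewrite <- E; ring.
- change (is_derive (fun s => - v s / (u s * (u s * 1) + v s * (v s * 1))) t
    (- l1 * (- (u t * v t + v t * u t) / ((u t * u t - v t * v t) * ((u t * u t - v t * v t) * 1) + (u t * v t + v t * u t) * ((u t * v t + v t * u t) * 1)))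
    + - l2 * ((u t * u t - v t * v t) / ((u t * u t - v t * v t) * ((u t * u t - v t * v t) * 1) + (u t * v t + v t * u t) * ((u t * v t + v t * u t) * 1))))).
  auto_derive.
  + repeat split; assumption.
  + change (Derive (fun x => u x) t) with (Derive u t). change (Derive (fun x => v x) t) with (Derive v t).
    rewrite H1, H2. field. split; intros E; [apply Hn3|apply Hn2]; rewrite <- E; ring.
Qed.

Lemma cder_Cexp f t l : cder f t l -> cder (fun s => Cexp (f s)) t (l * Cexp (f t))%C.
Proof.
intros [H1 H2]. destruct l as [l1 l2]; simpl in *.
set (u := fun s => fst (f s)) in *. set (v := fun s => snd (f s)) in *.
assert (Eu : ex_derive u t) by (eexists; eassumption).
assert (Ev : ex_derive v t) by (eexists; eassumption).
apply is_derive_unique in H1, H2.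
split; simpl.
- change (is_derive (fun s => exp (u s) * cos (v s)) t (l1 * (exp (u t) * cos (v t)) - l2 * (exp (u t) * sin (v t)))).
  auto_derive. now split.
  change (Derive (fun x => u x) t) with (Derive u t). change (Derive (fun x => v x) t) with (Derive v t).
  rewrite H1, H2; ring.
- change (is_derive (fun s => exp (u s) * sin (v s)) t (l1 * (exp (u t) * sin (v t)) + l2 * (exp (u t) * cos (v t)))).
  auto_derive. now split.
  change (Derive (fun x => u x) t) with (Derive u t). change (Derive (fun x => v x) t) with (Derive v t).
  rewrite H1, H2; ring.
Qed.

(** * The principal logarithm on the right half-plane *)

Lemma Carg_atan (z : C) : 0 < fst z -> Carg z = atan (snd z / fst z).
Proof.
destruct z as [x y]; simpl; intros Hx.
assert (Hm : 0 < Cmod (x, y)).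
{ apply Cmod_gt_0. intros E; injection E; lra. }
assert (Hq : 0 < x / Cmod (x, y)) by (apply Rdiv_lt_0_compat; assumption).
unfold Carg; simpl.
assert (Hs : acos (x / Cmod (x, y)) = atan (Rabs y / x)).
{ rewrite acos_atan by exact Hq. f_equal.
  replace (1 - (x / Cmod (x, y))²) with ((Rabs y / Cmod (x, y))²).
  - rewrite sqrt_Rsqr. field; split; lra.
    apply Rle_mult_inv_pos; [apply Rabs_pos|exact Hm].
  - assert (Hc := Cmod_sqr (x, y)). simpl in Hc.
    rewrite !Rsqr_div'. rewrite <- Rsqr_abs. unfold Rsqr. rewrite Hc. field. nra. }
rewrite Hs. destruct (Rle_dec 0 y) as [Hy|Hy].
- now rewrite Rabs_pos_eq.
- rewrite Rabs_left by lra. rewrite <- atan_opp. f_equal. field; lra.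
Qed.

(** On the right half-plane the case distinction on the sign of [Im z] disappears; this form can be
    differentiated across the real axis. *)
Lemma Clog_atan (z : C) : 0 < fst z -> Clog z = (ln (Cmod z), atan (snd z / fst z)).
Proof. intros H; unfold Clog. now rewrite Carg_atan. Qed.

Lemma Cexp_Clog (z : C) : 0 < fst z -> Cexp (Clog z) = z.
Proof.
intros Hx. rewrite Clog_atan by exact Hx. unfold Cexp; simpl.
assert (Hm : 0 < Cmod z).
{ apply Cmod_gt_0. intros E; rewrite E in Hx; simpl in Hx; lra. }
rewrite exp_ln by exact Hm.
assert (Hc := Cmod_sqr z). destruct z as [x y]; simpl in *.
rewrite cos_atan, sin_atan.
replace (sqrt (1 + (y / x)²)) with (Cmod (x, y) / x).
- apply injective_projections; simpl; field; lra.
- symmetry. apply Rsqr_inj. apply sqrt_pos. apply Rlt_le, Rdiv_lt_0_compat; lra.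
  rewrite Rsqr_sqrt. rewrite !Rsqr_div'. unfold Rsqr. rewrite Hc. field; lra.
  assert (H := Rle_0_sqr (y / x)); lra.
Qed.

Lemma cder_Clog f t l : cder f t l -> 0 < fst (f t) -> cder (fun s => Clog (f s)) t (l / f t)%C.
Proof.
intros H Hx.
assert (Hc := cder_ccont _ _ _ H). destruct H as [H1 H2], Hc as [Hc _].
apply cder_ext_loc with (f := fun s => (ln (Cmod (f s)), atan (snd (f s) / fst (f s)))).
{ generalize (Hc _ (open_gt 0 (fst (f t)) Hx)).
  intros L; unfold filtermap in L. revert L; apply filter_imp.
  intros s Hs. symmetry; now apply Clog_atan. }
clear Hc.
destruct l as [l1 l2]; simpl in *. unfold Cmod.
set (u := fun s => fst (f s)) in *. set (v := fun s => snd (f s)) in *.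
assert (Eu : ex_derive u t) by (eexists; eassumption).
assert (Ev : ex_derive v t) by (eexists; eassumption).
apply is_derive_unique in H1, H2.
assert (Hu : 0 < u t) by exact Hx.
split; simpl.
- change (is_derive (fun s => ln (sqrt (u s ^ 2 + v s ^ 2))) t (l1 * (u t / (u t * (u t * 1) + v t * (v t * 1))) - l2 * (- v t / (u t * (u t * 1) + v t * (v t * 1))))).
  assert (Hp : 0 < u t ^ 2 + v t ^ 2) by nra.
  assert (Hs := sqrt_lt_R0 _ Hp).
  auto_derive.
  + repeat split; try assumption; nra.
  + change (Derive (fun x => u x) t) with (Derive u t). change (Derive (fun x => v x) t) with (Derive v t).
    rewrite H1, H2.
    replace (u t * (u t * 1) + v t * (v t * 1)) with (u t ^ 2 + v t ^ 2) in * by ring.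
    assert (Hss := sqrt_sqrt (u t ^ 2 + v t ^ 2) ltac:(lra)).
    set (q := sqrt (u t ^ 2 + v t ^ 2)) in *.
    rewrite <- Hss. field; lra.
- change (is_derive (fun s => atan (v s / u s)) t (l1 * (- v t / (u t * (u t * 1) + v t * (v t * 1))) + l2 * (u t / (u t * (u t * 1) + v t * (v t * 1))))).
  auto_derive.
  + repeat split; try assumption. lra.
  + change (Derive (fun x => u x) t) with (Derive u t). change (Derive (fun x => v x) t) with (Derive v t).
    rewrite H1, H2. unfold Rsqr. field. repeat split; nra.
Qed.

(** * A mean value inequality and hyperbolic estimates *)

Lemma ex_derive_continuity_pt (f : R -> R) x : ex_derive f x -> continuity_pt f x.
Proof.
intros H. apply continuity_pt_filterlim. exact (ex_derive_continuous (V := R_NormedModule) f x H).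
Qed.

(** A complex curve satisfies no mean value equality, but its projection [h] on the direction of the
    increment [w] does. The increment of [h] is [|w|^2], while Cauchy-Schwarz bounds its derivative
    by [|w| M]. *)
Lemma cder_bound f f' M a b : a <= b ->
  (forall s, a <= s <= b -> cder f s (f' s)) ->
  (forall s, a <= s <= b -> Cmod (f' s) <= M) ->
  Cmod (f b - f a) <= M * (b - a).
Proof.
intros Hab Hd HM.
set (w := (f b - f a)%C).
assert (Hw := Cmod_ge_0 w).
set (h := fun s => fst w * fst (f s) + snd w * snd (f s)).
set (h' := fun s => fst w * fst (f' s) + snd w * snd (f' s)).
assert (Hh : forall s, a <= s <= b -> is_derive h s (h' s)).
{ intros s Hs. destruct (Hd s Hs) as [H1 H2].
  apply (is_derive_plus (V := R_NormedModule)); apply is_derive_scal; assumption. }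
destruct (MVT_gen h a b h') as [c [Hc E]].
- intros s Hs. rewrite Rmin_left, Rmax_right in Hs by lra. apply Hh; lra.
- intros s Hs. rewrite Rmin_left, Rmax_right in Hs by lra.
  apply ex_derive_continuity_pt. eexists; apply Hh; lra.
- rewrite Rmin_left, Rmax_right in Hc by lra.
  assert (E2 : h b - h a = Cmod w * Cmod w).
  { rewrite Cmod_sqr. unfold h. replace (fst (f b)) with (fst w + fst (f a)) by (simpl; ring).
    replace (snd (f b)) with (snd w + snd (f a)) by (simpl; ring). ring. }
  assert (H3 : h' c <= Cmod w * M).
  { apply Rle_trans with (Cmod w * Cmod (f' c)).
    - assert (Hv := Cmod_ge_0 (f' c)).
      apply Rsqr_incr_0_var; [|nra]. unfold Rsqr, h'.
      replace (_ * _) with ((fst w * fst (f' c) + snd w * snd (f' c)) ^ 2) by ring.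
      replace (Cmod w * Cmod (f' c) * _) with ((Cmod w * Cmod w) * (Cmod (f' c) * Cmod (f' c))) by ring.
      rewrite !Cmod_sqr. assert (Hq := pow2_ge_0 (fst w * snd (f' c) - snd w * fst (f' c))). nra.
    - apply Rmult_le_compat_l. assumption. now apply HM. }
  destruct (Req_dec (Cmod w) 0) as [Z|Z].
  + rewrite Z. assert (0 <= M). { apply Rle_trans with (2 := HM a ltac:(lra)). apply Cmod_ge_0. } nra.
  + apply Rmult_le_reg_l with (Cmod w). lra. rewrite <- E2, E. nra.
Qed.

Lemma sinh_ge w : 0 <= w -> 2 * w <= exp w - exp (- w).
Proof.
intros Hw.
destruct (MVT_gen (fun x => exp x - exp (- x) - 2 * x) 0 w (fun x => exp x + exp (- x) - 2)) as [c [Hc E]].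
- intros x _. auto_derive. exact I. ring.
- intros x _. apply ex_derive_continuity_pt. auto_derive. exact I.
- cbv beta in E. rewrite Ropp_0, exp_0 in E.
  assert (0 <= exp c + exp (- c) - 2).
  { assert (H : exp c * exp (- c) = 1) by (rewrite <- exp_plus, Rplus_opp_r; apply exp_0).
    assert (Hp := exp_pos c). assert (Hq := exp_pos (- c)). assert (Hs := pow2_ge_0 (exp c - exp (- c))). nra. }
  nra.
Qed.

(** The right-hand side is the square of [exp (v/2) - exp (-v/2)], so this is [sinh_ge] at
    [|v| / 2], squared. Used at multiples and differences of logarithms, it trades powers of [ln t]
    for powers of [t]. *)
Lemma cosh_ge (v : R) : v * v <= exp v + exp (- v) - 2.
Proof.
assert (Q : forall w, 0 <= w -> w * w <= exp w + exp (- w) - 2).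
{ intros w Hw. assert (P := sinh_ge (w / 2) ltac:(lra)).
  assert (E1 : exp w = exp (w / 2) * exp (w / 2)) by (rewrite <- exp_plus; f_equal; lra).
  assert (E2 : exp (- w) = exp (- (w / 2)) * exp (- (w / 2))) by (rewrite <- exp_plus; f_equal; lra).
  assert (H : exp (w / 2) * exp (- (w / 2)) = 1) by (rewrite <- exp_plus, Rplus_opp_r; apply exp_0).
  nra. }
destruct (Rle_dec 0 v) as [H|H].
- now apply Q.
- specialize (Q (- v) ltac:(lra)). rewrite Ropp_involutive in Q. nra.
Qed.

(** The same square bounded above: for [w >= 0], [1 - exp (-w) <= w] gives
    [exp (w/2) - exp (-w/2) <= w exp (w/2)]. *)
Lemma cosh_le (v : R) : exp v + exp (- v) - 2 <= v * v * (exp v + exp (- v)).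
Proof.
assert (Q : forall w, 0 <= w -> exp w + exp (- w) - 2 <= w * w * exp w).
{ intros w Hw.
  assert (E1 : exp w = exp (w / 2) * exp (w / 2)) by (rewrite <- exp_plus; f_equal; lra).
  assert (E2 : exp (- w) = exp (- (w / 2)) * exp (- (w / 2))) by (rewrite <- exp_plus; f_equal; lra).
  assert (H : exp (w / 2) * exp (- (w / 2)) = 1) by (rewrite <- exp_plus, Rplus_opp_r; apply exp_0).
  assert (H1 := exp_ineq1_le (- w)).
  assert (Hp := exp_pos (w / 2)). assert (Hq := exp_pos (- (w / 2))).
  assert (Hd : 0 <= exp (w / 2) - exp (- (w / 2)) <= w * exp (w / 2)).
  { split.
    - assert (H2 := exp_ineq1_le (w / 2)). assert (exp (- (w / 2)) <= 1); [|lra].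
      rewrite <- exp_0. destruct Hw as [Hw| <-]. left; apply exp_increasing; lra. right; f_equal; lra.
    - rewrite E2 in H1.
      apply Rmult_le_reg_r with (exp (- (w / 2))). assumption. nra. }
  nra. }
assert (Hp := exp_pos v). assert (Hq := exp_pos (- v)).
destruct (Rle_dec 0 v) as [H|H].
- specialize (Q v H). nra.
- specialize (Q (- v) ltac:(lra)). rewrite Ropp_involutive in Q. nra.
Qed.

(** * Limits of complex-valued functions *)

(** Neighbourhoods in the product space [C] are componentwise; stating limits with the modulus lets
    the triangle inequality and multiplicativity act directly. *)
Definition Clim {T} (F : (T -> Prop) -> Prop) (f : T -> C) (l : C) : Prop :=
  forall eps, 0 < eps -> F (fun t => Cmod (f t - l) < eps).

Section Clim.
Context {T : Type} (F : (T -> Prop) -> Prop) {FF : Filter F}.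

Lemma Clim_filterlim (f : T -> C) l : Clim F f l -> filterlim f F (locally l).
Proof.
intros H. apply filterlim_locally. intros eps.
generalize (H eps (cond_pos eps)). apply filter_imp. intros x Hx.
split; apply Rle_lt_trans with (2 := Hx).
- exact (Rabs_fst_le (f x - l)).
- exact (Rabs_snd_le (f x - l)).
Qed.

Lemma filterlim_Clim (f : T -> C) l : filterlim f F (locally l) -> Clim F f l.
Proof.
intros H eps He.
assert (He' : 0 < eps / 2) by lra.
generalize (proj1 (filterlim_locally _ _) H (mkposreal _ He')).
apply filter_imp. intros x [H1 H2].
change (Rabs (fst (f x) - fst l) < eps / 2) in H1.
change (Rabs (snd (f x) - snd l) < eps / 2) in H2.
apply Rle_lt_trans with (1 := Cmod_le_abs _).
change (Rabs (fst (f x) - fst l) + Rabs (snd (f x) - snd l) < eps). lra.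
Qed.

Lemma Clim_le (f : T -> C) (g : T -> R) l :
  F (fun t => Cmod (f t - l) <= g t) -> filterlim g F (locally 0) -> Clim F f l.
Proof.
intros H Hg eps He.
generalize (filter_and _ _ H (proj1 (filterlim_locally _ _) Hg (mkposreal _ He))).
apply filter_imp. intros x [H1 H2].
change (Rabs (g x - 0) < eps) in H2. rewrite Rminus_0_r in H2.
apply Rabs_def2 in H2. lra.
Qed.

Lemma Clim_ext (f g : T -> C) l : F (fun t => f t = g t) -> Clim F f l -> Clim F g l.
Proof.
intros H Hf eps He. generalize (filter_and _ _ H (Hf eps He)).
apply filter_imp. now intros x [-> H2].
Qed.

Lemma Clim_const (c : C) : Clim F (fun _ => c) c.
Proof.
intros eps He. apply filter_forall. intros _. replace (c - c)%C with (RtoC 0) by ring. now rewrite Cmod_0.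
Qed.

Lemma Clim_plus (f g : T -> C) l m : Clim F f l -> Clim F g m -> Clim F (fun t => f t + g t)%C (l + m)%C.
Proof.
intros Hf Hg eps He.
assert (He2 : 0 < eps / 2) by lra.
generalize (filter_and _ _ (Hf _ He2) (Hg _ He2)).
apply filter_imp. intros x [H1 H2].
replace (f x + g x - (l + m))%C with ((f x - l) + (g x - m))%C by ring.
apply Rle_lt_trans with (1 := Cmod_triangle _ _). lra.
Qed.

Lemma Clim_scal (c : C) (f : T -> C) l : Clim F f l -> Clim F (fun t => c * f t)%C (c * l)%C.
Proof.
intros Hf eps He. assert (Hc := Cmod_ge_0 c).
assert (He' : 0 < eps / (Cmod c + 1)) by (apply Rdiv_lt_0_compat; lra).
generalize (Hf _ He'). apply filter_imp. intros x H1.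
replace (c * f x - c * l)%C with (c * (f x - l))%C by ring. rewrite Cmod_mult.
apply Rlt_div_r in H1; [|lra]. assert (Hd := Cmod_ge_0 (f x - l)). nra.
Qed.

Lemma Clim_minus (f g : T -> C) l m : Clim F f l -> Clim F g m -> Clim F (fun t => f t - g t)%C (l - m)%C.
Proof.
intros Hf Hg. apply Clim_ext with (f := fun t => (f t + - RtoC 1 * g t)%C).
- apply filter_forall. intros; ring.
- replace (l - m)%C with (l + - RtoC 1 * m)%C by ring. apply Clim_plus. assumption. now apply Clim_scal.
Qed.

Lemma Clim_RtoC (f : T -> R) l : filterlim f F (locally l) -> Clim F (fun t => RtoC (f t)) (RtoC l).
Proof.
intros H eps He. generalize (proj1 (filterlim_locally _ _) H (mkposreal _ He)).
apply filter_imp. intros x Hx. rewrite <- RtoC_minus, Cmod_R. exact Hx.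
Qed.

Lemma Clim_Cmod_le (f : T -> C) l M : ProperFilter F -> Clim F f l -> F (fun t => Cmod (f t) <= M) -> Cmod l <= M.
Proof.
intros PF Hf HM. apply Rnot_lt_le. intros Hl.
assert (He : 0 < Cmod l - M) by lra.
destruct (filter_ex (F := F) _ (filter_and _ _ (Hf _ He) HM)) as [x [H1 H2]].
assert (H3 := Cmod_triangle (f x) (- (f x - l))). rewrite Cmod_opp in H3.
replace (f x + - (f x - l))%C with l in H3 by ring. lra.
Qed.

Lemma Clim_unique (f : T -> C) l m : ProperFilter F -> Clim F f l -> Clim F f m -> l = m.
Proof.
intros PF Hl Hm.
assert (H : Cmod (l - m) <= 0).
{ apply (Clim_Cmod_le (fun t => f t - f t)%C). exact PF.
  now apply Clim_minus. apply filter_forall. intros x. replace (f x - f x)%C with (RtoC 0) by ring.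
  rewrite Cmod_0; lra. }
assert (H0 : (l - m)%C = 0%C). { apply Cmod_eq_0. generalize (Cmod_ge_0 (l - m)). lra. }
replace l with (l - m + m)%C by ring. rewrite H0. ring.
Qed.

End Clim.

(** * Improper integrals over the half-line *)

Notation is_Cint f l := (is_RInt_gen (V := C_R_CompleteNormedModule) f (at_right 0) (Rbar_locally p_infty) l).
Notation is_Rint f l := (is_RInt_gen (V := R_CompleteNormedModule) f (at_right 0) (Rbar_locally p_infty) l).

Lemma filter_prod_pos (P : R * R -> Prop) :
  (forall a b, 0 < a < 1 -> 1 < b -> P (a, b)) -> filter_prod (at_right 0) (Rbar_locally p_infty) P.
Proof.
intros H. apply Filter_prod with (fun a => 0 < a < 1) (fun b => 1 < b).
- exists (mkposreal 1 Rlt_0_1). intros y Hy Hy0. change (Rabs (y - 0) < 1) in Hy.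
  apply Rabs_def2 in Hy. lra.
- now exists 1.
- exact H.
Qed.

Lemma is_RInt_primitive_C f F a b : (forall t, Rmin a b <= t <= Rmax a b -> cder F t (f t)) ->
  (forall t, Rmin a b <= t <= Rmax a b -> ex_cder f t) ->
  is_RInt (V := C_R_NormedModule) f a b (F b - F a)%C.
Proof.
intros HF Hf.
replace (F b - F a)%C with (fst (F b) - fst (F a), snd (F b) - snd (F a)) by reflexivity.
apply (is_RInt_fct_extend_pair (U := R_NormedModule) (V := R_NormedModule)).
- apply (is_RInt_derive (V := R_CompleteNormedModule) (fun t => fst (F t))).
  + intros t Ht. apply (HF t Ht).
  + intros t Ht. destruct (Hf t Ht) as [l Hl]. apply (cder_ccont _ _ _ Hl).
- apply (is_RInt_derive (V := R_CompleteNormedModule) (fun t => snd (F t))).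
  + intros t Ht. apply (HF t Ht).
  + intros t Ht. destruct (Hf t Ht) as [l Hl]. apply (cder_ccont _ _ _ Hl).
Qed.

Lemma is_Cint_primitive (f F : R -> C) l0 l1 :
  (forall t, 0 < t -> cder F t (f t)) -> (forall t, 0 < t -> ex_cder f t) ->
  Clim (at_right 0) F l0 -> Clim (Rbar_locally p_infty) F l1 -> is_Cint f (l1 - l0)%C.
Proof.
intros HF Hf H0 H1.
apply (filterlimi_lim_ext_loc (U := C) (fun ab : R * R => F (snd ab) - F (fst ab))%C).
- apply filter_prod_pos. intros a b Ha Hb. simpl.
  apply is_RInt_primitive_C; intros t Ht; rewrite Rmin_left, Rmax_right in Ht by lra; [apply HF|apply Hf]; lra.
- apply (Clim_filterlim (filter_prod (at_right 0) (Rbar_locally p_infty))).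
  apply Clim_minus; [apply filter_prod_filter; typeclasses eauto| |].
  + intros eps He. exact (Filter_prod _ _ _ _ _ filter_true (H1 eps He) (fun x y _ Hy => Hy)).
  + intros eps He. exact (Filter_prod _ _ _ _ _ (H0 eps He) filter_true (fun x y Hx _ => Hx)).
Qed.

Lemma is_Rint_primitive (f F : R -> R) l0 l1 :
  (forall t, 0 < t -> is_derive F t (f t)) -> (forall t, 0 < t -> ex_derive f t) ->
  filterlim F (at_right 0) (locally l0) -> filterlim F (Rbar_locally p_infty) (locally l1) ->
  is_Rint f (l1 - l0).
Proof.
intros HF Hf H0 H1.
apply (filterlimi_lim_ext_loc (fun ab : R * R => F (snd ab) - F (fst ab))).
- apply filter_prod_pos. intros a b Ha Hb. simpl.
  apply (is_RInt_derive (V := R_CompleteNormedModule) F); intros t Ht; rewrite Rmin_left, Rmax_right in Ht by lra.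
  apply HF; lra. apply (ex_derive_continuous (V := R_NormedModule)), Hf; lra.
- apply (filterlim_comp_2 (G := locally l1) (H := locally l0)).
  + apply filterlim_comp with (2 := H1). apply filterlim_snd.
  + apply filterlim_comp with (2 := H0). apply filterlim_fst.
  + apply (filterlim_comp_2 (G := locally l1) (H := locally (- l0)) fst (fun x => - snd x) Rplus).
    * apply filterlim_fst.
    * exact (filterlim_comp _ _ _ snd Ropp _ _ _ filterlim_snd (filterlim_opp (V := R_NormedModule) l0)).
    * apply (filterlim_plus (V := R_NormedModule)).
Qed.

(** * Integrability by domination *)

Section Domination.
Context {V : CompleteNormedModule R_AbsRing} (f : R -> V) (g : R -> R)
  (Hf : forall t, 0 < t -> continuous f t)
  (Hg : forall t, 0 < t -> continuous g t)
  (Hfg : forall t, 0 < t -> norm (f t) <= g t).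

Lemma ex_RInt_pos {W : CompleteNormedModule R_AbsRing} (h : R -> W) a b :
  (forall t, 0 < t -> continuous h t) -> 0 < a -> 0 < b -> ex_RInt h a b.
Proof.
intros Hh Ha Hb. apply ex_RInt_continuous. intros z Hz. apply Hh.
apply Rlt_le_trans with (2 := proj1 Hz). now apply Rmin_pos.
Qed.

Lemma norm_RInt_le_pos a b : 0 < a -> 0 < b -> norm (RInt f a b) <= Rabs (RInt g a b).
Proof.
assert (P : forall a b, 0 < a -> a <= b -> norm (RInt f a b) <= Rabs (RInt g a b)).
{ clear a b. intros a b Ha Hab.
  apply Rle_trans with (2 := Rle_abs _).
  apply (norm_RInt_le f g a b).
  - exact Hab.
  - intros x Hx; apply Hfg; lra.
  - apply (RInt_correct f), ex_RInt_pos; [exact Hf|lra|lra].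
  - apply (RInt_correct g), (ex_RInt_pos (W := R_CompleteNormedModule)); [exact Hg|lra|lra]. }
intros Ha Hb. destruct (Rle_dec a b) as [H|H].
- now apply P.
- rewrite <- (opp_RInt_swap f), <- (opp_RInt_swap (V := R_CompleteNormedModule) g).
  + rewrite (norm_opp (V := V)). change (norm (RInt f b a) <= Rabs (- RInt g b a)). rewrite Rabs_Ropp.
    apply P; lra.
  + now apply (ex_RInt_pos (W := R_CompleteNormedModule)).
  + now apply ex_RInt_pos.
Qed.

(** Cauchy criterion on the pair of endpoints: two truncated integrals of [f] differ by two end
    pieces, and each is dominated by the corresponding piece of the convergent integral of [g]. *)
Lemma is_RInt_gen_dominated G : is_Rint g G ->
  exists l, is_RInt_gen f (at_right 0) (Rbar_locally p_infty) l /\ norm l <= G.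
Proof.
intros HG.
assert (Hl : exists l, is_RInt_gen f (at_right 0) (Rbar_locally p_infty) l).
{ apply (filterlimi_locally_cauchy (U := V) (F := filter_prod (at_right 0) (Rbar_locally p_infty))
    (fun ab : R * R => is_RInt f (fst ab) (snd ab))).
  - apply filter_prod_pos. intros a b Ha Hb; simpl. split.
    + apply (ex_RInt_pos f a b Hf); lra.
    + intros y1 y2 H1 H2. apply is_RInt_unique in H1, H2. congruence.
  - intros eps.
    (* There are two end pieces, and each is a difference of two truncated integrals of [g], both
       this close to [G]. *)
    assert (He : 0 < eps / 4) by (destruct eps; simpl; lra).
    destruct (proj1 (filterlimi_locally _ _) HG (mkposreal _ He)) as [Q R HQ HR HP].
    simpl in HP.
    exists (fun p => (Q (fst p) /\ 0 < fst p < 1) /\ (R (snd p) /\ 1 < snd p)). split.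
    { apply (Filter_prod _ _ _ (fun a => Q a /\ 0 < a < 1) (fun b => R b /\ 1 < b)).
      - apply filter_and. exact HQ. exists (mkposreal 1 Rlt_0_1). intros y Hy Hy0.
        change (Rabs (y - 0) < 1) in Hy. apply Rabs_def2 in Hy. lra.
      - apply filter_and. exact HR. now exists 1.
      - intros x y Hx Hy; split; assumption. }
    assert (HP' : forall a b, Q a -> R b -> Rabs (RInt g a b - G) < eps / 4).
    { intros a b Ha Hb. destruct (HP a b Ha Hb) as [z [Hz Bz]].
      apply (is_RInt_unique (V := R_CompleteNormedModule)) in Hz. rewrite Hz. exact Bz. }
    intros [a b] [a' b']; simpl. intros [[Qa Ha] [Rb Hb]] [[Qa' Ha'] [Rb' Hb']] u' v' Hu Hv.
    apply is_RInt_unique in Hu, Hv. subst u' v'.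
    assert (EX : forall x y, 0 < x -> 0 < y -> ex_RInt f x y) by (intros x y; now apply ex_RInt_pos).
    assert (EXg : forall x y, 0 < x -> 0 < y -> ex_RInt g x y) by (intros x y; now apply (ex_RInt_pos (W := R_CompleteNormedModule))).
    apply (norm_compat1 (V := V)).
    assert (ED : plus (RInt f a' a) (RInt f b b') = minus (RInt f a' b') (RInt f a b)).
    2:{ apply Rle_lt_trans with (norm (plus (RInt f a' a) (RInt f b b'))); [rewrite ED; apply Rle_refl|].
      apply Rle_lt_trans with (norm (RInt f a' a) + norm (RInt f b b')); [exact (norm_triangle (V := V) _ _)|].
      assert (N1 := norm_RInt_le_pos a' a ltac:(lra) ltac:(lra)).
      assert (N2 := norm_RInt_le_pos b b' ltac:(lra) ltac:(lra)).
      assert (C1 := RInt_Chasles (V := R_CompleteNormedModule) g a' a b ltac:(apply EXg; lra) ltac:(apply EXg; lra)).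
      assert (C2 := RInt_Chasles (V := R_CompleteNormedModule) g a b b' ltac:(apply EXg; lra) ltac:(apply EXg; lra)).
      change (RInt g a' a + RInt g a b = RInt g a' b) in C1.
      change (RInt g a b + RInt g b b' = RInt g a b') in C2.
      assert (A1 := HP' a b Qa Rb). assert (A2 := HP' a' b Qa' Rb). assert (A3 := HP' a b' Qa Rb').
      replace (RInt g a' a) with (RInt g a' b - RInt g a b) in N1 by lra.
      replace (RInt g b b') with (RInt g a b' - RInt g a b) in N2 by lra.
      apply Rabs_def2 in A1, A2, A3.
      assert (Rabs (RInt g a' b - RInt g a b) < eps / 2) by (apply Rabs_def1; lra).
      assert (Rabs (RInt g a b' - RInt g a b) < eps / 2) by (apply Rabs_def1; lra).
      lra. }
    rewrite <- (RInt_Chasles f a' a b') by (apply EX; lra).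
    rewrite <- (RInt_Chasles f a b b') by (apply EX; lra).
    unfold minus. rewrite <- !plus_assoc. f_equal.
    rewrite (plus_comm (RInt f a b)), <- plus_assoc.
    rewrite <- (plus_zero_r (RInt f b b')) at 1. f_equal.
    symmetry. exact (plus_opp_l (G := V) (RInt f a b)). }
destruct Hl as [l Hl]. exists l. split. exact Hl.
apply (RInt_gen_norm (Fa := at_right 0) (Fb := Rbar_locally p_infty) f g); try assumption.
- apply filter_prod_pos; simpl; intros; lra.
- apply filter_prod_pos; simpl; intros. apply Hfg; lra.
Qed.
End Domination.

Lemma is_RInt_gen_ext_pos {V : NormedModule R_AbsRing} (f g : R -> V) l :
  (forall t, 0 < t -> f t = g t) ->
  is_RInt_gen f (at_right 0) (Rbar_locally p_infty) l -> is_RInt_gen g (at_right 0) (Rbar_locally p_infty) l.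
Proof.
intros H. apply is_RInt_gen_ext. apply filter_prod_pos. simpl. intros a b Ha Hb x Hx.
rewrite Rmin_left in Hx by lra. apply H; lra.
Qed.

Lemma is_Rint_ext (f g : R -> R) l : (forall t, 0 < t -> f t = g t) -> is_Rint f l -> is_Rint g l.
Proof. exact (is_RInt_gen_ext_pos (V := R_NormedModule) f g l). Qed.

Lemma is_Cint_ext (f g : R -> C) l : (forall t, 0 < t -> f t = g t) -> is_Cint f l -> is_Cint g l.
Proof. exact (is_RInt_gen_ext_pos (V := C_R_NormedModule) f g l). Qed.

Lemma is_Rint_eq (f : R -> R) (l l' : R) : is_Rint f l -> l = l' -> is_Rint f l'.
Proof. now intros H <-. Qed.

Lemma is_Cint_eq (f : R -> C) (l l' : C) : is_Cint f l -> l = l' -> is_Cint f l'.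
Proof. now intros H <-. Qed.

(** The integral is taken in a real normed module, whose scalars are real; passing to components is
    what allows a complex constant to be pulled out. *)
Lemma is_Cint_components (f : R -> C) (l : C) :
  is_Cint f l <-> is_Rint (fun t => fst (f t)) (fst l) /\ is_Rint (fun t => snd (f t)) (snd l).
Proof.
split.
- intros H. split; apply filterlimi_locally; intros eps.
  + generalize (proj1 (filterlimi_locally _ _) H eps). apply filter_imp.
    intros p [z [Hz [B1 B2]]]. exists (fst z). split. now apply (is_RInt_fct_extend_fst (U := R_NormedModule) (V := R_NormedModule)). exact B1.
  + generalize (proj1 (filterlimi_locally _ _) H eps). apply filter_imp.
    intros p [z [Hz [B1 B2]]]. exists (snd z). split. now apply (is_RInt_fct_extend_snd (U := R_NormedModule) (V := R_NormedModule)). exact B2.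
- intros [H1 H2]. apply filterlimi_locally; intros eps.
  generalize (filter_and _ _ (proj1 (filterlimi_locally _ _) H1 eps) (proj1 (filterlimi_locally _ _) H2 eps)).
  apply filter_imp. intros p [[x [Hx Bx]] [y [Hy By]]].
  exists ((x, y) : C). split.
  + now apply (is_RInt_fct_extend_pair (U := R_NormedModule) (V := R_NormedModule)).
  + split; assumption.
Qed.

Lemma is_Cint_plus f g lf lg : is_Cint f lf -> is_Cint g lg -> is_Cint (fun t => f t + g t)%C (lf + lg)%C.
Proof. intros H1 H2. exact (is_RInt_gen_plus f g lf lg H1 H2). Qed.

Lemma is_Cint_minus f g lf lg : is_Cint f lf -> is_Cint g lg -> is_Cint (fun t => f t - g t)%C (lf - lg)%C.
Proof. intros H1 H2. exact (is_RInt_gen_minus f g lf lg H1 H2). Qed.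

Lemma is_Rint_plus f g lf lg : is_Rint f lf -> is_Rint g lg -> is_Rint (fun t => f t + g t) (lf + lg).
Proof. intros H1 H2. exact (is_RInt_gen_plus f g lf lg H1 H2). Qed.

Lemma is_Rint_minus f g lf lg : is_Rint f lf -> is_Rint g lg -> is_Rint (fun t => f t - g t) (lf - lg).
Proof. intros H1 H2. exact (is_RInt_gen_minus f g lf lg H1 H2). Qed.

Lemma is_Rint_scal k f l : is_Rint f l -> is_Rint (fun t => k * f t) (k * l).
Proof. intros H. exact (is_RInt_gen_scal f k l H). Qed.

Lemma is_Cint_scal c f l : is_Cint f l -> is_Cint (fun t => c * f t)%C (c * l)%C.
Proof.
rewrite !is_Cint_components. intros [H1 H2]. split; simpl.
- apply is_Rint_minus; now apply is_Rint_scal.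
- apply is_Rint_plus; now apply is_Rint_scal.
Qed.

Lemma is_Rint_0 : is_Rint (fun _ => 0) 0.
Proof.
enough (H : is_Rint (fun _ => 0) (0 - 0)) by now rewrite Rminus_0_r in H.
apply (is_Rint_primitive (fun _ => 0) (fun _ => 0)).
- intros t _. apply (is_derive_const (V := R_NormedModule)).
- intros t _. apply ex_derive_const.
- apply filterlim_const.
- apply filterlim_const.
Qed.

Lemma is_Cint_RtoC f l : is_Rint f l -> is_Cint (fun t => RtoC (f t)) (RtoC l).
Proof.
intros H. apply is_Cint_components. split; simpl. exact H. apply is_Rint_0.
Qed.

Lemma is_Cint_unique f l l' : is_Cint f l -> is_Cint f l' -> l = l'.
Proof.
intros H1 H2. apply is_RInt_gen_unique in H1, H2; [|typeclasses eauto..].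
exact (eq_trans (eq_sym H1) H2).
Qed.

Lemma is_Cint_le f l g G : (forall t, 0 < t -> Cmod (f t) <= g t) ->
  is_Cint f l -> is_Rint g G -> Cmod l <= G.
Proof.
intros H Hf Hg. rewrite <- Cmod_norm_R.
apply (RInt_gen_norm (V := C_R_CompleteNormedModule) (Fa := at_right 0) (Fb := Rbar_locally p_infty) f g); try assumption.
- apply filter_prod_pos; simpl; intros; lra.
- apply filter_prod_pos; simpl; intros. change (norm (V := C_R_NormedModule) (f x) <= g x). rewrite Cmod_norm_R. apply H; lra.
Qed.

Lemma is_Rint_le f l g G : (forall t, 0 < t -> f t <= g t) ->
  is_Rint f l -> is_Rint g G -> l <= G.
Proof.
intros H Hf Hg.
assert (H0 := is_Rint_minus _ _ _ _ Hg Hf).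
assert (Hz := is_Rint_0).
(* Monotonicity is extracted from the norm estimate: the zero function is dominated by [g - f],
   hence [0 <= G - l]. *)
assert (norm 0 <= G - l); [|unfold norm in *; simpl in *; unfold abs in *; simpl in *; rewrite Rabs_R0 in *; lra].
apply (RInt_gen_norm (V := R_CompleteNormedModule) (Fa := at_right 0) (Fb := Rbar_locally p_infty) (fun _ => 0) (fun t => g t - f t)); try assumption.
- apply filter_prod_pos; simpl; intros; lra.
- apply filter_prod_pos; simpl; intros. change (Rabs 0 <= g x - f x). rewrite Rabs_R0. specialize (H x ltac:(lra)). lra.
Qed.

Lemma is_Cint_dominated f g G : (forall t, 0 < t -> ex_cder f t) ->
  (forall t, 0 < t -> ex_derive g t) -> (forall t, 0 < t -> Cmod (f t) <= g t) ->
  is_Rint g G -> exists l, is_Cint f l /\ Cmod l <= G.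
Proof.
intros Hf Hg H HG.
destruct (is_RInt_gen_dominated (V := C_R_CompleteNormedModule) f g) with (4 := HG) as [l [Hl1 Hl2]].
- intros t Ht. destruct (Hf t Ht) as [l Hl]. exact (ccont_continuous _ _ (cder_ccont _ _ _ Hl)).
- intros t Ht. apply (ex_derive_continuous (V := R_NormedModule)), Hg, Ht.
- intros t Ht. change (norm (V := C_R_NormedModule) (f t) <= g t). rewrite Cmod_norm_R. now apply H.
- exists l; split. exact Hl1. rewrite <- Cmod_norm_R. exact Hl2.
Qed.

Lemma is_Rint_dominated f g G : (forall t, 0 < t -> ex_derive f t) ->
  (forall t, 0 < t -> ex_derive g t) -> (forall t, 0 < t -> Rabs (f t) <= g t) ->
  is_Rint g G -> exists l, is_Rint f l.
Proof.
intros Hf Hg H HG.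
destruct (is_RInt_gen_dominated (V := R_CompleteNormedModule) f g) with (4 := HG) as [l [Hl1 Hl2]].
- intros t Ht. apply (ex_derive_continuous (V := R_NormedModule)), Hf, Ht.
- intros t Ht. apply (ex_derive_continuous (V := R_NormedModule)), Hg, Ht.
- exact H.
- now exists l.
Qed.

(** * The Gamma function *)

Lemma filterlim_Rpower_0 p : 0 < p -> filterlim (fun t => exp (p * ln t)) (at_right 0) (locally 0).
Proof.
intros Hp. apply filterlim_locally. intros eps.
exists (mkposreal _ (exp_pos (ln eps / p))). intros t Ht H0.
change (Rabs (t - 0) < exp (ln eps / p)) in Ht. rewrite Rminus_0_r, Rabs_pos_eq in Ht by lra.
change (Rabs (exp (p * ln t) - 0) < eps). rewrite Rminus_0_r, Rabs_pos_eq by (left; apply exp_pos).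
rewrite <- (exp_ln eps (cond_pos eps)). apply exp_increasing.
apply ln_increasing in Ht; [|exact H0]. rewrite ln_exp in Ht.
apply Rmult_lt_compat_l with (r := p) in Ht; [|exact Hp].
replace (p * (ln eps / p)) with (ln eps) in Ht by (field; lra). exact Ht.
Qed.

Lemma filterlim_Rpower_infty p : 0 < p -> filterlim (fun t => exp (- (p * ln t))) (Rbar_locally p_infty) (locally 0).
Proof.
intros Hp. apply filterlim_locally. intros eps.
exists (exp (- ln eps / p)). intros t Ht.
change (Rabs (exp (- (p * ln t)) - 0) < eps). rewrite Rminus_0_r, Rabs_pos_eq by (left; apply exp_pos).
rewrite <- (exp_ln eps (cond_pos eps)). apply exp_increasing.
apply ln_increasing in Ht; [|apply exp_pos]. rewrite ln_exp in Ht.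
apply Rmult_lt_compat_l with (r := p) in Ht; [|exact Hp].
replace (p * (- ln eps / p)) with (- ln eps) in Ht by (field; lra). lra.
Qed.

Lemma ln_le_sub1 t : 0 < t -> ln t <= t - 1.
Proof.
intros Ht. apply Rnot_lt_le; intros H. apply exp_increasing in H. rewrite exp_ln in H by exact Ht.
assert (H1 := exp_ineq1_le (t - 1)). lra.
Qed.

Lemma exp_le x y : x <= y -> exp x <= exp y.
Proof. intros [H| ->]. left; now apply exp_increasing. right; reflexivity. Qed.

Lemma exp_minus_ln x t : 0 < t -> exp (x - ln t) = exp x / t.
Proof. intros Ht. unfold Rminus. rewrite exp_plus, exp_Ropp, exp_ln by exact Ht. reflexivity. Qed.

Lemma Rpower_exp_bound p : 0 < p -> exists K, 0 < K /\ forall t, 0 < t -> exp (p * ln t - t) <= K.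
Proof.
(* The maximum of [t^p e^(-t)], attained at [t = p]. *)
intros Hp. exists (exp (p * (ln p - 1))). split. apply exp_pos.
intros t Ht.
assert (H : p * ln t - t <= p * (ln p - 1)).
{ assert (H1 := ln_le_sub1 (t / p) ltac:(now apply Rdiv_lt_0_compat)).
  rewrite ln_div in H1 by assumption.
  apply Rmult_le_compat_l with (r := p) in H1; [|lra].
  replace (p * (t / p - 1)) with (t - p) in H1 by (field; lra). lra. }
now apply exp_le.
Qed.

(** Euler's integrand [t^(p-1) e^(-t)] as a single exponential: it is visibly positive, and a shift
    of [p] is a factor [exp (d * ln t)]. *)
Definition gam (p t : R) : R := exp ((p - 1) * ln t - t).

Lemma ex_derive_gam p t : 0 < t -> ex_derive (gam p) t.
Proof. intros Ht. unfold gam. auto_derive. lra. Qed.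

(** One majorant serves both ends of the half-line: [t^(p-1) / (1 + t^p)^2] behaves like [t^(p-1)]
    at 0 and like [t^(-p-1)] at infinity, and it has the primitive [-1 / (p (1 + t^p))]. *)
Lemma is_Rint_gam_ex p : 0 < p -> exists G, is_Rint (gam p) G.
Proof.
intros Hp.
destruct (Rpower_exp_bound (2 * p)) as [K [HK HKt]]. lra.
(* From [(1 + y)^2 <= 2 + 2 y^2] with [y = t^p], where [K] bounds [y^2 e^(-t)] and 1 bounds
   [e^(-t)]. *)
set (C := 2 + 2 * K).
apply is_Rint_dominated with (fun t => C * (exp ((p - 1) * ln t) / (1 + exp (p * ln t)) ^ 2)) (C * (0 - (- / p))).
- intros t Ht; now apply ex_derive_gam.
- intros t Ht. assert (H := exp_pos (p * ln t)). auto_derive. repeat split; try lra. nra.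
- intros t Ht. unfold gam. rewrite Rabs_pos_eq by (left; apply exp_pos).
  unfold Rminus at 1. rewrite exp_plus.
  replace (C * (exp ((p - 1) * ln t) / (1 + exp (p * ln t)) ^ 2)) with (exp ((p - 1) * ln t) * (C / (1 + exp (p * ln t)) ^ 2)).
  2:{ assert (H := exp_pos (p * ln t)). field. lra. }
  apply Rmult_le_compat_l. left; apply exp_pos.
  assert (H := exp_pos (p * ln t)).
  apply Rle_div_r. nra.
  specialize (HKt t Ht). unfold Rminus in HKt. rewrite exp_plus in HKt.
  replace (exp (2 * p * ln t)) with (exp (p * ln t) * exp (p * ln t)) in HKt by (rewrite <- exp_plus; f_equal; ring).
  assert (He := exp_pos (- t)).
  assert (He1 : exp (- t) <= 1). { rewrite <- exp_0. left; apply exp_increasing; lra. }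
  assert (Hs := pow2_ge_0 (1 - exp (p * ln t))).
  apply Rle_trans with (exp (- t) * (2 + 2 * (exp (p * ln t) * exp (p * ln t)))). apply Rmult_le_compat_l; nra.
  unfold C. nra.
- apply is_Rint_scal.
  apply (is_Rint_primitive _ (fun t => - / p * / (1 + exp (p * ln t)))).
  + intros t Ht. assert (H := exp_pos (p * ln t)). auto_derive. split. lra. split. lra. exact I.
    replace (exp ((p - 1) * ln t)) with (exp (p * ln t) / t).
    * field. repeat split; lra.
    * rewrite <- exp_minus_ln by exact Ht. f_equal; ring.
  + intros t Ht. assert (H := exp_pos (p * ln t)). auto_derive. repeat split; try lra. nra.
  + enough (H : filterlim (fun t => - / p * / (1 + exp (p * ln t))) (at_right 0) (locally (- / p * / (1 + 0)))).
    {replace (- / p * / (1 + 0)) with (- / p) in H by (field; lra). exact H. }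
    apply (filterlim_comp _ _ _ (fun t => exp (p * ln t)) (fun y => - / p * / (1 + y)) _ (locally 0)).
    * apply filterlim_Rpower_0, Hp.
    * apply (ex_derive_continuous (V := R_NormedModule) (fun y => - / p * / (1 + y))). auto_derive. lra.
  + apply filterlim_locally. intros eps.
    assert (He : 0 < eps * p) by (destruct eps; simpl; nra).
    generalize (proj1 (filterlim_locally _ _) (filterlim_Rpower_infty p Hp) (mkposreal _ He)).
    apply filter_imp. intros t Ht.
    change (Rabs (exp (- (p * ln t)) - 0) < eps * p) in Ht. rewrite Rminus_0_r, Rabs_pos_eq in Ht by (left; apply exp_pos).
    change (Rabs (- / p * / (1 + exp (p * ln t)) - 0) < eps).
    assert (H := exp_pos (p * ln t)).
    assert (Hi : 0 < / (1 + exp (p * ln t)) < / exp (p * ln t)).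
    { split. apply Rinv_0_lt_compat; lra. apply Rinv_lt_contravar; nra. }
    rewrite exp_Ropp in Ht.
    assert (Hp' := Rinv_0_lt_compat p Hp).
    rewrite Rminus_0_r, Rabs_left by nra.
    apply Rmult_lt_reg_r with p. exact Hp.
    replace (- (- / p * / (1 + exp (p * ln t))) * p) with (/ (1 + exp (p * ln t))) by (field; split; lra). lra.
Qed.

Lemma filterlim_gam_0 p : 0 < p -> filterlim (fun t => exp (p * ln t - t)) (at_right 0) (locally 0).
Proof.
intros Hp. apply filterlim_locally. intros eps.
generalize (filter_and _ _ (proj1 (filterlim_locally _ _) (filterlim_Rpower_0 p Hp) eps)
  (filter_forall (F := at_right 0) (fun _ => True) (fun _ => I))).
intros H. destruct H as [d Hd]. exists d. intros t H1 H2. specialize (Hd t H1 H2). destruct Hd as [Hd _].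
change (Rabs (exp (p * ln t) - 0) < eps) in Hd. rewrite Rminus_0_r, Rabs_pos_eq in Hd by (left; apply exp_pos).
change (Rabs (exp (p * ln t - t) - 0) < eps). rewrite Rminus_0_r, Rabs_pos_eq by (left; apply exp_pos).
apply Rlt_trans with (2 := Hd). apply exp_increasing; lra.
Qed.

Lemma filterlim_gam_infty p : 0 < p -> filterlim (fun t => exp (p * ln t - t)) (Rbar_locally p_infty) (locally 0).
Proof.
intros Hp. destruct (Rpower_exp_bound (2 * p)) as [K [HK HKt]]. lra.
apply filterlim_locally. intros eps.
assert (He : 0 < eps / K) by (apply Rdiv_lt_0_compat; [apply cond_pos|exact HK]).
destruct (proj1 (filterlim_locally _ _) (filterlim_Rpower_infty p Hp) (mkposreal _ He)) as [M HM].
exists (Rmax M 0). intros t Ht.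
assert (Ht1 := Rle_lt_trans _ _ _ (Rmax_l _ _) Ht). assert (Ht2 := Rle_lt_trans _ _ _ (Rmax_r _ _) Ht).
specialize (HM t Ht1). specialize (HKt t Ht2).
change (Rabs (exp (- (p * ln t)) - 0) < eps / K) in HM. rewrite Rminus_0_r, Rabs_pos_eq in HM by (left; apply exp_pos).
change (Rabs (exp (p * ln t - t) - 0) < eps). rewrite Rminus_0_r, Rabs_pos_eq by (left; apply exp_pos).
(* A bounded factor [t^(2p) e^(-t)] times the vanishing factor [t^(-p)]. *)
replace (p * ln t - t) with ((2 * p * ln t - t) + - (p * ln t)) by ring. rewrite exp_plus.
apply Rle_lt_trans with (K * exp (- (p * ln t))).
apply Rmult_le_compat_r. left; apply exp_pos. exact HKt.
apply Rlt_div_r in HM. lra. exact HK.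
Qed.

Lemma is_Rint_gam_succ p G : 0 < p -> is_Rint (gam p) G -> is_Rint (gam (p + 1)) (p * G).
Proof.
intros Hp HG.
assert (H : is_Rint (fun t => p * gam p t - gam (p + 1) t) (0 - 0)).
{ apply (is_Rint_primitive _ (fun t => exp (p * ln t - t))).
  - intros t Ht. auto_derive. lra. unfold gam. change (p * ln t + - t) with (p * ln t - t).
    replace ((p + 1 - 1) * ln t - t) with (p * ln t - t) by ring.
    replace (exp ((p - 1) * ln t - t)) with (exp (p * ln t - t) / t).
    + field; lra.
    + rewrite <- exp_minus_ln by exact Ht. f_equal; ring.
  - intros t Ht. unfold gam. auto_derive. lra.
  - now apply filterlim_gam_0.
  - now apply filterlim_gam_infty. }
replace (p * G) with (p * G - (0 - 0)) by ring.
apply is_Rint_ext with (fun t => p * gam p t - (p * gam p t - gam (p + 1) t)).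
- intros; ring.
- apply is_Rint_minus; [now apply is_Rint_scal|exact H].
Qed.

Lemma Bernoulli_ineq q t : 1 <= q -> 0 < t -> 1 + q * (t - 1) <= exp (q * ln t).
Proof.
intros Hq Ht.
assert (H : 0 <= exp (q * ln t) - q * exp (ln t) - 1 + q).
{ set (v := ln t).
  destruct (MVT_gen (fun y => exp (q * y) - q * exp y - 1 + q) 0 v (fun y => q * (exp (q * y) - exp y))) as [c [Hc E]].
  - intros x _. auto_derive. exact I. ring.
  - intros x _. apply ex_derive_continuity_pt. auto_derive. exact I.
  - cbv beta in E. rewrite Rmult_0_r, exp_0 in E.
    assert (0 <= q * (exp (q * c) - exp c) * (v - 0)); [|lra].
    rewrite Rminus_0_r, Rmult_assoc. apply Rmult_le_pos. lra.
    destruct (Rle_dec 0 v) as [Hv|Hv].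
    + rewrite Rmin_left, Rmax_right in Hc by lra. apply Rmult_le_pos; [|exact Hv].
      assert (exp c <= exp (q * c)); [|lra].
      apply exp_le. nra.
    + rewrite Rmin_right, Rmax_left in Hc by lra.
      assert (exp (q * c) <= exp c); [|nra].
      apply exp_le. nra. }
rewrite exp_ln in H by exact Ht. lra.
Qed.

(** Comparison of integrals gives only weak inequalities, so strict positivity needs an explicit
    lower bound. For [p >= 2], integrating [t^(p-1) >= 1 + (p-1)(t-1)] against [e^(-t)] gives
    [G >= 1], as the orders 1 and 2 both integrate to 1. The functional equation, applied twice,
    brings any [p > 0] into this range. *)
Lemma is_Rint_gam_pos p G : 0 < p -> is_Rint (gam p) G -> 0 < G.
Proof.
assert (H2 : forall p G, 2 <= p -> is_Rint (gam p) G -> 0 < G).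
{ clear p G. intros p G Hp HG.
  assert (H1 : is_Rint (gam 1) 1).
  { apply (is_Rint_eq _ (0 - -1)); [|ring].
    apply (is_Rint_primitive _ (fun t => - exp (- t))).
    - intros t Ht. unfold gam. auto_derive. exact I. replace ((1 - 1) * ln t - t) with (- t) by ring. ring.
    - intros t Ht. now apply ex_derive_gam.
    - replace (-1) with (- exp (- 0)) by (rewrite Ropp_0, exp_0; ring).
      apply (filterlim_filter_le_1 (F := locally 0)). apply filter_le_within.
      apply (ex_derive_continuous (V := R_NormedModule) (fun t => - exp (- t))). auto_derive. exact I.
    - apply filterlim_locally. intros eps. exists (- ln eps). intros t Ht.
      change (Rabs (- exp (- t) - 0) < eps). rewrite Rminus_0_r, Rabs_Ropp, Rabs_pos_eq by (left; apply exp_pos).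
      rewrite <- (exp_ln eps (cond_pos eps)). apply exp_increasing. lra. }
  assert (H2 := is_Rint_gam_succ 1 1 ltac:(lra) H1).
  apply Rlt_le_trans with 1. lra.
  replace 1 with (1 + (p - 1) * (1 * 1 - 1)) by ring.
  refine (is_Rint_le (fun t => gam 1 t + (p - 1) * (gam (1 + 1) t - gam 1 t)) _ _ _ _ _ HG).
  - intros t Ht. unfold gam.
    replace ((1 - 1) * ln t - t) with (- t) by ring. replace ((1 + 1 - 1) * ln t - t) with (ln t + - t) by ring.
    replace ((p - 1) * ln t - t) with ((p - 1) * ln t + - t) by ring. rewrite !exp_plus, exp_ln by exact Ht.
    assert (HB := Bernoulli_ineq (p - 1) t ltac:(lra) Ht). assert (He := exp_pos (- t)). nra.
  - apply is_Rint_plus. exact H1. apply is_Rint_scal. apply is_Rint_minus; assumption. }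
intros Hp HG. apply is_Rint_gam_succ in HG as HG1; [|exact Hp].
apply is_Rint_gam_succ in HG1 as HG2; [|lra].
apply H2 in HG2; [|lra]. assert (0 < (p + 1) * p) by nra.
apply Rmult_lt_reg_l with ((p + 1) * p); lra.
Qed.

(** * Euler's integral at complex arguments *)

Lemma RtoC_neq_0 t : t <> 0 -> RtoC t <> 0%C.
Proof. intros H E. apply H, RtoC_inj, E. Qed.

Lemma Cexp_plus z w : Cexp (z + w) = (Cexp z * Cexp w)%C.
Proof.
unfold Cexp, Re, Im; apply injective_projections; simpl; rewrite exp_plus, ?cos_plus, ?sin_plus; ring.
Qed.

Lemma Cmod_Cexp z : Cmod (Cexp z) = exp (fst z).
Proof.
apply Rsqr_inj. apply Cmod_ge_0. left; apply exp_pos.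
unfold Rsqr. rewrite Cmod_sqr. unfold Cexp; simpl.
assert (H := sin2_cos2 (snd z)). unfold Rsqr, Im, Re in *.
replace (_ + _) with (exp (fst z) * exp (fst z) * (sin (snd z) * sin (snd z) + cos (snd z) * cos (snd z))) by ring.
rewrite H; ring.
Qed.

Lemma Cexp_RtoC x : Cexp (RtoC x) = RtoC (exp x).
Proof.
unfold Cexp, RtoC; simpl. rewrite cos_0, sin_0. apply injective_projections; simpl; ring.
Qed.

Lemma Clog_RtoC t : 0 < t -> Clog (RtoC t) = RtoC (ln t).
Proof.
intros Ht. rewrite Clog_atan by exact Ht. rewrite Cmod_R, Rabs_pos_eq by lra.
unfold RtoC; simpl. unfold Rdiv. now rewrite Rmult_0_l, atan_0.
Qed.

Definition gamC (z : C) (t : R) : C := Cexp ((z - 1) * RtoC (ln t) - RtoC t)%C.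

Lemma gamC_Cpower z t : 0 < t -> gamC z t = (Cpower (RtoC t) (z - 1) * RtoC (exp (- t)))%C.
Proof.
intros Ht. unfold gamC, Cpower. rewrite Clog_RtoC by exact Ht. unfold Cminus at 1.
rewrite Cexp_plus, <- RtoC_opp, Cexp_RtoC. reflexivity.
Qed.

Lemma Cmod_gamC z t : Cmod (gamC z t) = gam (fst z) t.
Proof. unfold gamC. rewrite Cmod_Cexp. unfold gam. f_equal. simpl. ring. Qed.

Lemma cder_lnC t : 0 < t -> cder (fun t => RtoC (ln t)) t (RtoC (/ t)).
Proof. intros Ht. apply cder_RtoC. now apply is_derive_ln. Qed.

Lemma cder_Cexp_ln (c d : C) t : 0 < t ->
  cder (fun t => Cexp (c * RtoC (ln t) - d * RtoC t)%C) t ((c / RtoC t - d) * Cexp (c * RtoC (ln t) - d * RtoC t))%C.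
Proof.
intros Ht. eapply cder_eq.
- apply cder_Cexp. apply cder_minus.
  + apply cder_scal. apply cder_lnC, Ht.
  + apply cder_scal. apply cder_id.
- cbv beta. rewrite RtoC_inv by lra. unfold Cdiv. f_equal. ring.
Qed.

Lemma cder_gamC z t : 0 < t -> cder (gamC z) t (((z - 1) / RtoC t - 1) * gamC z t)%C.
Proof.
intros Ht. eapply cder_eq. eapply cder_ext. 2: apply (cder_Cexp_ln (z - 1) 1 t Ht).
- intros s. unfold gamC. now rewrite Cmult_1_l.
- unfold gamC. now rewrite Cmult_1_l.
Qed.

Lemma is_Cint_Gamma z : 0 < fst z -> is_Cint (gamC z) (Gamma z).
Proof.
intros Hz. destruct (is_Rint_gam_ex _ Hz) as [G HG].
destruct (is_Cint_dominated (gamC z) (gam (fst z)) G) as [l [Hl _]].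
- intros t Ht. eexists. now apply cder_gamC.
- apply ex_derive_gam.
- intros t _. rewrite Cmod_gamC. lra.
- exact HG.
- replace (Gamma z) with l. exact Hl.
  symmetry. unfold Gamma. apply (is_RInt_gen_unique (V := C_R_CompleteNormedModule)).
  apply is_Cint_ext with (2 := Hl). apply gamC_Cpower.
Qed.

Lemma Gamma_succ z : 0 < fst z -> Gamma (z + 1) = (z * Gamma z)%C.
Proof.
intros Hz.
assert (H : is_Cint (fun t => z * gamC z t - gamC (z + 1) t)%C (0 - 0)%C).
{ apply (is_Cint_primitive _ (gamC (z + 1))).
  - intros t Ht. eapply cder_eq. now apply cder_gamC.
    replace (gamC (z + 1) t) with (gamC z t * RtoC t)%C.
    + field. apply RtoC_neq_0. lra.
    + unfold gamC. rewrite <- (exp_ln t) at 3 by exact Ht. rewrite <- Cexp_RtoC, <- Cexp_plus. f_equal. ring.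
  - intros t Ht. eexists. apply cder_minus. apply cder_scal. now apply cder_gamC. now apply cder_gamC.
  - apply Clim_le with (fun t => exp (fst z * ln t - t)). typeclasses eauto.
    + apply filter_forall. intros t. unfold Cminus. rewrite Copp_0, Cplus_0_r, Cmod_gamC. unfold gam. right. f_equal. simpl. ring.
    + now apply filterlim_gam_0.
  - apply Clim_le with (fun t => exp (fst z * ln t - t)). typeclasses eauto.
    + apply filter_forall. intros t. unfold Cminus. rewrite Copp_0, Cplus_0_r, Cmod_gamC. unfold gam. right. f_equal. simpl. ring.
    + now apply filterlim_gam_infty. }
assert (Hz1 : 0 < fst (z + 1)%C) by (simpl; lra).
assert (H2 := is_Cint_minus _ _ _ _ (is_Cint_scal z _ _ (is_Cint_Gamma z Hz)) (is_Cint_Gamma _ Hz1)).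
assert (H3 := is_Cint_unique _ _ _ H H2).
replace (Gamma (z + 1)) with (z * Gamma z - (z * Gamma z - Gamma (z + 1)))%C by ring.
rewrite <- H3. ring.
Qed.

(** * The derivative of Gamma *)

Lemma cder_0_of_bound (f : R -> C) (D : C) d K : 0 < d ->
  (forall s, Rabs s <= d -> Cmod (f s - f 0 - RtoC s * D) <= K * s ^ 2) -> cder f 0 D.
Proof.
intros Hd H.
assert (HK : 0 <= K).
{ specialize (H d ltac:(rewrite Rabs_pos_eq; lra)). assert (Hc := Cmod_ge_0 (f d - f 0 - RtoC d * D)%C).
  assert (0 < d ^ 2) by nra. apply Rnot_lt_le; intros Hn. nra. }
assert (P : forall (u : R -> R) D', (forall s, Rabs s <= d -> Rabs (u s - u 0 - s * D') <= K * s ^ 2) -> is_derive u 0 D').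
{ intros u D' Hu. apply is_derive_Reals. intros eps He.
  assert (Hm : 0 < Rmin d (eps / (K + 1))) by (apply Rmin_pos; [|apply Rdiv_lt_0_compat]; lra).
  exists (mkposreal _ Hm). intros h Hh Hlt. simpl in Hlt.
  assert (H1 := Rlt_le_trans _ _ _ Hlt (Rmin_l _ _)). assert (H2 := Rlt_le_trans _ _ _ Hlt (Rmin_r _ _)).
  specialize (Hu h ltac:(lra)). rewrite Rplus_0_l.
  replace ((u h - u 0) / h - D') with ((u h - u 0 - h * D') / h) by (field; exact Hh).
  rewrite Rabs_div by exact Hh. assert (Hp := Rabs_pos_lt _ Hh).
  apply Rlt_div_l. exact Hp.
  apply Rlt_div_r in H2; [|lra].
  replace (h ^ 2) with (Rabs h * Rabs h) in Hu by (rewrite <- Rabs_mult, Rabs_pos_eq; nra). nra. }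
split; apply P; intros s Hs; apply Rle_trans with (2 := H s Hs).
- replace (fst (f s) - fst (f 0) - s * fst D) with (fst (f s - f 0 - RtoC s * D)%C) by (simpl; ring). apply Rabs_fst_le.
- replace (snd (f s) - snd (f 0) - s * snd D) with (snd (f s - f 0 - RtoC s * D)%C) by (simpl; ring). apply Rabs_snd_le.
Qed.

(* [C_lim] only looks at the horizontal line through the point. *)
Lemma C_derive_of_cder (f : C -> C) z D : cder (fun s => f (z + RtoC s)%C) 0 D -> C_derive f z = D.
Proof.
intros [H1 H2].
assert (P : forall (u : R -> R) x0 l, is_derive (fun s => u (x0 + s)) 0 l -> real (Lim (fun x => (u x - u x0) / (x - x0)) x0) = l).
{ intros u x0 l Hl. replace l with (real (Finite l)) by reflexivity. f_equal. apply is_lim_unique.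
  apply is_lim_spec. intros eps. apply is_derive_Reals in Hl.
  destruct (Hl eps (cond_pos eps)) as [d Hd].
  exists d. intros y Hy Hn. change (Rabs (y - x0) < d) in Hy.
  specialize (Hd (y - x0) ltac:(lra) Hy). cbv beta in Hd.
  assert (Er : forall y : R, x0 + (0 + (y - x0)) = y) by (intros; ring). rewrite Er in Hd. now rewrite Rplus_0_r in Hd. }
unfold C_derive, C_lim. destruct D as [D1 D2]. simpl in H1, H2.
assert (E : forall x, x <> fst z -> ((f (x, snd z) - f z) / ((x, snd z) - z))%C =
   ((fst (f (x, snd z)) - fst (f z)) / (x - fst z), (snd (f (x, snd z)) - snd (f z)) / (x - fst z))).
{ intros x Hx. replace ((x, snd z) - z)%C with (RtoC (x - fst z)).
  - unfold Cdiv. rewrite <- RtoC_inv by lra. apply injective_projections; simpl; unfold Rdiv; ring.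
  - apply injective_projections; simpl; ring. }
assert (Ez : forall s, (fst z + s, snd z) = (z + RtoC s)%C).
{ intros s. apply injective_projections; simpl; ring. }
assert (Ez0 : (fst z, snd z) = z) by (now destruct z).
f_equal.
- rewrite <- (P (fun x => fst (f (x, snd z))) (fst z) D1).
  + f_equal. apply Lim_ext_loc. exists (mkposreal 1 Rlt_0_1). intros y _ Hy. rewrite E by exact Hy. simpl. now rewrite Ez0.
  + eapply is_derive_ext. 2: exact H1. intros s; simpl. now rewrite Ez.
- rewrite <- (P (fun x => snd (f (x, snd z))) (fst z) D2).
  + f_equal. apply Lim_ext_loc. exists (mkposreal 1 Rlt_0_1). intros y _ Hy. rewrite E by exact Hy. simpl. now rewrite Ez0.
  + eapply is_derive_ext. 2: exact H2. intros s; simpl. now rewrite Ez.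
Qed.

(** The terms of index strictly below [n], whereas [sum_n] includes the index [n]; hence the [S n]
    wherever the two meet. *)
Fixpoint Csum (f : nat -> C) (n : nat) : C :=
  match n with O => 0%C | S m => (Csum f m + f m)%C end.

Lemma gam_shift p d t : gam (p + d) t = exp (d * ln t) * gam p t.
Proof. unfold gam. rewrite <- exp_plus. f_equal. ring. Qed.

Lemma gamC_shift z s t : gamC (z + RtoC s) t = (RtoC (exp (s * ln t)) * gamC z t)%C.
Proof. unfold gamC. rewrite <- Cexp_RtoC, <- Cexp_plus. f_equal. rewrite RtoC_mult. ring. Qed.

(** [exp y - 1 - y] and [exp (-y) - 1 + y] are both nonnegative and add up to
    [exp y + exp (-y) - 2], so [cosh_le] bounds the first. Unlike a local Taylor estimate, this
    holds for all [y], as needed under an integral over all [t > 0]. *)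
Lemma exp_sub1_sub_id_le y : Rabs (exp y - 1 - y) <= y * y * (exp y + exp (- y)).
Proof.
assert (H1 := exp_ineq1_le y). assert (H2 := exp_ineq1_le (- y)). assert (H3 := cosh_le y).
rewrite Rabs_pos_eq; lra.
Qed.

Lemma exp_abs_le y w : Rabs y <= Rabs w -> exp y <= exp w + exp (- w).
Proof.
intros H. assert (H1 := exp_pos w). assert (H2 := exp_pos (- w)).
apply Rle_trans with (exp (Rabs w)).
- apply exp_le. apply Rle_trans with (2 := H). apply Rle_abs.
- unfold Rabs. destruct (Rcase_abs w); lra.
Qed.

(** Differentiation under the integral by a quantitative remainder: [t^s - 1 - s ln t] is at most
    [s^2] times a combination of powers of [t] that is integrable against [gam], so the integrated
    remainder is quadratic in [s]. *)
Lemma Gamma_derivative (z : C) : 0 < fst z ->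
  exists D, is_Cint (fun t => RtoC (ln t) * gamC z t)%C D /\ cder (fun s => Gamma (z + RtoC s)) 0 D.
Proof.
(* A quarter of [x] keeps the exponents [x - d] and [x - 2 d] positive, so all four dominating
   moments exist. *)
intros Hz. set (x := fst z) in *. set (d := x / 4).
assert (Hd : 0 < d) by (unfold d; lra).
destruct (is_Rint_gam_ex (x + d)) as [G1 HG1]. unfold d; lra.
destruct (is_Rint_gam_ex (x + - d)) as [G2 HG2]. unfold d; lra.
destruct (is_Rint_gam_ex (x + 2 * d)) as [G3 HG3]. unfold d; lra.
destruct (is_Rint_gam_ex (x + - (2 * d))) as [G4 HG4]. unfold d; lra.
assert (HD : exists D, is_Cint (fun t => RtoC (ln t) * gamC z t)%C D /\ Cmod D <= / d * (G1 + G2)).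
{ apply (is_Cint_dominated _ (fun t => / d * (gam (x + d) t + gam (x + - d) t))).
  - intros t Ht. eexists. apply (cder_mult (fun t => RtoC (ln t)) (gamC z)). now apply cder_lnC. now apply cder_gamC.
  - intros t Ht. unfold gam. auto_derive. lra.
  - intros t Ht. rewrite Cmod_mult, Cmod_gamC, Cmod_R, !gam_shift. fold x.
    assert (Hg : 0 < gam x t) by apply exp_pos.
    assert (H := cosh_ge (d * ln t)). replace (- d * ln t) with (- (d * ln t)) by ring.
    assert (Hl : d * Rabs (ln t) <= exp (d * ln t) + exp (- (d * ln t))).
    { rewrite <- (Rabs_pos_eq d) at 1 by lra. rewrite <- Rabs_mult. set (v := d * ln t) in *. unfold Rabs; destruct (Rcase_abs v); nra. }
    apply Rmult_le_reg_l with d. exact Hd.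
    replace (d * (/ d * (exp (d * ln t) * gam x t + exp (- (d * ln t)) * gam x t))) with ((exp (d * ln t) + exp (- (d * ln t))) * gam x t) by (field; lra).
    nra.
  - apply is_Rint_scal. now apply is_Rint_plus. }
destruct HD as [D [HD _]]. exists D. split. exact HD.
apply cder_0_of_bound with d (4 / (d * d) * (G3 + G4)). exact Hd.
intros s Hs. assert (Hs' : - d <= s <= d) by (apply Rabs_le_between; exact Hs).
replace (4 / (d * d) * (G3 + G4) * s ^ 2) with ((4 / (d * d) * s ^ 2) * (G3 + G4)) by ring.
assert (Hzs : 0 < fst (z + RtoC s)%C) by (simpl; fold x; unfold d in *; lra).
assert (Hz0 : 0 < fst (z + RtoC 0)%C) by (simpl; fold x; lra).
apply is_Cint_le with (fun t => gamC (z + RtoC s) t - gamC (z + RtoC 0) t - RtoC s * (RtoC (ln t) * gamC z t))%C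
  (fun t => (4 / (d * d) * s ^ 2) * (gam (x + 2 * d) t + gam (x + - (2 * d)) t)).
- intros t Ht. rewrite Cplus_0_r, gamC_shift.
  replace (RtoC (exp (s * ln t)) * gamC z t - gamC z t - RtoC s * (RtoC (ln t) * gamC z t))%C
    with (RtoC (exp (s * ln t) - 1 - s * ln t) * gamC z t)%C by (rewrite !RtoC_minus, RtoC_mult; ring).
  rewrite Cmod_mult, Cmod_gamC, Cmod_R, !gam_shift. fold x.
  assert (Hg : 0 < gam x t) by apply exp_pos.
  set (v := ln t). rewrite <- Rmult_plus_distr_r, <- Rmult_assoc.
  apply Rmult_le_compat_r. lra.
  apply Rle_trans with (1 := exp_sub1_sub_id_le _).
  set (w := d * v).
  replace (2 * d * v) with (w + w) by (unfold w; ring). replace (- (2 * d) * v) with (- w + - w) by (unfold w; ring).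
  rewrite !exp_plus.
  assert (H1 : exp (s * v) <= exp w + exp (- w)).
  { apply exp_abs_le. unfold w. rewrite !Rabs_mult. apply Rmult_le_compat_r. apply Rabs_pos. rewrite (Rabs_pos_eq d); lra. }
  assert (H2 : exp (- (s * v)) <= exp w + exp (- w)).
  { apply exp_abs_le. unfold w. rewrite Rabs_Ropp, !Rabs_mult. apply Rmult_le_compat_r. apply Rabs_pos. rewrite (Rabs_pos_eq d); lra. }
  assert (H3 := cosh_ge w).
  assert (Hp := exp_pos w). assert (Hq := exp_pos (- w)).
  set (A := exp w) in *. set (B := exp (- w)) in *.
  (* Here [A = t^d] and [B = t^(-d)]. The factor [v^2] is removed by [w^2 <= A + B], and
     [(A + B)^2 <= 2 (A^2 + B^2)] then leads to the constant [4 / d^2]. *)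
  apply Rle_trans with (s * v * (s * v) * (2 * (A + B))).
  { apply Rmult_le_compat_l; nra. }
  apply Rmult_le_reg_l with (d * d). nra.
  replace (d * d * (s * v * (s * v) * (2 * (A + B)))) with (s ^ 2 * (w * w * (2 * (A + B)))) by (unfold w; ring).
  replace (d * d * (4 / (d * d) * s ^ 2 * (A * A + B * B))) with (s ^ 2 * (4 * (A * A + B * B))) by (field; lra).
  apply Rmult_le_compat_l. apply pow2_ge_0.
  apply Rle_trans with ((A + B) * (2 * (A + B))). apply Rmult_le_compat_r; lra.
  assert (Hsq := pow2_ge_0 (A - B)). nra.
- apply is_Cint_minus. apply is_Cint_minus; now apply is_Cint_Gamma. now apply is_Cint_scal.
- apply is_Rint_scal. now apply is_Rint_plus.
Qed.

Lemma cder_Gamma z : 0 < fst z -> cder (fun s => Gamma (z + RtoC s)) 0 (C_derive Gamma z).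
Proof.
intros Hz. destruct (Gamma_derivative z Hz) as [D [_ HD]]. now rewrite (C_derive_of_cder _ _ _ HD).
Qed.

Lemma is_Cint_Gamma_derive z : 0 < fst z -> is_Cint (fun t => RtoC (ln t) * gamC z t)%C (C_derive Gamma z).
Proof.
intros Hz. destruct (Gamma_derivative z Hz) as [D [H HD]]. now rewrite (C_derive_of_cder _ _ _ HD).
Qed.

(** The logarithmic derivative of [Gamma_succ], obtained by differentiating both sides of that
    equation along the horizontal line through [z]. *)
Lemma digamma_succ (z : C) : 0 < fst z -> Gamma z <> 0%C -> digamma (z + 1) = (digamma z + / z)%C.
Proof.
intros Hz H0. unfold digamma.
assert (Hz0 : z <> 0%C) by (intros E; rewrite E in Hz; simpl in Hz; lra).
replace (C_derive Gamma (z + 1)) with (Gamma z + z * C_derive Gamma z)%C.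
- rewrite Gamma_succ by exact Hz. field. now split.
- apply (cder_unique (fun s => Gamma (z + 1 + RtoC s)%C) 0); [|apply cder_Gamma; simpl; lra].
  apply (cder_ext_loc (fun s => (z + RtoC s) * Gamma (z + RtoC s))%C).
  + exists (mkposreal _ Hz). intros s Hs. change (Rabs (s - 0) < fst z) in Hs. apply Rabs_def2 in Hs.
    rewrite <- Gamma_succ by (simpl; lra). f_equal. ring.
  + eapply cder_eq. apply cder_mult.
    * apply (cder_plus (fun _ => z)). apply cder_const. apply cder_id.
    * now apply cder_Gamma.
    * cbv beta. rewrite !Cplus_0_r. ring.
Qed.

(** * Asymptotics of Gamma and digamma *)

Lemma Cexp_imag_dist (y u v : R) :
  Cmod (Cexp (Ci * RtoC (y * u)) - Cexp (Ci * RtoC (y * v)))%C <= Rabs y * Rabs (u - v).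
Proof.
assert (P : forall u v, u <= v -> Cmod (Cexp (Ci * RtoC (y * v)) - Cexp (Ci * RtoC (y * u)))%C <= Rabs y * (v - u)).
{ clear u v. intros u v Huv.
  apply (cder_bound (fun s => Cexp (Ci * RtoC (y * s))) (fun s => Ci * RtoC y * Cexp (Ci * RtoC (y * s)))%C). exact Huv.
  - intros s _. apply cder_Cexp. apply cder_scal. apply cder_RtoC. auto_derive. exact I. ring.
  - intros s _. rewrite !Cmod_mult, Cmod_Cexp, Cmod_R. simpl. rewrite Rmult_0_l, Rmult_0_r, Rminus_0_r, exp_0.
    replace (Cmod Ci) with 1. lra. symmetry. unfold Cmod, Ci; cbn [fst snd]. replace (0 ^ 2 + 1 ^ 2) with 1 by ring. apply sqrt_1. }
destruct (Rle_dec u v) as [H|H].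
- rewrite <- Cmod_opp, Copp_minus_distr, Rabs_minus_sym, (Rabs_pos_eq (v - u)) by lra. now apply P.
- rewrite (Rabs_pos_eq (u - v)) by lra. apply P; lra.
Qed.

(* With [u = t / c], [|ln u| <= (d + (ln u)^2 / d) / 2] and [(ln u)^2 <= u + 1 / u - 2] turn the
   logarithmic moment into power moments. *)
Lemma Gamma_concentration (z : C) G c d : 1 < fst z -> is_Rint (gam (fst z)) G -> 0 < c -> 0 < d ->
  let e := (d + (fst z / c + c / (fst z - 1) - 2) / d) / 2 in
  Cmod (C_derive Gamma z - RtoC (ln c) * Gamma z) <= e * G /\
  Cmod (Gamma z - Cexp (Ci * RtoC (snd z * ln c)) * RtoC G) <= Rabs (snd z) * (e * G).
Proof.
intros Hz HG Hc Hd e. set (X := fst z) in *.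
destruct (is_Rint_gam_ex (X - 1)) as [G' HG']. lra.
assert (HG2 := is_Rint_gam_succ X G ltac:(lra) HG).
assert (EG : G = (X - 1) * G').
{ assert (H := is_Rint_gam_succ (X - 1) G' ltac:(lra) HG'). replace (X - 1 + 1) with X in H by ring.
  apply RtoC_inj. apply (is_Cint_unique (fun t => RtoC (gam X t))); now apply is_Cint_RtoC. }
set (h := fun t => d / 2 * gam X t + / (2 * d) * (/ c * gam (X + 1) t + c * gam (X - 1) t - 2 * gam X t)).
assert (Hh : is_Rint h (e * G)).
{ apply is_Rint_eq with (d / 2 * G + / (2 * d) * (/ c * (X * G) + c * G' - 2 * G)).
  - apply is_Rint_plus. now apply is_Rint_scal. apply is_Rint_scal. apply is_Rint_minus. apply is_Rint_plus; now apply is_Rint_scal. now apply is_Rint_scal.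
  - unfold e. rewrite EG. field. lra. }
assert (Hb : forall t, 0 < t -> Rabs (ln t - ln c) * gam X t <= h t).
{ intros t Ht. unfold h.
  assert (Hg : 0 < gam X t) by apply exp_pos.
  change (X - 1) with (X + -1). rewrite !gam_shift, Rmult_1_l, exp_ln by exact Ht.
  replace (exp (-1 * ln t)) with (/ t) by (replace (-1 * ln t) with (- ln t) by ring; rewrite exp_Ropp, exp_ln by exact Ht; reflexivity).
  set (v := ln t - ln c).
  assert (H := cosh_ge v).
  assert (E1 : exp v = t / c) by (unfold v; rewrite exp_minus_ln, exp_ln by assumption; reflexivity).
  assert (E2 : exp (- v) = c / t) by (unfold v; rewrite Ropp_minus_distr, exp_minus_ln, exp_ln by assumption; reflexivity).
  rewrite E1, E2 in H.
  replace (d / 2 * gam X t + / (2 * d) * (/ c * (t * gam X t) + c * (/ t * gam X t) - 2 * gam X t))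
    with ((d + / d * (t / c + c / t - 2)) / 2 * gam X t) by (field; lra).
  apply Rmult_le_compat_r. lra.
  apply Rle_trans with ((d + / d * (v * v)) / 2).
  - apply Rmult_le_reg_l with (2 * d). lra. replace (2 * d * ((d + / d * (v * v)) / 2)) with (d * d + v * v) by (field; lra).
    assert (Hs := pow2_ge_0 (d - Rabs v)). assert (Hv : Rabs v * Rabs v = v * v) by (rewrite <- Rabs_mult; apply Rabs_pos_eq; nra). nra.
  - assert (Hi := Rinv_0_lt_compat d Hd). nra. }
assert (Hz0 : 0 < fst z) by (fold X; lra).
split.
- apply is_Cint_le with (fun t => RtoC (ln t) * gamC z t - RtoC (ln c) * gamC z t)%C h; [| |exact Hh].
  + intros t Ht. replace (RtoC (ln t) * gamC z t - RtoC (ln c) * gamC z t)%C with (RtoC (ln t - ln c) * gamC z t)%C by (rewrite RtoC_minus; ring).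
    rewrite Cmod_mult, Cmod_R, Cmod_gamC. now apply Hb.
  + apply is_Cint_minus. now apply is_Cint_Gamma_derive. apply is_Cint_scal. now apply is_Cint_Gamma.
(* [gamC z t] is [gam X t] times the unimodular factor [t^(i Im z)]. Freezing that factor at [t = c]
   costs at most [|Im z| |ln t - ln c|], so the majorant [h] serves again. *)
- apply is_Cint_le with (fun t => gamC z t - Cexp (Ci * RtoC (snd z * ln c)) * RtoC (gam X t))%C (fun t => Rabs (snd z) * h t).
  + intros t Ht.
    replace (gamC z t) with (Cexp (Ci * RtoC (snd z * ln t)) * RtoC (gam X t))%C.
    2:{ unfold gamC, gam. rewrite <- Cexp_RtoC, <- Cexp_plus. f_equal. unfold X. apply injective_projections; simpl; ring. }
    replace (_ - _)%C with ((Cexp (Ci * RtoC (snd z * ln t)) - Cexp (Ci * RtoC (snd z * ln c))) * RtoC (gam X t))%C by ring.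
    assert (Hg : 0 < gam X t) by apply exp_pos.
    rewrite Cmod_mult, Cmod_R, (Rabs_pos_eq (gam X t)) by lra.
    apply Rle_trans with (Rabs (snd z) * Rabs (ln t - ln c) * gam X t).
    * apply Rmult_le_compat_r. lra. apply Cexp_imag_dist.
    * rewrite Rmult_assoc. apply Rmult_le_compat_l. apply Rabs_pos. now apply Hb.
  + apply is_Cint_minus. now apply is_Cint_Gamma. apply is_Cint_scal. now apply is_Cint_RtoC.
  + now apply is_Rint_scal.
Qed.

Lemma INR_above M : exists N : nat, forall n : nat, (N <= n)%nat -> M < INR n.
Proof.
exists (Z.to_nat (up M)). intros n Hn.
destruct (archimed M) as [H1 _]. apply Rlt_le_trans with (1 := H1).
apply le_INR in Hn. apply Rle_trans with (2 := Hn). rewrite INR_IZR_INZ. apply IZR_le. lia.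
Qed.

(** Both claims come from one concentration estimate: [Gamma z] lies within [G / 2] of a number of
    modulus [G], which makes it nonzero and gives the lower bound [G / 2] needed to divide the other
    estimate by it. *)
Lemma Gamma_digamma_asymptotic (a : C) eps : 0 < fst a -> 0 < eps ->
  exists N : nat, forall n : nat, (N <= n)%nat ->
    Gamma (a + RtoC (INR n)) <> 0%C /\ Cmod (digamma (a + RtoC (INR n)) - RtoC (ln (INR n))) < eps.
Proof.
intros Ha He. set (y := Rabs (snd a)). assert (Hy : 0 <= y) by apply Rabs_pos.
(* The first entry makes the error of [digamma] at most [2 d <= eps / 2]; the second keeps the
   oscillation error [y d G] below [G / 2]. *)
set (d := Rmin (eps / 4) (/ (2 * (y + 1)))).
assert (Hd : 0 < d). { apply Rmin_pos. lra. apply Rinv_0_lt_compat; lra. }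
assert (Hd1 : d <= eps / 4) by apply Rmin_l.
assert (Hd2 : y * d <= / 2).
{ apply Rle_trans with (y * / (2 * (y + 1))). apply Rmult_le_compat_l. exact Hy. apply Rmin_r.
  apply Rmult_le_reg_r with (2 * (y + 1)). lra. rewrite Rmult_assoc, Rinv_l by lra. lra. }
(* Beyond this threshold the moment excess [X/c + c/(X-1) - 2], at most [(Re a + 1)/(c - 2)], is
   below [d^2], so that [e <= d]. *)
destruct (INR_above (2 + (fst a + 1) / (d * d))) as [N HN]. exists N. intros n Hn. specialize (HN n Hn).
set (c := INR n) in *. set (z := (a + RtoC c)%C).
assert (Hq : 0 < (fst a + 1) / (d * d)) by (apply Rdiv_lt_0_compat; nra).
assert (Hz : fst z = fst a + c) by (simpl; ring). assert (Hz2 : snd z = snd a) by (simpl; ring).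
destruct (is_Rint_gam_ex (fst z)) as [G HG]. lra.
assert (HGp := is_Rint_gam_pos (fst z) G ltac:(lra) HG).
destruct (Gamma_concentration z G c d ltac:(lra) HG ltac:(lra) Hd) as [H1 H2].
rewrite Hz2 in H2 at 2. fold y in H2.
assert (Hm : fst z / c + c / (fst z - 1) - 2 <= d * d).
{ rewrite Hz. replace ((fst a + c) / c + c / (fst a + c - 1) - 2) with (fst a / c + (1 - fst a) / (fst a + c - 1)) by (field; lra).
  apply Rle_trans with (fst a / (c - 2) + 1 / (c - 2)).
  - apply Rplus_le_compat.
    + apply Rmult_le_compat_l. lra. apply Rinv_le_contravar; lra.
    + apply Rle_trans with (1 / (fst a + c - 1)). apply Rmult_le_compat_r. left; apply Rinv_0_lt_compat; lra. lra.
      apply Rmult_le_compat_l. lra. apply Rinv_le_contravar; lra.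
  - replace (fst a / (c - 2) + 1 / (c - 2)) with ((fst a + 1) / (c - 2)) by (field; lra).
    apply Rle_div_l. lra. assert (Hl : (fst a + 1) / (d * d) < c - 2) by lra.
    apply Rlt_div_l in Hl. lra. nra. }
set (e := (d + (fst z / c + c / (fst z - 1) - 2) / d) / 2) in *.
assert (Hed : e <= d).
{ unfold e. assert ((fst z / c + c / (fst z - 1) - 2) / d <= d). apply Rle_div_l; lra. lra. }
assert (HG2 : G / 2 <= Cmod (Gamma z)).
{ set (w := (Cexp (Ci * RtoC (snd z * ln c)) * RtoC G)%C) in *.
  assert (Hw : Cmod w = G).
  { unfold w. rewrite Cmod_mult, Cmod_Cexp, Cmod_R, (Rabs_pos_eq G) by lra. simpl. rewrite Rmult_0_l, Rmult_0_r, Rminus_0_r, exp_0. ring. }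
  assert (Ht := Cmod_triangle (Gamma z) (- (Gamma z - w))). rewrite Cmod_opp in Ht.
  replace (Gamma z + - (Gamma z - w))%C with w in Ht by ring.
  assert (y * (e * G) <= / 2 * G). { apply Rle_trans with (y * d * G); [|nra]. rewrite Rmult_assoc. apply Rmult_le_compat_l. exact Hy. nra. }
  lra. }
assert (HG0 : Gamma z <> 0%C). { apply Cmod_gt_0. lra. }
split. exact HG0.
unfold digamma.
replace (C_derive Gamma z / Gamma z - RtoC (ln c))%C with ((C_derive Gamma z - RtoC (ln c) * Gamma z) / Gamma z)%C by (field; exact HG0).
rewrite Cmod_div by exact HG0.
apply Rlt_div_l. lra.
assert (e * G <= eps / 4 * G) by nra. nra.
Qed.

(** A zero at [a] would propagate by the functional equation to every [a + n], against the
    asymptotics. *)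
Lemma Gamma_neq_0 (a : C) : 0 < fst a -> Gamma a <> 0%C.
Proof.
intros Ha H0.
destruct (Gamma_digamma_asymptotic a 1 Ha Rlt_0_1) as [N HN].
destruct (HN N (Nat.le_refl N)) as [H _]. apply H. clear H HN.
induction N as [|N IH].
- simpl. now rewrite Cplus_0_r.
- rewrite S_INR, RtoC_plus, Cplus_assoc, Gamma_succ, IH. ring.
  assert (HN := pos_INR N). simpl. lra.
Qed.

Lemma digamma_add_nat (a : C) n : 0 < fst a ->
  digamma (a + RtoC (INR n)) = (digamma a + Csum (fun k => / (a + RtoC (INR k))) n)%C.
Proof.
intros Ha. induction n as [|n IH].
- simpl. now rewrite !Cplus_0_r.
- assert (Hn := pos_INR n).
  assert (H : 0 < fst (a + RtoC (INR n))%C) by (simpl; lra).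
  rewrite S_INR, RtoC_plus, Cplus_assoc, digamma_succ, IH by (try apply Gamma_neq_0; exact H).
  simpl. ring.
Qed.

Lemma digamma_limit (a : C) : 0 < fst a ->
  Clim eventually (fun n => Csum (fun k => / (a + RtoC (INR k))) n - RtoC (ln (INR n)))%C (- digamma a)%C.
Proof.
intros Ha eps He. destruct (Gamma_digamma_asymptotic a eps Ha He) as [N HN].
exists N. intros n Hn. destruct (HN n Hn) as [_ H]. rewrite digamma_add_nat in H by exact Ha.
replace (_ - - digamma a)%C with (digamma a + Csum (fun k => / (a + RtoC (INR k))) n - RtoC (ln (INR n)))%C by ring.
exact H.
Qed.

(** * Partial fractions of the hyperbolic cotangent *)

(* [cosB n] is the derivative of [cosA n] in [t], so [cosB_rec] is the derivative of [cosA_rec].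
   Hence [cosB n / cosA n], the logarithmic derivative, changes by [- 2 t / ((n + 2)^2 + t^2)] when
   [n] increases by 2; it starts from a hyperbolic cotangent and tends to 0. *)
Definition cosA (n : nat) (t : R) : R := RInt (fun x => cos x ^ n * cosh (t * x)) 0 (PI / 2).
Definition cosB (n : nat) (t : R) : R := RInt (fun x => cos x ^ n * (x * sinh (t * x))) 0 (PI / 2).

Lemma ex_RInt_ex_derive (f : R -> R) a b : (forall x, ex_derive f x) -> ex_RInt f a b.
Proof.
intros H. apply (ex_RInt_continuous (V := R_CompleteNormedModule)).
intros x _. exact (ex_derive_continuous (V := R_NormedModule) f x (H x)).
Qed.

Lemma is_RInt_derive_R (F f : R -> R) a b : (forall x, is_derive F x (f x)) -> (forall x, ex_derive f x) ->
  is_RInt f a b (F b - F a).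
Proof.
intros HF Hf. apply (is_RInt_derive (V := R_CompleteNormedModule) F f).
- intros x _. apply HF.
- intros x _. exact (ex_derive_continuous (V := R_NormedModule) f x (Hf x)).
Qed.

Lemma is_RInt_cosA n t : is_RInt (fun x => cos x ^ n * cosh (t * x)) 0 (PI / 2) (cosA n t).
Proof.
apply (RInt_correct (V := R_CompleteNormedModule)), ex_RInt_ex_derive.
intros x. unfold cosh. auto_derive. exact I.
Qed.

Lemma is_RInt_cosB n t : is_RInt (fun x => cos x ^ n * (x * sinh (t * x))) 0 (PI / 2) (cosB n t).
Proof.
apply (RInt_correct (V := R_CompleteNormedModule)), ex_RInt_ex_derive.
intros x. unfold sinh. auto_derive. exact I.
Qed.

Lemma is_RInt_unique_R (f : R -> R) a b l l' : is_RInt f a b l -> is_RInt f a b l' -> l = l'.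
Proof. intros H1 H2. apply (is_RInt_unique (V := R_CompleteNormedModule)) in H1, H2. congruence. Qed.

(** Two integrations by parts merged into one exact derivative. Its primitive [F] vanishes at
    [PI / 2] through the positive powers of the cosine, and at 0 through [sin] and [sinh]. *)
Lemma cosA_rec n t : (INR (n + 2) ^ 2 + t ^ 2) * cosA (n + 2) t = INR (n + 2) * INR (n + 1) * cosA n t.
Proof.
set (F := fun x => - INR (n + 2) * cos x ^ (n + 1) * sin x * cosh (t * x) - t * cos x ^ (n + 2) * sinh (t * x)).
set (f := fun x => INR (n + 2) * INR (n + 1) * (cos x ^ n * cosh (t * x)) - (INR (n + 2) ^ 2 + t ^ 2) * (cos x ^ (n + 2) * cosh (t * x))).
assert (H1 : is_RInt f 0 (PI / 2) (F (PI / 2) - F 0)).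
{ apply is_RInt_derive_R; intros x; unfold F, f, cosh, sinh.
  - auto_derive. exact I.
    replace (Init.Nat.pred (n + 1)) with n by lia. replace (Init.Nat.pred (n + 2)) with (n + 1)%nat by lia.
    rewrite !pow_add, !plus_INR; simpl.
    assert (E := sin2_cos2 x). unfold Rsqr in E.
    assert (E2 : sin x * sin x = 1 - cos x * cos x) by lra.
    set (X := cos x ^ n). set (s := sin x) in *. set (c := cos x) in *.
    set (p := exp (t * x)). set (q := exp (- (t * x))).
    field [E2].
  - auto_derive. exact I. }
assert (H2 : is_RInt f 0 (PI / 2) (INR (n + 2) * INR (n + 1) * cosA n t - (INR (n + 2) ^ 2 + t ^ 2) * cosA (n + 2) t)).
{ apply (is_RInt_minus (V := R_NormedModule)); apply (is_RInt_scal (V := R_NormedModule)); apply is_RInt_cosA. }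
assert (E := is_RInt_unique_R _ _ _ _ _ H1 H2).
assert (E0 : F (PI / 2) - F 0 = 0).
{ unfold F. rewrite cos_PI2, sin_0. replace (t * 0) with 0 by ring. rewrite sinh_0, !pow_i by lia. ring. }
lra.
Qed.

Lemma cosB_rec n t : (INR (n + 2) ^ 2 + t ^ 2) * cosB (n + 2) t + 2 * t * cosA (n + 2) t = INR (n + 2) * INR (n + 1) * cosB n t.
Proof.
(* The derivative in [t] of the primitive used for [cosA_rec]. *)
set (F := fun x => - INR (n + 2) * cos x ^ (n + 1) * sin x * (x * sinh (t * x)) - cos x ^ (n + 2) * (sinh (t * x) + t * x * cosh (t * x))).
set (f := fun x => INR (n + 2) * INR (n + 1) * (cos x ^ n * (x * sinh (t * x))) -
  ((INR (n + 2) ^ 2 + t ^ 2) * (cos x ^ (n + 2) * (x * sinh (t * x))) + 2 * t * (cos x ^ (n + 2) * cosh (t * x)))).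
assert (H1 : is_RInt f 0 (PI / 2) (F (PI / 2) - F 0)).
{ apply is_RInt_derive_R; intros x; unfold F, f, cosh, sinh.
  - auto_derive. exact I.
    replace (Init.Nat.pred (n + 1)) with n by lia. replace (Init.Nat.pred (n + 2)) with (n + 1)%nat by lia.
    rewrite !pow_add, !plus_INR; simpl.
    assert (E := sin2_cos2 x). unfold Rsqr in E.
    assert (E2 : sin x * sin x = 1 - cos x * cos x) by lra.
    set (X := cos x ^ n). set (s := sin x) in *. set (c := cos x) in *.
    set (p := exp (t * x)). set (q := exp (- (t * x))).
    field [E2].
  - auto_derive. exact I. }
assert (H2 : is_RInt f 0 (PI / 2) (INR (n + 2) * INR (n + 1) * cosB n t - ((INR (n + 2) ^ 2 + t ^ 2) * cosB (n + 2) t + 2 * t * cosA (n + 2) t))).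
{ exact (is_RInt_minus _ _ _ _ _ _ (is_RInt_scal _ _ _ _ _ (is_RInt_cosB n t))
    (is_RInt_plus _ _ _ _ _ _ (is_RInt_scal _ _ _ _ _ (is_RInt_cosB (n + 2) t)) (is_RInt_scal _ _ _ _ _ (is_RInt_cosA (n + 2) t)))). }
assert (E := is_RInt_unique_R _ _ _ _ _ H1 H2).
assert (E0 : F (PI / 2) - F 0 = 0).
{ unfold F. rewrite cos_PI2, sin_0. replace (t * 0) with 0 by ring. rewrite sinh_0, !pow_i by lia. ring. }
lra.
Qed.

Lemma cosA_0 t : t <> 0 -> cosA 0 t = sinh (t * (PI / 2)) / t.
Proof.
intros Ht. apply (is_RInt_unique_R (fun x => cos x ^ 0 * cosh (t * x)) 0 (PI / 2)). apply is_RInt_cosA.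
replace (sinh (t * (PI / 2)) / t) with (sinh (t * (PI / 2)) / t - sinh (t * 0) / t).
- apply (is_RInt_derive_R (fun x => sinh (t * x) / t)); intros x; unfold sinh, cosh; auto_derive; try exact I; try exact Ht. simpl; field; exact Ht.
- rewrite Rmult_0_r, sinh_0. field; exact Ht.
Qed.

Lemma cosB_0 t : t <> 0 -> cosB 0 t = PI / 2 * cosh (t * (PI / 2)) / t - sinh (t * (PI / 2)) / t ^ 2.
Proof.
intros Ht. apply (is_RInt_unique_R (fun x => cos x ^ 0 * (x * sinh (t * x))) 0 (PI / 2)). apply is_RInt_cosB.
replace (PI / 2 * cosh (t * (PI / 2)) / t - sinh (t * (PI / 2)) / t ^ 2)
  with (PI / 2 * cosh (t * (PI / 2)) / t - sinh (t * (PI / 2)) / t ^ 2 - (0 * cosh (t * 0) / t - sinh (t * 0) / t ^ 2)).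
- apply (is_RInt_derive_R (fun x => x * cosh (t * x) / t - sinh (t * x) / t ^ 2)); intros x; unfold sinh, cosh; auto_derive; try exact I; repeat split; try exact Ht; try (simpl; field; exact Ht).
- rewrite (Rmult_0_r t), sinh_0. field; exact Ht.
Qed.

Lemma sinh_nonneg x : 0 <= x -> 0 <= sinh x.
Proof. intros Hx. unfold sinh. assert (exp (- x) <= exp x) by (apply exp_le; lra). lra. Qed.

Lemma cosB_nonneg n t : 0 <= t -> 0 <= cosB n t.
Proof.
intros Ht. assert (HP := PI_RGT_0).
apply (is_RInt_ge_0 (fun x => cos x ^ n * (x * sinh (t * x))) 0 (PI / 2)); [lra|apply is_RInt_cosB|].
intros x Hx. apply Rmult_le_pos.
- apply pow_le, cos_ge_0; lra.
- apply Rmult_le_pos. lra. apply sinh_nonneg. nra.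
Qed.

(* Since [x <= tan x], the factor [x cos x] in [cosB] is at most [sin x], and one integration by
   parts brings back [cosA]. *)
Lemma cosB_le n t : 0 <= t -> INR (n + 1) * cosB (n + 1) t <= t * cosA (n + 1) t.
Proof.
intros Ht. assert (HP := PI_RGT_0).
set (f := fun x => t * (cos x ^ (n + 1) * cosh (t * x)) - INR (n + 1) * (cos x ^ n * sin x * sinh (t * x))).
set (F := fun x => cos x ^ (n + 1) * sinh (t * x)).
assert (H1 : is_RInt f 0 (PI / 2) (F (PI / 2) - F 0)).
{ apply is_RInt_derive_R; intros x; unfold F, f, sinh, cosh.
  - auto_derive. exact I. replace (Init.Nat.pred (n + 1)) with n by lia. field.
  - auto_derive. exact I. }
assert (H2 : is_RInt (fun x => t * (cos x ^ (n + 1) * cosh (t * x)) - f x) 0 (PI / 2) (t * cosA (n + 1) t - (F (PI / 2) - F 0))).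
{ apply (is_RInt_minus (V := R_NormedModule)). apply (is_RInt_scal (V := R_NormedModule)), is_RInt_cosA. exact H1. }
assert (E0 : F (PI / 2) - F 0 = 0).
{ unfold F. rewrite cos_PI2, Rmult_0_r, sinh_0, pow_i by lia. ring. }
rewrite E0, Rminus_0_r in H2.
refine (is_RInt_le _ _ 0 (PI / 2) _ _ _ (is_RInt_scal (V := R_NormedModule) _ _ _ (INR (n + 1)) _ (is_RInt_cosB (n + 1) t)) H2 _). lra.
intros x Hx. change (INR (n + 1) * (cos x ^ (n + 1) * (x * sinh (t * x))) <= t * (cos x ^ (n + 1) * cosh (t * x)) - f x).
replace (t * (cos x ^ (n + 1) * cosh (t * x)) - f x) with (INR (n + 1) * (cos x ^ n * sin x * sinh (t * x))) by (unfold f; ring).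
apply Rmult_le_compat_l. apply pos_INR.
rewrite pow_add, pow_1.
assert (Hs : 0 <= sinh (t * x)) by (apply sinh_nonneg; nra).
assert (Hc : 0 <= cos x ^ n) by (apply pow_le, cos_ge_0; lra).
assert (Hx2 : x * cos x <= sin x).
{ destruct (MVT_gen (fun x => sin x - x * cos x) 0 x (fun x => x * sin x)) as [c [Hc1 E]].
  - intros y _. auto_derive. exact I. ring.
  - intros y _. apply ex_derive_continuity_pt. auto_derive. exact I.
  - rewrite Rmin_left, Rmax_right in Hc1 by lra. cbv beta in E. rewrite sin_0 in E.
    assert (0 <= sin c) by (apply sin_ge_0; lra).
    assert (0 <= c * sin c * (x - 0)) by (repeat apply Rmult_le_pos; lra). lra. }
replace (cos x ^ n * cos x * (x * sinh (t * x))) with (cos x ^ n * sinh (t * x) * (x * cos x)) by ring.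
replace (cos x ^ n * sin x * sinh (t * x)) with (cos x ^ n * sinh (t * x) * sin x) by ring.
apply Rmult_le_compat_l. now apply Rmult_le_pos. exact Hx2.
Qed.

Fixpoint Rsum (f : nat -> R) (n : nat) : R :=
  match n with O => 0 | S m => Rsum f m + f m end.

(** The recurrence multiplies by positive factors, so strict positivity passes from the explicit
    value at index 0 to all even indices. *)
Lemma cosA_pos m t : 0 < t -> 0 < cosA (2 * m) t.
Proof.
intros Ht. assert (HP := PI_RGT_0). induction m as [|m IH].
- simpl. rewrite cosA_0 by lra. apply Rdiv_lt_0_compat; [|exact Ht].
  unfold sinh. assert (exp (- (t * (PI / 2))) < exp (t * (PI / 2))) by (apply exp_increasing; nra). lra.
- assert (H := cosA_rec (2 * m) t). replace (2 * S m)%nat with (2 * m + 2)%nat by lia.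
  assert (0 < INR (2 * m + 2)) by (apply lt_0_INR; lia). assert (0 < INR (2 * m + 1)) by (apply lt_0_INR; lia).
  assert (0 < INR (2 * m + 2) * INR (2 * m + 1) * cosA (2 * m) t) by (repeat apply Rmult_lt_0_compat; assumption).
  assert (0 < INR (2 * m + 2) ^ 2 + t ^ 2) by nra. nra.
Qed.

Lemma cosB_div_cosA m t : 0 < t -> cosB (2 * m) t / cosA (2 * m) t =
  PI / 2 * (cosh (t * (PI / 2)) / sinh (t * (PI / 2))) - / t - Rsum (fun k => 2 * t / (t ^ 2 + 4 * INR (S k) ^ 2)) m.
Proof.
intros Ht. induction m as [|m IH].
- assert (H := cosA_pos 0 t Ht). simpl in H. simpl Nat.mul. rewrite cosA_0 in * by lra. rewrite cosB_0 by lra. simpl.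
  assert (0 < sinh (t * (PI / 2))). { apply Rmult_lt_reg_r with (/ t). now apply Rinv_0_lt_compat. unfold Rdiv in H. lra. }
  field. lra.
- assert (HA := cosA_pos m t Ht). assert (HA' := cosA_pos (S m) t Ht).
  assert (H1 := cosA_rec (2 * m) t). assert (H2 := cosB_rec (2 * m) t).
  cbn [Rsum]. rewrite S_INR.
  replace (2 * S m)%nat with (2 * m + 2)%nat in * by lia.
  replace (INR (2 * m + 2)) with (2 * (INR m + 1)) in * by (rewrite plus_INR, mult_INR; simpl; ring).
  assert (Hm := pos_INR m).
  assert (0 < INR (2 * m + 1)) by (apply lt_0_INR; lia).
  set (D := (2 * (INR m + 1)) ^ 2 + t ^ 2) in *. assert (HD : 0 < D) by (unfold D; nra).
  replace (t ^ 2 + 4 * (INR m + 1) ^ 2) with D by (unfold D; ring).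
  apply Rplus_eq_reg_r with (2 * t / D).
  match goal with |- _ = ?X => replace X with (cosB (2 * m) t / cosA (2 * m) t) by (rewrite IH; ring) end.
  set (K := 2 * (INR m + 1) * INR (2 * m + 1)) in *. assert (HK : 0 < K) by (unfold K; nra).
  replace (cosB (2 * m) t / cosA (2 * m) t) with ((K * cosB (2 * m) t) / (K * cosA (2 * m) t)) by (field; lra).
  rewrite <- H1, <- H2. field. lra.
Qed.

Definition bose (t : R) : R := / (exp (2 * PI * t) - 1).

(** The remainder is exactly [cosB / cosA] of index [2 (m + 1)] at [2 t]: a quotient of nonnegative
    integrals, at most [2 t / (2 (m + 1))] by [cosB_le]. Doubling [t] turns the hyperbolic cotangent
    of [t PI / 2] into that of [PI t], which is [1 + 2 * bose t]. *)
Lemma coth_remainder t m : 0 < t ->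
  0 <= PI * bose t + PI / 2 - / (2 * t) - Rsum (fun k => t / (t ^ 2 + INR (S k) ^ 2)) (S m) <= t / INR (S m).
Proof.
intros Ht. assert (HP := PI_RGT_0).
assert (E := cosB_div_cosA (S m) (2 * t) ltac:(lra)).
assert (HA := cosA_pos (S m) (2 * t) ltac:(lra)).
assert (HB := cosB_nonneg (2 * S m) (2 * t) ltac:(lra)).
assert (HB2 := cosB_le (2 * m + 1) (2 * t) ltac:(lra)).
replace (2 * m + 1 + 1)%nat with (2 * S m)%nat in HB2 by lia.
replace (PI * bose t + PI / 2 - / (2 * t) - Rsum (fun k => t / (t ^ 2 + INR (S k) ^ 2)) (S m))
  with (cosB (2 * S m) (2 * t) / cosA (2 * S m) (2 * t)).
- assert (Hm : 0 < INR (S m)) by (apply lt_0_INR; lia).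
  split. now apply Rle_mult_inv_pos.
  apply Rle_div_l. exact HA.
  replace (INR (2 * S m)) with (2 * INR (S m)) in HB2 by (rewrite mult_INR; simpl; ring).
  apply Rmult_le_reg_l with (2 * INR (S m)). lra.
  replace (2 * INR (S m) * (t / INR (S m) * cosA (2 * S m) (2 * t))) with (2 * t * cosA (2 * S m) (2 * t)) by (field; lra). exact HB2.
- rewrite E.
  assert (ES : forall n, Rsum (fun k => 2 * (2 * t) / ((2 * t) ^ 2 + 4 * INR (S k) ^ 2)) n = Rsum (fun k => t / (t ^ 2 + INR (S k) ^ 2)) n).
  { induction n as [|n IH]; [reflexivity|]. cbn [Rsum]. rewrite IH. f_equal.
    assert (0 <= INR (S n) ^ 2) by apply pow2_ge_0. field. split; nra. }
  rewrite ES.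
  assert (EC : PI / 2 * (cosh (2 * t * (PI / 2)) / sinh (2 * t * (PI / 2))) = PI * bose t + PI / 2); [|lra].
  unfold bose, cosh, sinh.
  assert (E2 : exp (2 * PI * t) = exp (2 * t * (PI / 2)) * exp (2 * t * (PI / 2))) by (rewrite <- exp_plus; f_equal; lra).
  rewrite E2, exp_Ropp.
  assert (1 < exp (2 * t * (PI / 2))) by (rewrite <- exp_0; apply exp_increasing; nra).
  set (y := exp (2 * t * (PI / 2))) in *. field. repeat split; nra.
Qed.

(** * Logarithmic primitives on the right half-plane *)

Lemma Clim_eq {T} (F : (T -> Prop) -> Prop) (f : T -> C) (l l' : C) : Clim F f l -> l = l' -> Clim F f l'.
Proof. now intros H <-. Qed.

Lemma cder_Clim (f : R -> C) t0 l (F : (R -> Prop) -> Prop) : Filter F -> filter_le F (locally t0) ->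
  cder f t0 l -> Clim F f (f t0).
Proof.
intros FF HF H. apply filterlim_Clim. exact FF.
apply filterlim_filter_le_1 with (1 := HF).
exact (ccont_continuous _ _ (cder_ccont _ _ _ H)).
Qed.

Lemma Cneq_0_fst (z : C) : 0 < fst z -> z <> 0%C.
Proof. intros H E. rewrite E in H. simpl in H. lra. Qed.

(** A point [a + i t] with [t] large, turned by [-i], becomes [t - i a], a bounded perturbation of a
    positive real, for which [Clog_add_real_bound] applies. The quarter turn accounts for [PI / 2];
    the sign conditions keep both arguments in the right half-plane. *)
Lemma Clog_rot (z : C) : 0 < fst z -> 0 < snd z -> Clog z = (Clog (- Ci * z) + Ci * RtoC (PI / 2))%C.
Proof.
intros H1 H2. rewrite !Clog_atan by (simpl; lra).
rewrite Cmod_mult, Cmod_opp.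
replace (Cmod Ci) with 1 by (symmetry; unfold Cmod, Ci; cbn [fst snd]; replace (0 ^ 2 + 1 ^ 2) with 1 by ring; apply sqrt_1).
apply injective_projections; simpl.
- replace (1 * Cmod z) with (Cmod z) by ring. ring.
- replace ((- 0 * snd z + - (1) * fst z) / (- 0 * fst z - - (1) * snd z)) with (- / (snd z / fst z)) by (field; lra).
  rewrite atan_opp, atan_inv by (now apply Rdiv_lt_0_compat). ring.
Qed.

Lemma Clog_rot' (z : C) : 0 < fst z -> snd z < 0 -> Clog z = (Clog (Ci * z) - Ci * RtoC (PI / 2))%C.
Proof.
intros H1 H2. rewrite (Clog_rot (Ci * z)) by (simpl; lra).
replace (- Ci * (Ci * z))%C with z. ring. apply injective_projections; simpl; ring.
Qed.

Lemma Clog_add_real_bound (b : C) t : Cmod b < t -> Cmod (Clog (RtoC t + b) - RtoC (ln t)) <= Cmod b / (t - Cmod b).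
Proof.
intros Ht. assert (Hb := Cmod_ge_0 b).
assert (Hx := Rabs_fst_le b). apply Rabs_le_between in Hx.
rewrite <- Clog_RtoC by lra.
replace (Clog (RtoC t + b) - Clog (RtoC t))%C with (Clog (RtoC t + RtoC 1 * b) - Clog (RtoC t + RtoC 0 * b))%C.
2:{ f_equal; f_equal. f_equal; ring. f_equal. ring. }
replace (Cmod b / (t - Cmod b)) with (Cmod b / (t - Cmod b) * (1 - 0)) by ring.
assert (Hs : forall s, 0 <= s <= 1 -> t - Cmod b <= fst (RtoC t + RtoC s * b)%C).
{ intros s Hs. simpl. nra. }
apply (cder_bound (fun s => Clog (RtoC t + RtoC s * b)) (fun s => (0 + (1 * b + RtoC s * 0)) / (RtoC t + RtoC s * b))%C). lra.
- intros s H. apply cder_Clog.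
  + apply (cder_plus (fun _ => RtoC t)). apply cder_const. apply (cder_mult (fun s => RtoC s) (fun _ => b)). apply cder_id. apply cder_const.
  + specialize (Hs s H). lra.
- intros s H. specialize (Hs s H).
  replace (0 + (1 * b + RtoC s * 0))%C with b by ring.
  rewrite Cmod_div by (apply Cneq_0_fst; lra).
  apply Rmult_le_compat_l. exact Hb. apply Rinv_le_contravar. lra.
  apply Rle_trans with (1 := Hs). apply Rle_trans with (2 := Rabs_fst_le _). apply Rle_abs.
Qed.

Lemma Clog_add_real_limit (b : C) : Clim (Rbar_locally p_infty) (fun t => Clog (RtoC t + b) - RtoC (ln t))%C 0%C.
Proof.
intros eps He. assert (Hb := Cmod_ge_0 b).
assert (Hq : 0 <= Cmod b / eps) by (apply Rle_mult_inv_pos; assumption).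
exists (Cmod b + Cmod b / eps). intros t Ht.
unfold Cminus at 1. rewrite Copp_0, Cplus_0_r.
apply Rle_lt_trans with (1 := Clog_add_real_bound b t ltac:(lra)).
apply Rlt_div_l. lra.
assert (H : Cmod b / eps < t - Cmod b) by lra. apply Rlt_div_l in H; lra.
Qed.

Lemma Clog_up_limit (a : C) : 0 < fst a ->
  Clim (Rbar_locally p_infty) (fun t => Clog (a + Ci * RtoC t) - RtoC (ln t))%C (Ci * RtoC (PI / 2))%C.
Proof.
intros Ha. apply Clim_ext with (fun t => (Clog (RtoC t + - Ci * a) - RtoC (ln t)) + Ci * RtoC (PI / 2))%C.
typeclasses eauto.
- exists (Rabs (snd a)). intros t Ht. assert (H := Rle_abs (- snd a)). rewrite Rabs_Ropp in H.
  rewrite (Clog_rot (a + Ci * RtoC t)) by (simpl; lra).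
  replace (- Ci * (a + Ci * RtoC t))%C with (RtoC t + - Ci * a)%C. ring. apply injective_projections; simpl; ring.
- apply Clim_eq with (0 + Ci * RtoC (PI / 2))%C; [|ring].
  apply Clim_plus. typeclasses eauto. apply Clog_add_real_limit. apply Clim_const. typeclasses eauto.
Qed.

Lemma Clog_down_limit (a : C) : 0 < fst a ->
  Clim (Rbar_locally p_infty) (fun t => Clog (a - Ci * RtoC t) - RtoC (ln t))%C (- (Ci * RtoC (PI / 2)))%C.
Proof.
intros Ha. apply Clim_ext with (fun t => (Clog (RtoC t + Ci * a) - RtoC (ln t)) + - (Ci * RtoC (PI / 2)))%C.
typeclasses eauto.
- exists (Rabs (snd a)). intros t Ht. assert (H := Rle_abs (snd a)).
  rewrite (Clog_rot' (a - Ci * RtoC t)) by (simpl; lra).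
  replace (Ci * (a - Ci * RtoC t))%C with (RtoC t + Ci * a)%C. ring. apply injective_projections; simpl; ring.
- apply Clim_eq with (0 + - (Ci * RtoC (PI / 2)))%C; [|ring].
  apply Clim_plus. typeclasses eauto. apply Clog_add_real_limit. apply Clim_const. typeclasses eauto.
Qed.

Lemma cder_Clog_up (a : C) t : 0 < fst a -> cder (fun t => Clog (a + Ci * RtoC t)) t (Ci / (a + Ci * RtoC t))%C.
Proof.
intros Ha. eapply cder_eq. apply (cder_Clog (fun t => a + Ci * RtoC t)%C).
- apply (cder_plus (fun _ => a)). apply cder_const. apply cder_scal. apply cder_id.
- simpl; lra.
- cbv beta. f_equal. ring.
Qed.

Lemma cder_Clog_down (a : C) t : 0 < fst a -> cder (fun t => Clog (a - Ci * RtoC t)) t (- Ci / (a - Ci * RtoC t))%C.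
Proof.
intros Ha. eapply cder_eq. apply (cder_Clog (fun t => a - Ci * RtoC t)%C).
- apply (cder_minus (fun _ => a)). apply cder_const. apply cder_scal. apply cder_id.
- simpl; lra.
- cbv beta. f_equal. ring.
Qed.

Definition den (a : C) (t : R) : C := (RtoC t * RtoC t + a * a)%C.

Lemma den_factor a t : den a t = ((a + Ci * RtoC t) * (a - Ci * RtoC t))%C.
Proof. unfold den. apply injective_projections; simpl; ring. Qed.

Lemma den_neq_0 (a : C) t : 0 < fst a -> den a t <> 0%C.
Proof.
intros Ha. rewrite den_factor. apply Cmult_neq_0; apply Cneq_0_fst; simpl; lra.
Qed.

Lemma cder_den a t : cder (den a) t (2 * RtoC t)%C.
Proof.
eapply cder_eq. apply (cder_plus (fun t => RtoC t * RtoC t)%C (fun _ => a * a)%C).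
- apply (cder_mult (fun t => RtoC t) (fun t => RtoC t)); apply cder_id.
- apply cder_const.
- ring.
Qed.

Lemma ex_cder_inv_den a t : 0 < fst a -> cder (fun t => / den a t)%C t (- (2 * RtoC t) / (den a t * den a t))%C.
Proof. intros Ha. apply cder_inv. apply cder_den. now apply den_neq_0. Qed.

(** The kernel of Binet's second formula for digamma; it is the derivative in [t] of
    [Log (a + i t) + Log (a - i t)]. *)
Definition phi (a : C) (t : R) : C := (2 * RtoC t / den a t)%C.

Lemma cder_phi (a : C) t : 0 < fst a -> ex_cder (phi a) t.
Proof.
intros Ha. eexists. unfold phi, Cdiv. apply (cder_mult (fun t => 2 * RtoC t)%C (fun t => / den a t)%C).
- apply cder_scal, cder_id.
- now apply ex_cder_inv_den.
Qed.

Lemma at_right_le_locally x : filter_le (at_right x) (locally x).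
Proof. apply filter_le_within. Qed.

Lemma Ci_neq_0 : Ci <> 0%C.
Proof. intros E. injection E. lra. Qed.

Lemma Ci_sqr : (Ci * Ci)%C = (- (1))%C.
Proof. apply injective_projections; simpl; ring. Qed.

Lemma up_neq_0 (a : C) t : 0 < fst a -> (a + Ci * RtoC t)%C <> 0%C.
Proof. intros Ha. apply Cneq_0_fst. simpl; lra. Qed.

Lemma down_neq_0 (a : C) t : 0 < fst a -> (a - Ci * RtoC t)%C <> 0%C.
Proof. intros Ha. apply Cneq_0_fst. simpl; lra. Qed.

(** Each kernel alone decays like [2 / t] and has a divergent integral. In the difference of the
    primitives the terms [2 ln t] cancel at infinity, and only the values [2 Log a] and [2 Log b] at
    0 remain. *)
Lemma is_Cint_phi_minus (a b : C) : 0 < fst a -> 0 < fst b ->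
  is_Cint (fun t => phi a t - phi b t)%C (2 * (Clog b - Clog a))%C.
Proof.
intros Ha Hb.
set (L := fun (a : C) (t : R) => (Clog (a + Ci * RtoC t) + Clog (a - Ci * RtoC t))%C).
assert (HL : forall a t, 0 < fst a -> cder (L a) t (phi a t)).
{ clear. intros a t Ha. eapply cder_eq. apply cder_plus. now apply cder_Clog_up. now apply cder_Clog_down.
  unfold phi. rewrite den_factor.
  assert (H1 := up_neq_0 a t Ha). assert (H2 := down_neq_0 a t Ha).
  transitivity (- (Ci * Ci) * (2 * RtoC t) / ((a + Ci * RtoC t) * (a - Ci * RtoC t)))%C.
  field; now split. rewrite Ci_sqr. field; now split. }
assert (HL0 : forall a, 0 < fst a -> Clim (at_right 0) (L a) (2 * Clog a)%C).
{ clear - HL. intros a Ha. eapply Clim_eq. apply (cder_Clim (L a) 0 (phi a 0)). typeclasses eauto. apply at_right_le_locally. now apply HL.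
  unfold L. rewrite Cmult_0_r. unfold Cminus. rewrite Copp_0, Cplus_0_r. ring. }
assert (HL1 : forall a, 0 < fst a -> Clim (Rbar_locally p_infty) (fun t => L a t - 2 * RtoC (ln t))%C 0%C).
{ clear. intros a Ha. eapply Clim_eq. eapply Clim_ext. typeclasses eauto.
  2: apply Clim_plus; [typeclasses eauto|apply (Clog_up_limit a Ha)|apply (Clog_down_limit a Ha)].
  apply filter_forall. intros t. unfold L. ring. ring. }
eapply is_Cint_eq.
apply (is_Cint_primitive _ (fun t => L a t - L b t)%C).
- intros t Ht. apply cder_minus; now apply HL.
- intros t Ht. destruct (cder_phi a t Ha) as [l Hl]. destruct (cder_phi b t Hb) as [m Hm].
  eexists. apply cder_minus; eassumption.
- apply Clim_minus. typeclasses eauto. now apply HL0. now apply HL0.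
- eapply Clim_ext. typeclasses eauto. 2: apply Clim_minus; [typeclasses eauto|apply (HL1 a Ha)|apply (HL1 b Hb)].
  apply filter_forall. intros t. ring.
- ring.
Qed.

(** This is [arctan (t / a) / a] for complex [a], expressed by logarithms on the right half-plane,
    where their derivative and limits are known. *)
Definition arctanC (a : C) (t : R) : C := (/ (2 * Ci * a) * (Clog (a + Ci * RtoC t) - Clog (a - Ci * RtoC t)))%C.

Lemma two_neq_0 : RtoC 2 <> 0%C.
Proof. apply RtoC_neq_0. lra. Qed.

Lemma cder_arctanC (a : C) t : 0 < fst a -> cder (arctanC a) t (/ den a t)%C.
Proof.
intros Ha. eapply cder_eq. apply cder_scal. apply cder_minus. now apply cder_Clog_up. now apply cder_Clog_down.
rewrite den_factor.
assert (H1 := up_neq_0 a t Ha). assert (H2 := down_neq_0 a t Ha). assert (H3 := Cneq_0_fst a Ha).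
assert (H4 := Ci_neq_0). assert (H5 := two_neq_0).
field; repeat split; assumption.
Qed.

Lemma arctanC_0 a : arctanC a 0 = 0%C.
Proof. unfold arctanC. rewrite Cmult_0_r. unfold Cminus. rewrite Copp_0, Cplus_0_r. ring. Qed.

Lemma arctanC_Clim_0 (a : C) : 0 < fst a -> Clim (at_right 0) (arctanC a) 0%C.
Proof.
intros Ha. rewrite <- (arctanC_0 a). eapply cder_Clim. typeclasses eauto. apply at_right_le_locally. now apply cder_arctanC.
Qed.

Lemma arctanC_Clim_infty (a : C) : 0 < fst a -> Clim (Rbar_locally p_infty) (arctanC a) (RtoC PI / (2 * a))%C.
Proof.
intros Ha. eapply Clim_eq. eapply Clim_ext. typeclasses eauto.
2: apply Clim_scal; [typeclasses eauto|apply Clim_minus; [typeclasses eauto|apply (Clog_up_limit a Ha)|apply (Clog_down_limit a Ha)]].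
- apply filter_forall. intros t. unfold arctanC. f_equal. ring.
- assert (H3 := Cneq_0_fst a Ha). assert (H4 := Ci_neq_0). assert (H5 := two_neq_0).
  rewrite RtoC_div by lra. field; repeat split; assumption.
Qed.

Lemma is_Cint_inv_den (a : C) : 0 < fst a -> is_Cint (fun t => / den a t)%C (RtoC PI / (2 * a))%C.
Proof.
intros Ha. eapply is_Cint_eq. apply (is_Cint_primitive _ (arctanC a)).
- intros t _. now apply cder_arctanC.
- intros t _. eexists. now apply ex_cder_inv_den.
- now apply arctanC_Clim_0.
- now apply arctanC_Clim_infty.
- ring.
Qed.

Lemma ex_cder_RtoC (f : R -> R) t : ex_derive f t -> ex_cder (fun t => RtoC (f t)) t.
Proof. intros [l Hl]. exists (RtoC l). now apply cder_RtoC. Qed.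

(** Partial fractions in [t^2] introduce the factor [1 / (a^2 - k^2)], so the double pole [a = k] is
    treated apart, with a primitive containing [t / (t^2 + k^2)]. Both cases give the same value. *)
Lemma is_Cint_sqr_den_den (a : C) k : 0 < fst a -> 0 < k ->
  is_Cint (fun t => RtoC t * RtoC t / (den a t * den (RtoC k) t))%C (RtoC PI / (2 * (a + RtoC k)))%C.
Proof.
intros Ha Hk. assert (Hk' : 0 < fst (RtoC k)) by exact Hk.
assert (H0 := two_neq_0).
assert (H3 := Cneq_0_fst a Ha). assert (H4 := Cneq_0_fst _ Hk').
assert (H5 : (a + RtoC k)%C <> 0%C) by (apply Cneq_0_fst; simpl; lra).
destruct (Ceq_dec a (RtoC k)) as [E|E].
- subst a. eapply is_Cint_eq.
  apply (is_Cint_primitive _ (fun t => / 2 * (arctanC (RtoC k) t - RtoC t * / den (RtoC k) t))%C).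
  + intros t _. assert (H := den_neq_0 (RtoC k) t Hk').
    eapply cder_eq. apply cder_scal. apply cder_minus. now apply cder_arctanC.
    apply (cder_mult (fun t => RtoC t) (fun t => / den (RtoC k) t)%C). apply cder_id. now apply ex_cder_inv_den.
    unfold den in *. field; repeat split; assumption.
  + intros t _. eexists. unfold Cdiv. apply (cder_mult (fun t => RtoC t * RtoC t)%C (fun t => / (den (RtoC k) t * den (RtoC k) t))%C).
    apply cder_mult; apply cder_id. apply cder_inv. apply cder_mult; apply cder_den. apply Cmult_neq_0; now apply den_neq_0.
  + apply Clim_scal. typeclasses eauto. apply Clim_minus. typeclasses eauto. now apply arctanC_Clim_0.
    apply (cder_Clim (fun t => RtoC t * / den (RtoC k) t)%C 0 (1 * / den (RtoC k) 0 + RtoC 0 * (- (2 * RtoC 0) / (den (RtoC k) 0 * den (RtoC k) 0)))%C).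
    typeclasses eauto. apply at_right_le_locally.
    apply (cder_mult (fun t => RtoC t) (fun t => / den (RtoC k) t)%C). apply cder_id. now apply ex_cder_inv_den.
  + apply Clim_scal. typeclasses eauto. apply Clim_minus. typeclasses eauto. now apply arctanC_Clim_infty.
    apply (Clim_ext _ (fun t => RtoC (t / (t * t + k * k)))).
    * exists 0. intros t Ht. unfold den. rewrite <- !RtoC_mult, <- RtoC_plus, <- RtoC_inv, <- RtoC_mult by nra. reflexivity.
    * apply (Clim_RtoC _ _ 0). apply filterlim_locally. intros eps.
      exists (/ eps). intros t Ht. assert (He := Rinv_0_lt_compat eps (cond_pos eps)).
      change (Rabs (t / (t * t + k * k) - 0) < eps).
      assert (0 < t / (t * t + k * k)) by (apply Rdiv_lt_0_compat; nra).
      rewrite Rminus_0_r, Rabs_pos_eq by lra. apply Rlt_div_l. nra.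
      assert (1 < eps * t). { apply (Rmult_lt_compat_l eps) in Ht; [|apply cond_pos]. rewrite Rinv_r in Ht. exact Ht. destruct eps; simpl; lra. }
      destruct eps as [e Hep]; simpl in *. nra.
  + cbv beta. rewrite !Cmult_0_l. field. split; assumption.
- assert (H6 : (a - RtoC k)%C <> 0%C). { intros E2. apply E. replace a with (a - RtoC k + RtoC k)%C by ring. rewrite E2. ring. }
  assert (H7 : (a * a - RtoC k * RtoC k)%C <> 0%C).
  { replace (a * a - RtoC k * RtoC k)%C with ((a + RtoC k) * (a - RtoC k))%C by ring. now apply Cmult_neq_0. }
  eapply is_Cint_eq. eapply is_Cint_ext.
  2: apply is_Cint_minus; [apply (is_Cint_scal (a * a / (a * a - RtoC k * RtoC k))%C), (is_Cint_inv_den a Ha)|apply (is_Cint_scal (RtoC k * RtoC k / (a * a - RtoC k * RtoC k))%C), (is_Cint_inv_den _ Hk')].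
  + intros t _. cbv beta. assert (H8 := den_neq_0 a t Ha). assert (H9 := den_neq_0 _ t Hk').
    unfold den in *. field. repeat split; assumption.
  + field. repeat split; assumption.
Qed.

(** * Binet's integral *)

(** With [x = PI t], the right-hand side is [e^x (e^x - e^(-x))]. Keeping the factor [e^x] provides
    the exponential decay of the integrand, and the factor [t] tames its singularity at 0. *)
Lemma bose_denominator t : 0 < t -> 2 * PI * t * exp (PI * t) <= exp (2 * PI * t) - 1.
Proof.
intros Ht. assert (HP := PI_RGT_0).
assert (H := sinh_ge (PI * t) ltac:(nra)). assert (He := exp_pos (PI * t)).
replace (exp (2 * PI * t)) with (exp (PI * t) * exp (PI * t)) by (rewrite <- exp_plus; f_equal; ring).
assert (H1 : exp (PI * t) * exp (- (PI * t)) = 1) by (rewrite <- exp_plus, Rplus_opp_r; apply exp_0).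
nra.
Qed.

Lemma bose_denominator_pos t : 0 < t -> 0 < exp (2 * PI * t) - 1.
Proof.
intros Ht. apply Rlt_le_trans with (2 := bose_denominator t Ht).
assert (HP := PI_RGT_0). assert (He := exp_pos (PI * t)). assert (H : 0 < PI * t) by nra. nra.
Qed.

Lemma bose_bound t : 0 < t -> 0 <= t * bose t <= / (2 * PI) * exp (- (PI * t)).
Proof.
intros Ht. assert (HP := PI_RGT_0). assert (H := bose_denominator t Ht). assert (H0 := bose_denominator_pos t Ht).
assert (He := exp_pos (PI * t)).
unfold bose. split.
- apply Rmult_le_pos. lra. left; now apply Rinv_0_lt_compat.
- rewrite exp_Ropp, <- Rinv_mult. apply Rle_div_l. exact H0.
  apply Rmult_le_reg_l with (2 * PI * exp (PI * t)). nra.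
  rewrite <- Rmult_assoc, Rinv_r, Rmult_1_l by nra. nra.
Qed.

Lemma is_Rint_exp c : 0 < c -> is_Rint (fun t => exp (- (c * t))) (/ c).
Proof.
intros Hc. apply is_Rint_eq with (0 - - / c); [|ring].
apply (is_Rint_primitive _ (fun t => - / c * exp (- (c * t)))).
- intros t _. auto_derive. exact I. field. lra.
- intros t _. auto_derive. exact I.
- assert (H : filterlim (fun t => - / c * exp (- (c * t))) (at_right 0) (locally (- / c * exp (- (c * 0))))).
  { apply (filterlim_filter_le_1 (F := locally 0)). apply filter_le_within.
    apply (ex_derive_continuous (V := R_NormedModule) (fun t => - / c * exp (- (c * t)))). auto_derive. exact I. }
  rewrite Rmult_0_r, Ropp_0, exp_0, Rmult_1_r in H. exact H.
- apply filterlim_locally. intros eps. exists (- ln (c * eps) / c). intros t Ht.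
  change (Rabs (- / c * exp (- (c * t)) - 0) < eps).
  assert (Hi := Rinv_0_lt_compat c Hc). assert (He := exp_pos (- (c * t))).
  rewrite Rminus_0_r, Rabs_left by nra.
  apply Rmult_lt_reg_l with c. exact Hc.
  replace (c * - (- / c * exp (- (c * t)))) with (exp (- (c * t))) by (field; lra).
  assert (Hce : 0 < c * eps) by (destruct eps; simpl; nra).
  rewrite <- (exp_ln _ Hce). apply exp_increasing. apply Rlt_div_l in Ht. lra. exact Hc.
Qed.

Lemma is_Rint_inv_sqr : is_Rint (fun t => / ((1 + t) * (1 + t))) 1.
Proof.
apply is_Rint_eq with (0 - - / (1 + 0)); [|field].
apply (is_Rint_primitive _ (fun t => - / (1 + t))).
- intros t Ht. auto_derive. lra. field. lra.
- intros t Ht. auto_derive. nra.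
- apply (filterlim_filter_le_1 (F := locally 0)). apply filter_le_within.
  apply (ex_derive_continuous (V := R_NormedModule) (fun t => - / (1 + t))). auto_derive. lra.
- apply filterlim_locally. intros eps. exists (/ eps). intros t Ht.
  change (Rabs (- / (1 + t) - 0) < eps).
  assert (Hi := Rinv_0_lt_compat eps (cond_pos eps)).
  assert (H := Rinv_0_lt_compat (1 + t) ltac:(lra)).
  rewrite Rminus_0_r, Rabs_left by lra. rewrite Ropp_involutive, <- (Rinv_inv eps).
  apply Rinv_lt_contravar. apply Rmult_lt_0_compat; lra. lra.
Qed.

Lemma Cmod_den_ge (a : C) t : 0 < fst a -> fst a * fst a <= Cmod (den a t).
Proof.
intros Ha. rewrite den_factor, Cmod_mult.
apply Rmult_le_compat; try lra.
- apply Rle_trans with (2 := Rabs_fst_le _). apply Rle_trans with (2 := Rle_abs _). simpl; lra.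
- apply Rle_trans with (2 := Rabs_fst_le _). apply Rle_trans with (2 := Rle_abs _). simpl; lra.
Qed.

(** Growth comes from [t^2 <= |den a t| + |a^2|]; the leftover constant [1 + |a^2|] is absorbed by
    the uniform lower bound [(Re a)^2 <= |den a t|]. *)
Lemma Cmod_den_ge_sqr (a : C) : 0 < fst a -> exists K, 0 < K /\ forall t, 1 + t * t <= K * Cmod (den a t).
Proof.
intros Ha. assert (Hp : 0 < fst a * fst a) by nra.
exists (1 + (1 + Cmod (a * a)) / (fst a * fst a)). assert (Hc := Cmod_ge_0 (a * a)).
assert (Hq : 0 < (1 + Cmod (a * a)) / (fst a * fst a)) by (apply Rdiv_lt_0_compat; lra).
split. lra.
intros t. assert (H := Cmod_den_ge a t Ha).
assert (H1 : t * t <= Cmod (den a t) + Cmod (a * a)).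
{ assert (Ht := Cmod_triangle (den a t) (- (a * a))). rewrite Cmod_opp in Ht.
  replace (den a t + - (a * a))%C with (RtoC (t * t)) in Ht by (unfold den; rewrite RtoC_mult; ring).
  rewrite Cmod_R, Rabs_pos_eq in Ht by nra. exact Ht. }
assert (H2 : 1 + Cmod (a * a) = (1 + Cmod (a * a)) / (fst a * fst a) * (fst a * fst a)) by (field; lra).
nra.
Qed.

Lemma ex_cder_phi_bose (a : C) t : 0 < fst a -> 0 < t -> ex_cder (fun t => phi a t * RtoC (bose t))%C t.
Proof.
intros Ha Ht. destruct (cder_phi a t Ha) as [l Hl].
destruct (ex_cder_RtoC bose t) as [m Hm].
- unfold bose. auto_derive. assert (H := bose_denominator_pos t Ht). lra.
- eexists. apply cder_mult; eassumption.
Qed.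

Definition binet (a : C) : C :=
  RInt_gen (V := C_R_CompleteNormedModule) (fun t => phi a t * RtoC (bose t))%C (at_right 0) (Rbar_locally p_infty).

(** The decay in [Re a] matters as much as the existence: it sends [binet (a + n)] to 0, which
    selects the right solution of the difference equation. *)
Lemma binet_spec (a : C) : 0 < fst a ->
  is_Cint (fun t => phi a t * RtoC (bose t))%C (binet a) /\ Cmod (binet a) <= / (PI * PI) / (fst a * fst a).
Proof.
intros Ha. assert (HP := PI_RGT_0).
destruct (is_Cint_dominated (fun t => phi a t * RtoC (bose t))%C
  (fun t => / PI / (fst a * fst a) * exp (- (PI * t))) (/ PI / (fst a * fst a) * / PI)) as [l [Hl Hb]].
- intros t Ht. now apply ex_cder_phi_bose.
- intros t Ht. auto_derive. exact I.
- intros t Ht. assert (H := bose_bound t Ht).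
  unfold phi. rewrite Cmod_mult, Cmod_div by (now apply den_neq_0). rewrite Cmod_mult, !Cmod_R.
  rewrite (Rabs_pos_eq 2), (Rabs_pos_eq t) by lra.
  assert (0 <= bose t) by (apply Rmult_le_reg_l with t; lra). rewrite Rabs_pos_eq by assumption.
  assert (Hd := Cmod_den_ge a t Ha). assert (Hp : 0 < fst a * fst a) by nra.
  replace (2 * t / Cmod (den a t) * bose t) with (2 * (t * bose t) * / Cmod (den a t)) by (field; lra).
  replace (/ PI / (fst a * fst a) * exp (- (PI * t))) with (2 * (/ (2 * PI) * exp (- (PI * t))) * / (fst a * fst a)) by (field; lra).
  apply Rmult_le_compat; try lra. left; apply Rinv_0_lt_compat; lra. apply Rinv_le_contravar; lra.
- apply is_Rint_scal. now apply is_Rint_exp.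
- replace (binet a) with l.
  + split. exact Hl. replace (/ (PI * PI) / (fst a * fst a)) with (/ PI / (fst a * fst a) * / PI) by (field; lra). exact Hb.
  + symmetry. unfold binet. apply (is_RInt_gen_unique (V := C_R_CompleteNormedModule)). exact Hl.
Qed.

Lemma is_Cint_phi_div (a : C) : 0 < fst a -> is_Cint (fun t => phi a t * RtoC (/ (2 * t)))%C (RtoC PI / (2 * a))%C.
Proof.
intros Ha. apply is_Cint_ext with (2 := is_Cint_inv_den a Ha).
intros t Ht. unfold phi. rewrite RtoC_inv, RtoC_mult by lra. assert (H := den_neq_0 a t Ha).
assert (H0 := two_neq_0). assert (H1 := RtoC_neq_0 t ltac:(lra)).
field; repeat split; assumption.
Qed.

Lemma is_Cint_phi_term (a : C) k : 0 < fst a -> 0 < k ->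
  is_Cint (fun t => phi a t * RtoC (t / (t ^ 2 + k ^ 2)))%C (RtoC PI / (a + RtoC k))%C.
Proof.
intros Ha Hk. assert (H0 := two_neq_0).
assert (H5 : (a + RtoC k)%C <> 0%C) by (apply Cneq_0_fst; simpl; lra).
eapply is_Cint_eq. eapply is_Cint_ext. 2: apply (is_Cint_scal 2), (is_Cint_sqr_den_den a k Ha Hk).
- intros t Ht. cbv beta. unfold phi. rewrite RtoC_div by nra.
  replace (RtoC (t ^ 2 + k ^ 2)) with (den (RtoC k) t) by (unfold den; rewrite RtoC_plus, <- !RtoC_mult; do 2 f_equal; ring).
  assert (H := den_neq_0 a t Ha). assert (H1 := den_neq_0 (RtoC k) t Hk).
  field; repeat split; assumption.
- field; repeat split; assumption.
Qed.

Lemma is_Cint_phi_sum (a : C) (m : nat) : 0 < fst a ->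
  is_Cint (fun t => phi a t * RtoC (Rsum (fun k => t / (t ^ 2 + INR (S k) ^ 2))%R m))%C
    (Csum (fun k => RtoC PI / (a + RtoC (INR (S k))))%C m).
Proof.
intros Ha. induction m as [|m IH].
- cbn [Rsum Csum]. apply is_Cint_ext with (fun t => 0 * (phi a t * RtoC (/ (2 * t))))%C.
  + intros t _. ring.
  + eapply is_Cint_eq. apply is_Cint_scal. now apply is_Cint_phi_div. ring.
- cbn [Rsum Csum]. eapply is_Cint_ext.
  2: apply is_Cint_plus; [exact IH|apply (is_Cint_phi_term a (INR (S m)) Ha)].
  + intros t _. cbv beta. rewrite RtoC_plus. ring.
  + apply lt_0_INR. lia.
Qed.

(** The difference of the kernels is [2 t (b^2 - a^2) / (den a t * den b t)], of order [t^(-3)],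
    hence integrable even against the bound [t / (m + 1)] of the remainder. The term with [Clog]
    comes from the constant [PI / 2] in [coth_remainder]. *)
Lemma binet_minus_approx (a b : C) : 0 < fst a -> 0 < fst b -> exists K : R, forall m : nat,
  Cmod (RtoC PI * (binet a - binet b) -
    (RtoC PI / (2 * a) - RtoC PI / (2 * b) - RtoC PI * (Clog b - Clog a)
     + (Csum (fun k => RtoC PI / (a + RtoC (INR (S k))))%C (S m) - Csum (fun k => RtoC PI / (b + RtoC (INR (S k))))%C (S m))))
    <= K / INR (S m).
Proof.
intros Ha Hb. assert (HP := PI_RGT_0).
destruct (Cmod_den_ge_sqr a Ha) as [Ka [HKa Hda]]. destruct (Cmod_den_ge_sqr b Hb) as [Kb [HKb Hdb]].
set (Q := Cmod (b * b - a * a)). assert (HQ : 0 <= Q) by apply Cmod_ge_0.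
(* A factor [2 Q] comes from the numerator of the kernel difference, another 2 from
   [(1 + t)^2 <= 2 (1 + t^2)], used to reach a majorant with the primitive [-1 / (1 + t)]. *)
exists (4 * Q * Ka * Kb). intros m.
assert (Hm : 0 < INR (S m)) by (apply lt_0_INR; lia).
set (rem := fun t => PI * bose t + PI / 2 - / (2 * t) - Rsum (fun k => t / (t ^ 2 + INR (S k) ^ 2)) (S m)).
apply (is_Cint_le (fun t => (phi a t - phi b t) * RtoC (rem t))%C _ (fun t => 4 * Q * Ka * Kb / INR (S m) * / ((1 + t) * (1 + t)))).
- intros t Ht. assert (Hr := coth_remainder t m Ht). fold (rem t) in Hr.
  assert (Hr' : Rabs (rem t) <= t / INR (S m)) by (rewrite Rabs_pos_eq; lra).
  rewrite Cmod_mult, Cmod_R.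
  assert (Na := den_neq_0 a t Ha). assert (Nb := den_neq_0 b t Hb).
  assert (Pa := proj1 (Cmod_gt_0 _) Na). assert (Pb := proj1 (Cmod_gt_0 _) Nb).
  replace (phi a t - phi b t)%C with (RtoC (2 * t) * (b * b - a * a) / (den a t * den b t))%C.
  2:{ unfold phi. rewrite RtoC_mult. unfold den in *. field. now split. }
  rewrite Cmod_div by (now apply Cmult_neq_0). rewrite !Cmod_mult, Cmod_R, (Rabs_pos_eq (2 * t)) by lra. fold Q.
  specialize (Hda t). specialize (Hdb t). set (A := Cmod (den a t)) in *. set (B := Cmod (den b t)) in *.
  apply Rle_trans with (2 * t * Q / (A * B) * (t / INR (S m))).
  { apply Rmult_le_compat_l. apply Rle_mult_inv_pos. repeat apply Rmult_le_pos; lra. now apply Rmult_lt_0_compat. exact Hr'. }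
  replace (2 * t * Q / (A * B) * (t / INR (S m))) with (2 * Q / INR (S m) * ((t * t) / (A * B))) by (field; lra).
  replace (4 * Q * Ka * Kb / INR (S m) * / ((1 + t) * (1 + t))) with (2 * Q / INR (S m) * (2 * Ka * Kb / ((1 + t) * (1 + t)))) by (field; lra).
  apply Rmult_le_compat_l. apply Rle_mult_inv_pos; lra.
  apply Rle_div_l. nra.
  replace (2 * Ka * Kb / ((1 + t) * (1 + t)) * (A * B)) with ((2 * ((Ka * A) * (Kb * B))) / ((1 + t) * (1 + t))) by (field; lra).
  apply -> Rle_div_r; [|nra].
  assert (H1 : (1 + t * t) * (1 + t * t) <= Ka * A * (Kb * B)) by (apply Rmult_le_compat; nra).
  assert (Hsq := Rle_0_sqr (1 - t)). unfold Rsqr in Hsq.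
  assert (H2 : (1 + t) * (1 + t) <= 2 * (1 + t * t)) by lra.
  apply Rle_trans with (t * t * (2 * (1 + t * t))). apply Rmult_le_compat_l; [nra|exact H2].
  apply Rle_trans with (2 * ((1 + t * t) * (1 + t * t))); [nra|lra].
- eapply is_Cint_eq. eapply is_Cint_ext.
  2:{ apply is_Cint_minus.
      - apply is_Cint_plus. apply (is_Cint_scal (RtoC PI)), is_Cint_minus. apply (binet_spec a Ha). apply (binet_spec b Hb).
        apply (is_Cint_scal (RtoC (PI / 2))), (is_Cint_phi_minus a b Ha Hb).
      - apply is_Cint_plus. apply is_Cint_minus. apply (is_Cint_phi_div a Ha). apply (is_Cint_phi_div b Hb).
        apply is_Cint_minus. apply (is_Cint_phi_sum a (S m) Ha). apply (is_Cint_phi_sum b (S m) Hb). }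
  + intros t Ht. cbv beta. unfold rem. rewrite !RtoC_minus, !RtoC_plus, RtoC_mult. ring.
  + rewrite RtoC_div by lra.
    assert (H0 := two_neq_0). assert (H3 := Cneq_0_fst a Ha). assert (H4 := Cneq_0_fst b Hb).
    match goal with |- context [Csum ?f ?n] => set (S1 := Csum f n) end.
    match goal with |- context [Csum ?f ?n] => set (S2 := Csum f n) end.
    field. repeat split; assumption.
- apply (is_Rint_eq _ (4 * Q * Ka * Kb / INR (S m) * 1)); [|ring]. apply is_Rint_scal. apply is_Rint_inv_sqr.
Qed.

Lemma filterlim_div_INR_S K : filterlim (fun m : nat => K / INR (S m)) eventually (locally 0).
Proof.
apply filterlim_locally. intros eps.
destruct (INR_above (Rabs K / eps)) as [N HN]. exists N. intros n Hn.
specialize (HN n Hn). change (Rabs (K / INR (S n) - 0) < eps).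
assert (H : 0 < INR (S n)) by (apply lt_0_INR; lia).
rewrite Rminus_0_r, Rabs_div, (Rabs_pos_eq (INR _)) by lra.
apply Rlt_div_l. exact H. apply Rlt_div_l in HN; [|apply cond_pos].
rewrite S_INR. assert (He := cond_pos eps). lra.
Qed.

Lemma filterlim_INR_infty : filterlim INR eventually (Rbar_locally p_infty).
Proof.
intros P [M HM]. destruct (INR_above M) as [N HN]. exists N. intros n Hn. apply HM. now apply HN.
Qed.

Lemma Cmod_add_INR (a : C) n : 0 < fst a -> INR n <= Cmod (a + RtoC (INR n)).
Proof.
intros Ha. apply Rle_trans with (2 := Rabs_fst_le _). apply Rle_trans with (2 := Rle_abs _). simpl; lra.
Qed.

Lemma Cinv_add_INR_limit (a : C) : 0 < fst a -> Clim eventually (fun n => / (a + RtoC (INR (S n))))%C 0%C.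
Proof.
intros Ha. apply Clim_le with (fun n : nat => 1 / INR (S n)). typeclasses eauto.
- apply filter_forall. intros n. unfold Cminus. rewrite Copp_0, Cplus_0_r.
  assert (H : 0 < INR (S n)) by (apply lt_0_INR; lia).
  rewrite Cmod_inv by (apply Cneq_0_fst; change (0 < fst a + INR (S n)); lra).
  unfold Rdiv. rewrite Rmult_1_l. apply Rinv_le_contravar. exact H. now apply Cmod_add_INR.
- apply filterlim_div_INR_S.
Qed.

(** For [b = a + 1] the two sums are shifts of each other and telescope to [PI / (a + 1)] in the
    limit. Together with [- PI / (2 (a + 1))] this yields the symmetric pair of half terms. *)
Lemma binet_succ (a : C) : 0 < fst a ->
  binet (a + 1) = (binet a - / (2 * a) - / (2 * (a + 1)) + Clog (a + 1) - Clog a)%C.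
Proof.
intros Ha. assert (Hb : 0 < fst (a + 1)%C) by (simpl; lra).
assert (HP : RtoC PI <> 0%C) by apply RtoC_neq_0, PI_neq0.
assert (Na := Cneq_0_fst a Ha). assert (Nb := Cneq_0_fst _ Hb). assert (N2 := two_neq_0).
destruct (binet_minus_approx a (a + 1) Ha Hb) as [K HK].
set (E := (RtoC PI / (2 * a) - RtoC PI / (2 * (a + 1)) - RtoC PI * (Clog (a + 1) - Clog a))%C) in *.
assert (HS : forall m, (Csum (fun k => RtoC PI / (a + RtoC (INR (S k))))%C m - Csum (fun k => RtoC PI / (a + 1 + RtoC (INR (S k))))%C m =
   RtoC PI / (a + 1) - RtoC PI * / (a + RtoC (INR (S m))))%C).
{ induction m as [|m IH].
  - cbn [Csum]. simpl INR. unfold Cdiv. ring.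
  - cbn [Csum]. rewrite (S_INR (S m)), RtoC_plus.
    match goal with |- (?X + ?u - (?Y + ?v))%C = _ => replace (X + u - (Y + v))%C with ((X - Y) + (u - v))%C by ring end.
    rewrite IH. replace (a + (RtoC (INR (S m)) + 1))%C with (a + 1 + RtoC (INR (S m)))%C by ring. unfold Cdiv. ring. }
assert (L1 : Clim eventually (fun m => E + (RtoC PI / (a + 1) - RtoC PI * / (a + RtoC (INR (S (S m))))))%C (RtoC PI * (binet a - binet (a + 1)))%C).
{ apply Clim_le with (fun m => K / INR (S m)). typeclasses eauto.
  - apply filter_forall. intros m. rewrite <- HS, <- Cmod_opp, Copp_minus_distr. apply HK.
  - apply filterlim_div_INR_S. }
assert (L2 : Clim eventually (fun m => E + (RtoC PI / (a + 1) - RtoC PI * / (a + RtoC (INR (S (S m))))))%C (E + (RtoC PI / (a + 1) - RtoC PI * 0))%C).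
{ apply Clim_plus. typeclasses eauto. apply Clim_const. typeclasses eauto.
  apply Clim_minus. typeclasses eauto. apply Clim_const. typeclasses eauto.
  apply Clim_scal. typeclasses eauto.
  intros eps He. destruct (Cinv_add_INR_limit a Ha eps He) as [N HN]. exists N. intros n Hn. apply HN. lia. }
assert (EQ := Clim_unique _ _ _ _ _ L1 L2).
assert (EQ2 : (binet a - binet (a + 1))%C = (/ RtoC PI * (E + (RtoC PI / (a + 1) - RtoC PI * 0)))%C).
{ rewrite <- EQ. field. exact HP. }
replace (binet (a + 1)) with (binet a - (binet a - binet (a + 1)))%C by ring.
rewrite EQ2. unfold E. field. repeat split; assumption.
Qed.

Lemma binet_limit (a : C) : 0 < fst a ->
  Clim eventually (fun n => Csum (fun k => / (a + RtoC (INR k)))%C n - RtoC (ln (INR n)))%C (/ (2 * a) - Clog a + binet a)%C.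
Proof.
(* The half terms and logarithms are arranged so that [beta (z + 1) = beta z - 1 / z]; summing gives
   [beta a - beta (a + n)], and [beta (a + n) + ln n] tends to 0. *)
intros Ha. set (beta := fun z => (/ (2 * z) - Clog z + binet z)%C).
assert (N2 := two_neq_0).
assert (HB : forall n, (beta a - beta (a + RtoC (INR n)))%C = Csum (fun k => / (a + RtoC (INR k)))%C n).
{ induction n as [|n IH].
  - cbn [Csum]. simpl INR. rewrite Cplus_0_r. ring.
  - cbn [Csum]. rewrite <- IH, S_INR, RtoC_plus, Cplus_assoc.
    assert (Hn := pos_INR n). assert (Hz : 0 < fst (a + RtoC (INR n))%C) by (simpl; lra).
    assert (Nz := Cneq_0_fst _ Hz). assert (Nz1 : (a + RtoC (INR n) + 1)%C <> 0%C) by (apply Cneq_0_fst; simpl; lra).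
    assert (Hs : beta (a + RtoC (INR n) + 1)%C = (beta (a + RtoC (INR n)) - / (a + RtoC (INR n)))%C).
    { unfold beta. rewrite (binet_succ _ Hz). field. repeat split; assumption. }
    rewrite Hs. ring. }
apply Clim_ext with (fun n => beta a - / 2 * / (a + RtoC (INR n)) + (Clog (RtoC (INR n) + a) - RtoC (ln (INR n))) - binet (a + RtoC (INR n)))%C.
typeclasses eauto.
- apply filter_forall. intros n. rewrite <- HB. set (ba := beta a). unfold beta.
  assert (Hn := pos_INR n). assert (Nz : (a + RtoC (INR n))%C <> 0%C) by (apply Cneq_0_fst; simpl; lra).
  rewrite (Cplus_comm (RtoC (INR n)) a). field; repeat split; assumption.
- apply Clim_eq with (beta a - / 2 * 0 + 0 - 0)%C; [|unfold beta; ring].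
  apply Clim_minus. typeclasses eauto. apply Clim_plus. typeclasses eauto. apply Clim_minus. typeclasses eauto.
  + apply Clim_const. typeclasses eauto.
  + apply Clim_scal. typeclasses eauto.
    intros eps He. destruct (Cinv_add_INR_limit a Ha eps He) as [N HN]. exists (S N). intros [|n] Hn. lia. apply HN. lia.
  + intros eps He. apply (filterlim_INR_infty _ (Clog_add_real_limit a eps He)).
  + assert (HP := PI_RGT_0).
    apply Clim_le with (fun n => / (PI * PI) * / INR n). typeclasses eauto.
    * exists 1%nat. intros n Hn. unfold Cminus. rewrite Copp_0, Cplus_0_r.
      assert (H1 : 1 <= INR n) by (apply (le_INR 1); exact Hn).
      assert (Hz : 0 < fst (a + RtoC (INR n))%C) by (simpl; lra).
      apply Rle_trans with (1 := proj2 (binet_spec _ Hz)). simpl.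
      apply Rmult_le_compat_l. left; apply Rinv_0_lt_compat; nra. apply Rinv_le_contravar. lra. nra.
    * apply filterlim_locally. intros eps.
      destruct (proj1 (filterlim_locally _ _) (filterlim_div_INR_S (/ (PI * PI))) eps) as [N HN].
      exists (S N). intros [|n] Hn. lia. apply HN. lia.
Qed.

(** * The constant term of the Hurwitz zeta function at 1 *)

Lemma cder_quotient (f : R -> C) t l : cder f t l ->
  Clim (at_right t) (fun s => (f s - f t) / RtoC (s - t))%C l.
Proof.
intros [H1 H2] eps He.
assert (He2 : 0 < eps / 2) by lra.
apply is_derive_Reals in H1, H2.
destruct (H1 _ He2) as [d1 Hd1]. destruct (H2 _ He2) as [d2 Hd2].
assert (Hd : 0 < Rmin d1 d2) by (apply Rmin_pos; apply cond_pos).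
exists (mkposreal _ Hd). intros s Hs Hts. change (Rabs (s - t) < Rmin d1 d2) in Hs.
assert (N : s - t <> 0) by lra.
specialize (Hd1 (s - t) N (Rlt_le_trans _ _ _ Hs (Rmin_l _ _))).
specialize (Hd2 (s - t) N (Rlt_le_trans _ _ _ Hs (Rmin_r _ _))).
assert (Er : forall s : R, t + (s - t) = s) by (intros; ring). rewrite Er in Hd1, Hd2.
apply Rle_lt_trans with (1 := Cmod_le_abs _).
assert (E : ((f s - f t) / RtoC (s - t))%C = ((fst (f s) - fst (f t)) / (s - t), (snd (f s) - snd (f t)) / (s - t))).
{ unfold Cdiv. rewrite <- RtoC_inv by exact N. apply injective_projections; simpl; unfold Rdiv; ring. }
rewrite E. simpl. unfold Rminus in Hd1, Hd2 |- *. lra.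
Qed.

(** [z^(-s)] for real exponents, since [s] descends to 1 along the real axis. *)
Definition Cpow_opp (z : C) (s : R) : C := Cexp (- RtoC s * Clog z)%C.

Lemma cder_Cpow_opp (z : C) s u : 0 < fst (z + RtoC u)%C ->
  cder (fun u => Cpow_opp (z + RtoC u) s) u (- RtoC s / (z + RtoC u) * Cpow_opp (z + RtoC u) s)%C.
Proof.
intros Hz. eapply cder_eq. apply cder_Cexp. apply cder_scal. apply (cder_Clog (fun u => z + RtoC u)%C).
- apply (cder_plus (fun _ => z)). apply cder_const. apply cder_id.
- exact Hz.
- cbv beta. unfold Cpow_opp, Cdiv. ring.
Qed.

Lemma Cpow_opp_pred (z : C) s : 0 < fst z -> Cpow_opp z (s - 1) = (z * Cpow_opp z s)%C.
Proof.
intros Hz. unfold Cpow_opp. rewrite <- (Cexp_Clog z Hz) at 2. rewrite <- Cexp_plus. f_equal. rewrite RtoC_minus. ring.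
Qed.

Lemma Cpow_opp_0 z : Cpow_opp z 0 = 1%C.
Proof. unfold Cpow_opp. replace (- RtoC 0 * Clog z)%C with (RtoC 0) by ring. now rewrite Cexp_RtoC, exp_0. Qed.

Lemma Cpow_opp_1 (z : C) : 0 < fst z -> Cpow_opp z 1 = (/ z)%C.
Proof.
intros Hz. assert (H := Cpow_opp_pred z 1 Hz). rewrite Rminus_diag, Cpow_opp_0 in H.
assert (Nz := Cneq_0_fst z Hz).
replace (Cpow_opp z 1) with (/ z * (z * Cpow_opp z 1))%C by (field; exact Nz). rewrite <- H. ring.
Qed.

Lemma Cmod_Cpow_opp z s : Cmod (Cpow_opp z s) = exp (- s * ln (Cmod z)).
Proof. unfold Cpow_opp. rewrite Cmod_Cexp. simpl. f_equal. ring. Qed.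

(** The quotient is the integral of [(z + u)^(-s)] over [0 <= u <= 1]. The mean value inequality is
    used twice: on [u -> (z + u)^(-s)], whose derivative is at most [2 / (Re z)^2], and on [f], the
    primitive minus its linear approximation. The bound is free of [s], so it survives [s -> 1]
    despite the division by [s - 1]. *)
Lemma Cpow_opp_integral_dist (z : C) s : 1 <= fst z -> 1 < s <= 2 ->
  Cmod (Cpow_opp z s - (Cpow_opp z (s - 1) - Cpow_opp (z + 1) (s - 1)) / RtoC (s - 1))%C <= 2 / (fst z * fst z).
Proof.
intros Hz Hs. assert (Hx : 0 < fst z) by lra.
assert (N : RtoC (s - 1) <> 0%C) by (apply RtoC_neq_0; lra).
assert (Hu : forall u, 0 <= u -> 0 < fst (z + RtoC u)%C) by (intros u Hu; simpl; lra).
assert (B1 : forall u, 0 <= u -> Cmod (- RtoC s / (z + RtoC u) * Cpow_opp (z + RtoC u) s)%C <= 2 / (fst z * fst z)).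
{ intros u H. specialize (Hu u H).
  assert (Hm : fst z <= Cmod (z + RtoC u)).
  { apply Rle_trans with (2 := Rabs_fst_le _). apply Rle_trans with (2 := Rle_abs _). simpl; lra. }
  assert (Nz := Cneq_0_fst _ Hu).
  rewrite Cmod_mult, Cmod_div, Cmod_opp, Cmod_R, Rabs_pos_eq, Cmod_Cpow_opp by (assumption || lra).
  set (m := Cmod (z + RtoC u)) in *.
  assert (Hl : exp (- s * ln m) <= / m).
  { rewrite <- (exp_ln m) at 2 by lra. rewrite <- exp_Ropp. apply exp_le.
    assert (0 <= ln m). { rewrite <- ln_1. apply ln_le; lra. } nra. }
  assert (Hi : / m <= / fst z) by (apply Rinv_le_contravar; lra).
  assert (Hp : 0 < / m) by (apply Rinv_0_lt_compat; lra).
  assert (He := exp_pos (- s * ln m)).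
  unfold Rdiv. rewrite Rinv_mult, Rmult_assoc.
  apply Rmult_le_compat; try lra. nra. apply Rmult_le_compat; lra. }
assert (B2 : forall v, 0 <= v <= 1 -> Cmod (Cpow_opp (z + RtoC v) s - Cpow_opp z s)%C <= 2 / (fst z * fst z)).
{ intros v Hv. replace (Cpow_opp z s) with (Cpow_opp (z + RtoC 0) s) by (now rewrite Cplus_0_r).
  apply Rle_trans with (2 / (fst z * fst z) * (v - 0)).
  - apply (cder_bound (fun u => Cpow_opp (z + RtoC u) s) (fun u => - RtoC s / (z + RtoC u) * Cpow_opp (z + RtoC u) s)%C). lra.
    + intros u H. apply cder_Cpow_opp. apply Hu; lra.
    + intros u H. apply B1; lra.
  - assert (0 < 2 / (fst z * fst z)) by (apply Rdiv_lt_0_compat; nra). nra. }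
set (f := fun u => (- / RtoC (s - 1) * Cpow_opp (z + RtoC u) (s - 1) - RtoC u * Cpow_opp z s)%C).
replace (Cpow_opp z s - (Cpow_opp z (s - 1) - Cpow_opp (z + 1) (s - 1)) / RtoC (s - 1))%C with (- (f 1 - f 0))%C.
2:{ unfold f. rewrite Cplus_0_r. field. exact N. }
rewrite Cmod_opp. replace (2 / (fst z * fst z)) with (2 / (fst z * fst z) * (1 - 0)) by ring.
apply (cder_bound f (fun u => Cpow_opp (z + RtoC u) s - Cpow_opp z s)%C). lra.
- intros u H. assert (Hv := Hu u (proj1 H)). eapply cder_eq. apply cder_minus.
  + apply cder_scal. now apply cder_Cpow_opp.
  + apply (cder_mult (fun u => RtoC u) (fun _ => Cpow_opp z s)). apply cder_id. apply cder_const.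
  + cbv beta. rewrite (Cpow_opp_pred _ s Hv). assert (Nz := Cneq_0_fst _ Hv). field. now split.
- exact B2.
Qed.

(** The errors for [z = a + M] are summed through [1 / M^2 <= 1/(M-1) - 1/M], which telescopes.
    Starting at [M = N + 2] keeps [M - 1] at least 1. *)
Lemma zeta_partial_dist (a : C) s N j : 0 < fst a -> 1 < s <= 2 ->
  Cmod (Csum (fun n => Cpow_opp (a + RtoC (INR n)) s) (N + 2 + j) - Csum (fun n => Cpow_opp (a + RtoC (INR n)) s) (N + 2)
    - (Cpow_opp (a + RtoC (INR (N + 2))) (s - 1) - Cpow_opp (a + RtoC (INR (N + 2 + j))) (s - 1)) / RtoC (s - 1))%C
   <= 2 * (/ INR (S N) - / INR (S N + j)).
Proof.
intros Ha Hs. induction j as [|j IH].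
- rewrite !Nat.add_0_r. assert (E : forall S P c : C, (S - S - (P - P) / c)%C = 0%C) by (intros; unfold Cdiv; ring).
  rewrite E, Cmod_0. lra.
- assert (N0 : RtoC (s - 1) <> 0%C) by (apply RtoC_neq_0; lra).
  replace (N + 2 + S j)%nat with (S (N + 2 + j)) by lia. cbn [Csum].
  set (M := (N + 2 + j)%nat) in *. set (S1 := Csum _ M) in *.
  set (z := (a + RtoC (INR M))%C) in *.
  assert (Hz : INR M < fst z) by (simpl; lra).
  assert (EM : INR M = INR (S N + j) + 1) by (rewrite <- S_INR; f_equal; unfold M; lia).
  assert (HM : 1 <= INR (S N + j)) by (apply (le_INR 1); lia).
  assert (Hd := Cpow_opp_integral_dist z s ltac:(lra) Hs).
  replace (a + RtoC (INR (S M)))%C with (z + 1)%C by (unfold z; rewrite S_INR, RtoC_plus; ring).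
  match goal with |- Cmod ?y <= _ => match type of IH with Cmod ?x <= _ => match type of Hd with Cmod ?w <= _ =>
    assert (E : y = (x + w)%C :> C) by (field; exact N0); rewrite E end end end.
  apply Rle_trans with (1 := Cmod_triangle _ _).
  replace (S N + S j)%nat with M by (unfold M; lia). rewrite EM. rewrite EM in Hz.
  set (y := INR (S N + j)) in *.
  assert (2 / (fst z * fst z) <= 2 * (/ y - / (y + 1))); [|lra].
  replace (/ y - / (y + 1)) with (/ (y * (y + 1))) by (field; lra).
  apply Rmult_le_compat_l. lra. apply Rinv_le_contravar; nra.
Qed.

Lemma sum_n_Csum (f : nat -> C) n : sum_n (G := C_AbelianMonoid) f n = Csum f (S n).
Proof.
induction n as [|n IH].
- rewrite sum_O. symmetry. exact (Cplus_0_l (f O)).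
- rewrite sum_Sn, IH. reflexivity.
Qed.

Lemma is_series_Clim (f : nat -> C) (l : C) :
  is_series (K := C_AbsRing) (V := C_NormedModule) f l -> Clim eventually (fun n => Csum f (S n)) l.
Proof.
intros H. apply Clim_ext with (fun n => sum_n (G := C_AbelianMonoid) f n). typeclasses eauto.
- apply filter_forall. apply sum_n_Csum.
- apply filterlim_Clim. typeclasses eauto. exact H.
Qed.

Lemma Clim_Cpow_opp_0 (a : C) s : 0 < fst a -> 0 < s -> Clim eventually (fun n => Cpow_opp (a + RtoC (INR n)) s) 0%C.
Proof.
intros Ha Hs. apply Clim_le with (fun n => exp (- (s * ln (INR n)))). typeclasses eauto.
- exists 1%nat. intros n Hn. unfold Cminus. rewrite Copp_0, Cplus_0_r, Cmod_Cpow_opp.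
  assert (H1 : 1 <= INR n) by (apply (le_INR 1); exact Hn).
  apply exp_le. assert (H := Cmod_add_INR a n Ha).
  assert (ln (INR n) <= ln (Cmod (a + RtoC (INR n)))) by (apply ln_le; lra). nra.
- apply (filterlim_comp _ _ _ INR (fun t => exp (- (s * ln t))) _ (Rbar_locally p_infty)).
  apply filterlim_INR_infty. now apply filterlim_Rpower_infty.
Qed.

(** The limit of [zeta_partial_dist] in [j]: for [s > 1] the far end of the integral vanishes, and
    the bound stays uniform in [s]. *)
Lemma zeta_dist (a : C) s N (z : C) : 0 < fst a -> 1 < s <= 2 ->
  is_series (K := C_AbsRing) (V := C_NormedModule) (fun n => Cpow_opp (a + RtoC (INR n)) s) z ->
  Cmod (z - Csum (fun n => Cpow_opp (a + RtoC (INR n)) s) (N + 2) - Cpow_opp (a + RtoC (INR (N + 2))) (s - 1) / RtoC (s - 1))%C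
   <= 2 / INR (S N).
Proof.
intros Ha Hs Hz. apply is_series_Clim in Hz.
assert (N0 : RtoC (s - 1) <> 0%C) by (apply RtoC_neq_0; lra).
set (f := fun n => Cpow_opp (a + RtoC (INR n)) s) in *.
set (P := Cpow_opp (a + RtoC (INR (N + 2))) (s - 1)).
apply (Clim_Cmod_le eventually (fun m => Csum f (S m) - Csum f (N + 2) - (/ RtoC (s - 1) * P - / RtoC (s - 1) * Cpow_opp (a + RtoC (INR (S m))) (s - 1)))%C).
- typeclasses eauto.
- eapply Clim_eq. apply Clim_minus. typeclasses eauto. apply Clim_minus. typeclasses eauto.
  exact Hz. apply Clim_const. typeclasses eauto. apply Clim_minus. typeclasses eauto. apply Clim_const. typeclasses eauto.
  apply Clim_scal. typeclasses eauto.
  intros eps He. destruct (Clim_Cpow_opp_0 a (s - 1) Ha ltac:(lra) eps He) as [M HM]. exists M. intros n Hn. apply HM. lia.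
  unfold Cdiv. ring.
- exists (N + 2)%nat. intros m Hm.
  assert (E : S m = (N + 2 + (S m - (N + 2)))%nat) by lia.
  assert (H := zeta_partial_dist a s N (S m - (N + 2)) Ha Hs). rewrite <- E in H. fold f P in H.
  replace (/ RtoC (s - 1) * P - / RtoC (s - 1) * Cpow_opp (a + RtoC (INR (S m))) (s - 1))%C
    with ((P - Cpow_opp (a + RtoC (INR (S m))) (s - 1)) / RtoC (s - 1))%C by (unfold Cdiv; ring).
  apply Rle_trans with (1 := H).
  assert (0 < INR (S N + (S m - (N + 2)))) by (apply lt_0_INR; lia).
  assert (0 < / INR (S N + (S m - (N + 2)))) by (now apply Rinv_0_lt_compat).
  unfold Rdiv. lra.
Qed.

(** Partial sums at a fixed [w0] are bounded by some [M], so single terms are at most [2 M]. At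
    [w = q w0] the terms then decrease geometrically, and the distance to [c O] is at most [4 M q],
    linear in [w]. *)
Lemma power_series_limit_0 (c : nat -> C) (F : R -> C) r : 0 < r ->
  (forall w, 0 < w < r -> is_series (K := C_AbsRing) (V := C_NormedModule) (fun n => c n * RtoC w ^ n)%C (F w)) ->
  Clim (at_right 0) F (c O).
Proof.
intros Hr H. set (w0 := r / 2). assert (Hw0 : 0 < w0 < r) by (unfold w0; lra).
destruct (filterlim_bounded (K := C_AbsRing) (V := C_NormedModule) (sum_n (fun n => c n * RtoC w0 ^ n)%C)) as [M HM].
{ exists (F w0). exact (H w0 Hw0). }
assert (HM' : forall n, Cmod (Csum (fun n => c n * RtoC w0 ^ n)%C (S n)) <= M).
{ intros n. rewrite <- sum_n_Csum. exact (HM n). }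
assert (HM0 : 0 <= M) by (apply Rle_trans with (2 := HM' O), Cmod_ge_0).
assert (HB : forall n, Cmod (c (S n)) * w0 ^ S n <= 2 * M).
{ intros n. replace (Cmod (c (S n)) * w0 ^ S n) with (Cmod (c (S n) * RtoC w0 ^ S n)%C)
    by (rewrite Cmod_mult, Cmod_pow, Cmod_R, Rabs_pos_eq by lra; reflexivity).
  replace (c (S n) * RtoC w0 ^ S n)%C with (Csum (fun n => c n * RtoC w0 ^ n)%C (S (S n)) + - Csum (fun n => c n * RtoC w0 ^ n)%C (S n))%C
    by (cbn [Csum]; ring).
  apply Rle_trans with (1 := Cmod_triangle _ _). rewrite Cmod_opp.
  assert (H1 := HM' n). assert (H2 := HM' (S n)). lra. }
apply Clim_le with (fun w => 4 * M / w0 * w). typeclasses eauto.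
- assert (Hd : 0 < w0 / 2) by lra.
  exists (mkposreal _ Hd). intros w Hw Hw1. change R in (type of w). change (Rabs (w - 0) < w0 / 2) in Hw. rewrite Rminus_0_r, Rabs_pos_eq in Hw by lra.
  assert (Hwr : 0 < w < r) by lra.
  set (q := w / w0). assert (Hq : 0 < q) by (apply Rdiv_lt_0_compat; lra).
  assert (Hq2 : q <= / 2). { unfold q. apply Rle_div_l; lra. }
  assert (Ew : w = q * w0) by (unfold q; field; lra).
  apply Rle_trans with (4 * M * q). 2:{ right. unfold q. field. lra. }
  apply (Clim_Cmod_le eventually (fun m => Csum (fun n => c n * RtoC w ^ n)%C (S m) - c O)%C).
  + typeclasses eauto.
  + apply Clim_minus. typeclasses eauto. now apply is_series_Clim, H. apply Clim_const. typeclasses eauto.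
  + apply filter_forall. intros m.
    (* A bound that the induction can carry: since [q <= 1/2], a new term [2 M q^(m+1)] fits into
       the increment [4 M (q^(m+1) - q^(m+2))]. *)
    apply Rle_trans with (4 * M * (q - q ^ S m)).
    2:{ assert (0 <= q ^ S m) by (apply pow_le; lra). nra. }
    induction m as [|m IH].
    * cbn [Csum]. assert (E : (0 + c O * RtoC w ^ 0 - c O)%C = 0%C) by (simpl; ring). rewrite E, Cmod_0. simpl. lra.
    * cbn [Csum] in IH |- *.
      match goal with |- Cmod (?x + ?y - ?z)%C <= _ => assert (E : (x + y - z)%C = (x - z + y)%C) by ring; rewrite E end.
      apply Rle_trans with (1 := Cmod_triangle _ _).
      rewrite Cmod_mult, Cmod_pow, Cmod_R, Rabs_pos_eq by lra.
      assert (Hs : Cmod (c (S m)) * w ^ S m <= 2 * M * q ^ S m).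
      { rewrite Ew, Rpow_mult_distr. assert (0 < q ^ S m) by (apply pow_lt; lra). specialize (HB m). nra. }
      assert (0 < q ^ S m) by (apply pow_lt; lra).
      replace (q ^ S (S m)) with (q * q ^ S m) by reflexivity.
      assert (0 <= M * q ^ S m) by (apply Rmult_le_pos; lra). nra.
- replace 0 with (4 * M / w0 * 0) by ring.
  apply (filterlim_filter_le_1 (F := locally 0)). rewrite Rmult_0_r. apply filter_le_within.
  apply (ex_derive_continuous (V := R_NormedModule) (fun w => 4 * M / w0 * w)). auto_derive. exact I.
Qed.

(** [N] is held fixed while [s -> 1], which the uniform bound of [zeta_dist] permits; this leaves an
    inequality in [N] alone, with [Log (a + N + 2)] in place of the logarithm of an integer until
    the last step. *)
Lemma stieltjes_0_limit (a : C) (g : nat -> C) : 0 < fst a -> is_stieltjes a g ->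
  Clim eventually (fun n => Csum (fun k => / (a + RtoC (INR k)))%C n - RtoC (ln (INR n)))%C (g O).
Proof.
intros Ha [Z [[HZ _] [r [Hr HL]]]].
assert (HZ' : forall s : R, 1 < s -> is_series (K := C_AbsRing) (V := C_NormedModule) (fun n => Cpow_opp (a + RtoC (INR n)) s) (Z (RtoC s))).
{ intros s Hs. eapply is_series_ext. 2: apply (HZ (RtoC s)); exact Hs.
  intros n. unfold Cpow_opp, Cpower. now rewrite (Cplus_comm a). }
assert (L1 : Clim (at_right 0) (fun w => Z (RtoC (1 + w)) - 1 / RtoC w)%C (g O)).
{ apply Clim_eq with (RtoC ((-1) ^ 0 / INR (fact 0)) * g O)%C.
  2:{ simpl. replace (1 / 1) with 1 by field. ring. }
  apply (power_series_limit_0 (fun n => RtoC ((-1) ^ n / INR (fact n)) * g n)%C) with r. exact Hr.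
  intros w Hw. replace (RtoC w) with (RtoC (1 + w) - 1)%C by (rewrite RtoC_plus; ring).
  apply HL. replace (RtoC (1 + w) - 1)%C with (RtoC w) by (rewrite RtoC_plus; ring).
  rewrite Cmod_R, Rabs_pos_eq; lra. }
assert (HN : forall N, Cmod (g O - (Csum (fun k => / (a + RtoC (INR k)))%C (N + 2) - Clog (a + RtoC (INR (N + 2)))))%C <= 2 / INR (S N)).
{ intros N. set (b := (a + RtoC (INR (N + 2)))%C).
  (* Subtracting the pole [1 / w] turns the tail [b^(-w) / w] into the difference quotient of
     [w -> b^(-w)] at 0, whose limit is [- Log b]. *)
  apply (Clim_Cmod_le (at_right 0) (fun w => (Z (RtoC (1 + w)) - 1 / RtoC w)
     - (Csum (fun n => Cpow_opp (a + RtoC (INR n)) (1 + w)) (N + 2) + (Cpow_opp b w - Cpow_opp b 0) / RtoC (w - 0)))%C).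
  - typeclasses eauto.
  - apply Clim_minus. typeclasses eauto. exact L1.
    apply Clim_plus. typeclasses eauto.
    + generalize (N + 2)%nat. intros n. induction n as [|n IH]; cbn [Csum].
      * apply Clim_const. typeclasses eauto.
      * apply Clim_plus. typeclasses eauto. exact IH.
        assert (Hn := pos_INR n). assert (Hz : 0 < fst (a + RtoC (INR n))%C) by (simpl; lra).
        eapply Clim_eq. eapply (cder_Clim (fun w => Cpow_opp (a + RtoC (INR n)) (1 + w)) 0). typeclasses eauto. apply at_right_le_locally.
        unfold Cpow_opp. apply cder_Cexp. apply (cder_mult (fun w => - RtoC (1 + w))%C (fun _ => Clog (a + RtoC (INR n)))).
        apply cder_opp. apply cder_RtoC. auto_derive. exact I. reflexivity. apply cder_const.
        cbv beta. rewrite Rplus_0_r. now apply Cpow_opp_1.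
    + apply cder_quotient. eapply cder_eq. unfold Cpow_opp. apply cder_Cexp. apply (cder_mult (fun w => - RtoC w)%C (fun _ => Clog b)).
      apply cder_opp, cder_id. apply cder_const.
      cbv beta. replace (- RtoC 0 * Clog b)%C with (RtoC 0) by ring. rewrite Cexp_RtoC, exp_0. ring.
  - exists (mkposreal 1 Rlt_0_1). intros w Hw Hw0. change (Rabs (w - 0) < 1) in Hw. apply Rabs_def2 in Hw.
    assert (H := zeta_dist a (1 + w) N _ Ha ltac:(lra) (HZ' (1 + w) ltac:(lra))).
    assert (Er : forall w : R, 1 + w - 1 = w) by (intros; ring). rewrite Er in H. fold b in H.
    rewrite Rminus_0_r.
    replace (Cpow_opp b 0) with (RtoC 1).
    2:{ symmetry. apply Cpow_opp_0. }
    match type of H with Cmod ?x <= _ => match goal with |- Cmod ?y <= _ =>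
      assert (E : y = x :> C) by (unfold Cdiv; ring); rewrite E end end. exact H. }
assert (L2 : Clim eventually (fun n => Csum (fun k => / (a + RtoC (INR k)))%C n - Clog (a + RtoC (INR n)))%C (g O)).
{ intros eps He. destruct (proj1 (filterlim_locally _ _) (filterlim_div_INR_S 2) (mkposreal _ He)) as [M HM].
  exists (M + 2)%nat. intros n Hn. specialize (HN (n - 2)%nat). specialize (HM (n - 2)%nat ltac:(lia)).
  replace (n - 2 + 2)%nat with n in HN by lia.
  change (Rabs (2 / INR (S (n - 2)) - 0) < eps) in HM. rewrite Rminus_0_r in HM. apply Rabs_def2 in HM.
  rewrite <- Cmod_opp, Copp_minus_distr. lra. }
eapply Clim_eq. eapply Clim_ext. typeclasses eauto.
2: apply Clim_plus; [typeclasses eauto|exact L2|].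
2:{ intros eps He. apply (filterlim_INR_infty _ (Clog_add_real_limit a eps He)). }
- apply filter_forall. intros n. cbv beta. rewrite (Cplus_comm (RtoC (INR n)) a). ring.
- ring.
Qed.

(** * Change of variable *)

(** The inverse of [t -> 1 - e^(-2 PI t)], for which [bose (tau u) = (1 - u) / u]. *)
Definition tau (u : R) : R := - ln (1 - u) / (2 * PI).

Lemma tau_bounds u : 0 < u < 1 -> 0 < tau u.
Proof.
intros Hu. assert (HP := PI_RGT_0). unfold tau. apply Rdiv_lt_0_compat; [|lra].
assert (ln (1 - u) < 0); [|lra]. rewrite <- ln_1. apply ln_increasing; lra.
Qed.

Lemma filterlim_tau_0 : filterlim tau (at_right 0) (at_right 0).
Proof.
assert (HP := PI_RGT_0). intros P [eps Heps].
assert (He : exp (- (2 * PI * eps)) < 1).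
{ rewrite <- exp_0. apply exp_increasing. assert (H := cond_pos eps). nra. }
assert (Hd : 0 < 1 - exp (- (2 * PI * eps))) by lra.
exists (mkposreal _ Hd). intros u Hu Hu0.
change (Rabs (u - 0) < 1 - exp (- (2 * PI * eps))) in Hu. rewrite Rminus_0_r, Rabs_pos_eq in Hu by lra.
assert (H1 := exp_pos (- (2 * PI * eps))).
assert (Ht := tau_bounds u ltac:(lra)).
apply Heps; [|exact Ht]. change (Rabs (tau u - 0) < eps). rewrite Rminus_0_r, Rabs_pos_eq by lra.
unfold tau. apply Rlt_div_l. lra.
assert (Hl : exp (- (2 * PI * eps)) < 1 - u) by lra.
apply ln_increasing in Hl; [|exact H1]. rewrite ln_exp in Hl. lra.
Qed.

Lemma filterlim_tau_1 : filterlim tau (at_left 1) (Rbar_locally p_infty).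
Proof.
assert (HP := PI_RGT_0). intros P [M HM].
exists (mkposreal _ (exp_pos (- (2 * PI * M)))). intros u Hu Hu1.
change (Rabs (u - 1) < exp (- (2 * PI * M))) in Hu. rewrite Rabs_left in Hu by lra.
apply HM. unfold tau. apply -> Rlt_div_r; [|lra].
assert (Hl : 1 - u < exp (- (2 * PI * M))) by lra.
apply ln_increasing in Hl; [|lra]. rewrite ln_exp in Hl. lra.
Qed.

(** Ordinary substitution on each compact interval inside []0, 1[], after which [tau] carries the
    two endpoint filters to those of the half-line. The scalar factor is the derivative of [tau]. *)
Lemma is_RInt_gen_tau (h : R -> C) (l : C) : (forall t, 0 < t -> ex_cder h t) -> is_Cint h l ->
  is_RInt_gen (V := C_R_CompleteNormedModule) (fun u => scal (/ (2 * PI * (1 - u))) (h (tau u)) : C_R_CompleteNormedModule)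
    (at_right 0) (at_left 1) l.
Proof.
intros Hh Hl. assert (HP := PI_RGT_0). apply filterlimi_locally. intros eps.
destruct (proj1 (filterlimi_locally _ _) Hl eps) as [Q S HQ HS HQS].
apply (Filter_prod _ _ _ (fun p => Q (tau p) /\ 0 < p < 1) (fun q => S (tau q) /\ 0 < q < 1)).
- apply filter_and. apply (filterlim_tau_0 Q HQ).
  exists (mkposreal 1 Rlt_0_1). intros y Hy Hy0. change (Rabs (y - 0) < 1) in Hy. apply Rabs_def2 in Hy. lra.
- apply filter_and. apply (filterlim_tau_1 S HS).
  exists (mkposreal 1 Rlt_0_1). intros y Hy Hy0. change (Rabs (y - 1) < 1) in Hy. apply Rabs_def2 in Hy. lra.
- intros p q [Hp Hp1] [Hq Hq1]. destruct (HQS _ _ Hp Hq) as [z [Hz Bz]]. exists z. split; [|exact Bz].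
  simpl in Hz |- *.
  apply (is_RInt_unique (V := C_R_CompleteNormedModule)) in Hz. rewrite <- Hz.
  assert (Hb : forall x, Rmin p q <= x <= Rmax p q -> 0 < x < 1).
  { intros x Hx. split. apply Rlt_le_trans with (2 := proj1 Hx). now apply Rmin_pos.
    apply Rle_lt_trans with (1 := proj2 Hx). now apply Rmax_lub_lt. }
  apply (is_RInt_comp (V := C_R_CompleteNormedModule) h tau (fun u => / (2 * PI * (1 - u)))).
  + intros x Hx. destruct (Hh (tau x)) as [m Hm]. apply tau_bounds, Hb, Hx.
    exact (ccont_continuous _ _ (cder_ccont _ _ _ Hm)).
  + intros x Hx. specialize (Hb x Hx). split.
    * unfold tau. auto_derive. lra. field. lra.
    * apply (ex_derive_continuous (V := R_NormedModule)). auto_derive. nra.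
Qed.

(** At [t = tau u] the two denominators are [(a - i t) / a] and [(a + i t) / a], so the bracket
    equals [i a phi a t]; the factor [1 - u] from [bose] cancels the one from the derivative of
    [tau]. *)
Lemma integrand_tau (a : C) u : 0 < fst a -> 0 < u < 1 ->
  scal (V := C_R_NormedModule) (/ (2 * PI * (1 - u))) (2 * PI * Ci * a * (phi a (tau u) * RtoC (bose (tau u))))%C =
  ((1 / (1 - RtoC (ln (1 - u)) / (2 * PI * Ci * a))
      - 1 / (1 + RtoC (ln (1 - u)) / (2 * PI * Ci * a))) / RtoC u)%C.
Proof.
intros Ha Hu. assert (HP := PI_RGT_0).
assert (E1 : bose (tau u) = (1 - u) / u).
{ unfold bose, tau. replace (2 * PI * (- ln (1 - u) / (2 * PI))) with (- ln (1 - u)) by (field; lra).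
  rewrite exp_Ropp, exp_ln by lra. field. lra. }
set (t := tau u).
assert (E2 : ln (1 - u) = - (2 * PI * t)) by (unfold t, tau; field; lra).
rewrite scal_R_Cmult. fold t in E1. rewrite E1, E2. unfold phi.
assert (N1 : (1 - RtoC u)%C <> 0%C) by (rewrite <- RtoC_minus; apply RtoC_neq_0; lra).
assert (N2 := RtoC_neq_0 u ltac:(lra)). assert (N3 := RtoC_neq_0 PI PI_neq0). assert (N4 := two_neq_0).
assert (N5 := Ci_neq_0). assert (N6 := Cneq_0_fst a Ha).
assert (N7 := up_neq_0 a t Ha). assert (N8 := down_neq_0 a t Ha).
assert (K1 : (1 - RtoC (- (2 * PI * t)) / (2 * PI * Ci * a))%C = ((a - Ci * RtoC t) / a)%C).
{ rewrite RtoC_opp, !RtoC_mult.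
  replace (a - Ci * RtoC t)%C with ((Ci * a + RtoC t) / Ci)%C.
  - field. repeat split; assumption.
  - replace (Ci * a + RtoC t)%C with (Ci * (a - Ci * RtoC t))%C by (apply injective_projections; simpl; ring).
    field. exact N5. }
assert (K2 : (1 + RtoC (- (2 * PI * t)) / (2 * PI * Ci * a))%C = ((a + Ci * RtoC t) / a)%C).
{ rewrite RtoC_opp, !RtoC_mult.
  replace (a + Ci * RtoC t)%C with ((Ci * a - RtoC t) / Ci)%C.
  - field. repeat split; assumption.
  - replace (Ci * a - RtoC t)%C with (Ci * (a + Ci * RtoC t))%C by (apply injective_projections; simpl; ring).
    field. exact N5. }
rewrite K1, K2, den_factor.
rewrite RtoC_div, RtoC_inv, !RtoC_mult, RtoC_minus by nra.
match goal with |- ?x = ?y => change (x = y :> C) end.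
field. repeat split; assumption.
Qed.

Theorem proposition1 (a : C) (gamma : nat -> C)
  (ha : 0 < Re a) (hgamma : is_stieltjes a gamma) :
  let integrand (u : R) : C :=
    ((1 / (1 - RtoC (ln (1 - u)) / (2 * PI * Ci * a))
      - 1 / (1 + RtoC (ln (1 - u)) / (2 * PI * Ci * a))) / RtoC u)%C in
  gamma O = (- digamma a)%C /\
  ex_RInt_gen (V := C_R_CompleteNormedModule)
    integrand (at_right 0) (at_left 1) /\
  (- digamma a)%C =
    (1 / (2 * a) - Clog a
     + 1 / (2 * PI * Ci * a)
       * RInt_gen (V := C_R_CompleteNormedModule)
           integrand (at_right 0) (at_left 1))%C.
Proof.
intros integrand.
assert (Ha : 0 < fst a) by exact ha.
(* The factor [2 PI i a] is the reciprocal of the prefactor in the statement, so the last term of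
   the formula is exactly [binet a]. *)
assert (HI : is_RInt_gen (V := C_R_CompleteNormedModule) integrand (at_right 0) (at_left 1) (2 * PI * Ci * a * binet a)%C).
{ eapply (is_RInt_gen_ext (V := C_R_CompleteNormedModule)).
  2: apply (is_RInt_gen_tau (fun t => 2 * PI * Ci * a * (phi a t * RtoC (bose t)))%C).
  - apply (Filter_prod _ _ _ (fun p => 0 < p < 1) (fun q => 0 < q < 1)).
    + exists (mkposreal 1 Rlt_0_1). intros y Hy Hy0. change (Rabs (y - 0) < 1) in Hy. apply Rabs_def2 in Hy. lra.
    + exists (mkposreal 1 Rlt_0_1). intros y Hy Hy0. change (Rabs (y - 1) < 1) in Hy. apply Rabs_def2 in Hy. lra.
    + simpl. intros p q Hp Hq u Hu. apply (integrand_tau a u Ha). split.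
      * apply Rlt_trans with (2 := proj1 Hu). now apply Rmin_pos.
      * apply Rlt_trans with (1 := proj2 Hu). now apply Rmax_lub_lt.
  - intros t Ht. destruct (ex_cder_phi_bose a t Ha Ht) as [m Hm]. eexists. apply cder_scal. exact Hm.
  - apply is_Cint_scal. apply (binet_spec a Ha). }
assert (Hpsi := digamma_limit a Ha).
split; [|split].
- apply (Clim_unique eventually _ _ _ _ (stieltjes_0_limit a gamma Ha hgamma) Hpsi).
- eexists. exact HI.
- rewrite (is_RInt_gen_unique (V := C_R_CompleteNormedModule) _ _ HI).
  rewrite <- (Clim_unique eventually _ _ _ _ (binet_limit a Ha) Hpsi).
  assert (N3 := RtoC_neq_0 PI PI_neq0). assert (N4 := two_neq_0).
  assert (N5 := Ci_neq_0). assert (N6 := Cneq_0_fst a Ha).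
  field. repeat split; assumption.
Qed.
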